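(* Let $n\ge5$. None of the (full) C*-algebras $A_{O_n^+}$, $A_{B_n^{\#+}}$, $A_{B_n'^+}$, $A_{B_n^+}$, $A_{H_n^+}$, $A_{S_n'^+}$, $A_{S_n^+}$ corresponding to the seven free easy quantum groups is exact.
   Context: A system $(u_{ij})_{1\le i,j\le n}$ of self-adjoint elements of a unital C*-algebra is: orthogonal if $\sum_k u_{ik}u_{jk}=\sum_k u_{ki}u_{kj}=\delta_{ij}$ for all $i,j$; cubic if orthogonal and $u_{ik}u_{jk}=u_{ki}u_{kj}=0$ whenever $i\ne j$; magic' if cubic and $\sum_k u_{ik}=\sum_k u_{kj}$ for all $i,j$ (put $r:=\sum_k u_{ik}$); magic if magic' and $r=1$; bistochastic$^\#$ if orthogonal and $\sum_k u_{ik}=\sum_k u_{kj}$ for all $i,j$ (put $r:=\sum_k u_{ik}$); bistochastic' if bistochastic$^\#$ and $u_{ij}r=ru_{ij}$ for all $i,j$; bistochastic if bistochastic' and $r=1$. $A_{O_n^+},A_{H_n^+},A_{S_n'^+},A_{S_n^+},A_{B_n^{\#+}},A_{B_n'^+},A_{B_n^+}$ are the universal unital C*-algebras generated by self-adjoint $u_{ij}$, $1\le i,j\le n$, that are respectively orthogonal, cubic, magic', magic, bistochastic$^\#$, bistochastic', bistochastic. *)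

(* Defs.v *)
From HB Require Import structures.
From mathcomp Require Import all_boot all_order all_algebra sesquilinear.
From mathcomp Require Import complex.
From mathcomp Require Import all_classical all_reals all_analysis.

Set Implicit Arguments.
Unset Strict Implicit.
Unset Printing Implicit Defensive.

Import Order.TTheory GRing.Theory Num.Theory.
Import numFieldNormedType.Exports.

Local Open Scope classical_set_scope.
Local Open Scope ring_scope.
Local Open Scope complex_scope.

(* C*-algebras, not necessarily unital. MathComp's rings are unital, so the
   product is part of the mixin; norms take their values in [R[i]]. *)
HB.mixin Record isCstarAlgebra (R : realType) A
    & CompleteNormedModule R[i] A := {
  amul : A -> A -> A ;
  adj : A -> A ;
  amulA : associative amul ;
  amulDl : left_distributive amul +%R ;
  amulDr : right_distributive amul +%R ;
  amulZl : forall (c : R[i]) (x y : A), amul (c *: x) y = c *: amul x y ;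
  amulZr : forall (c : R[i]) (x y : A), amul x (c *: y) = c *: amul x y ;
  adjK : involutive adj ;
  adjD : {morph adj : x y / x + y} ;
  adjZ : forall (c : R[i]) (x : A), adj (c *: x) = Num.conj c *: adj x ;
  adjM : forall x y : A, adj (amul x y) = amul (adj y) (adj x) ;
  norm_amul : forall x y : A, `|amul x y| <= `|x| * `|y| ;
  norm_cstar : forall x : A, `|amul (adj x) x| = `|x| ^+ 2
}.

#[short(type="cstarType")]
HB.structure Definition CstarAlgebra (R : realType) :=
  { A of isCstarAlgebra R A & CompleteNormedModule R[i] A }.

HB.mixin Record CstarAlgebra_isUnital (R : realType) A & CstarAlgebra R A := {
  aone : A ;
  amul1x : left_id aone amul ;
  amulx1 : right_id aone amul
}.

#[short(type="unitalCstarType")]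
HB.structure Definition UnitalCstarAlgebra (R : realType) :=
  { A of CstarAlgebra_isUnital R A & CstarAlgebra R A }.

Declare Scope cstar_scope.
Delimit Scope cstar_scope with cstar.
Notation "x ** y" := (amul x y) (at level 40, left associativity) : cstar_scope.
Local Open Scope cstar_scope.

HB.mixin Record isHilbertSpace (R : realType) H
    & CompleteNormedModule R[i] H := {
  hdot : {dot H for Num.conj} ;
  hdot_norm : forall x : H, hdot x x = `|x| ^+ 2
}.

#[short(type="hilbertType")]
HB.structure Definition HilbertSpace (R : realType) :=
  { H of isHilbertSpace R H & CompleteNormedModule R[i] H }.

Definition star_hom (R : realType) (A B : cstarType R) (f : A -> B) : Prop :=
  [/\ linear f,
      {morph f : x y / x ** y} &
      {morph f : x / adj x}].

Definition unital_star_hom (R : realType) (A B : unitalCstarType R)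
    (f : A -> B) : Prop :=
  star_hom f /\ f aone = aone.

Definition is_rep (R : realType) (A : cstarType R) (H : hilbertType R)
    (pi : A -> H -> H) : Prop :=
  [/\ forall a, linear (pi a) /\ continuous (pi a),
      forall (c : R[i]) a b x, pi (c *: a + b) x = c *: pi a x + pi b x,
      forall a b x, pi (a ** b) x = pi a (pi b x) &
      forall a x y, hdot (pi a x) y = hdot x (pi (adj a) y)].

Definition is_bilinear (K : fieldType) (U V W : lmodType K)
    (t : U -> V -> W) : Prop :=
  (forall v, linear (t^~ v)) /\ (forall u, linear (t u)).

(* Finite sums of elementary tensors. *)
Definition tensor_span (U V : Type) (W : zmodType) (t : U -> V -> W) : set W :=
  [set w | exists (m : nat) (u : 'I_m -> U) (v : 'I_m -> V),
             w = \sum_i t (u i) (v i)].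

Definition is_hilbert_tensor (R : realType) (H K L : hilbertType R)
    (t : H -> K -> L) : Prop :=
  [/\ is_bilinear t,
      forall x x' y y', hdot (t x y) (t x' y') = hdot x x' * hdot y y' &
      dense (tensor_span t)].

(* [M] bounds the operator norm of [\sum_i pi(a_i) (x) sigma(b_i)] on [L], the
   Hilbert space tensor product of [H] and [K] through [t]; the inequality is
   tested on the dense subspace of finite sums of elementary tensors. *)
Definition tensor_op_bound (R : realType) (A B : cstarType R)
    (H K L : hilbertType R) (t : H -> K -> L)
    (pi : A -> H -> H) (sigma : B -> K -> K)
    (m : nat) (a : 'I_m -> A) (b : 'I_m -> B) (M : R[i]) : Prop :=
  forall (p : nat) (x : 'I_p -> H) (y : 'I_p -> K),
    `|\sum_k \sum_i t (pi (a i) (x k)) (sigma (b i) (y k))|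
      <= M * `|\sum_k t (x k) (y k)|.

(* [T], with [tens : A -> B -> T], is the minimal (spatial) tensor product: the
   completion of the algebraic tensor product for the norm
   [sup ||\sum_i pi(a_i) (x) sigma(b_i)||] over all representations [pi] of [A]
   and [sigma] of [B]. The last clause says that the norm of [T] is this
   supremum, i.e. that its upper bounds are those of the operator norms. *)
Definition is_min_tensor (R : realType) (A B T : cstarType R)
    (tens : A -> B -> T) : Prop :=
  [/\ is_bilinear tens,
      forall a a' b b', tens a b ** tens a' b' = tens (a ** a') (b ** b'),
      forall a b, adj (tens a b) = tens (adj a) (adj b),
      dense (tensor_span tens) &
      forall (m : nat) (a : 'I_m -> A) (b : 'I_m -> B) (M : R[i]), 0 <= M ->
        (`|\sum_i tens (a i) (b i)| <= M <->
         forall (H K L : hilbertType R) (t : H -> K -> L)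
                (pi : A -> H -> H) (sigma : B -> K -> K),
           is_hilbert_tensor t -> is_rep pi -> is_rep sigma ->
           tensor_op_bound t pi sigma a b M)].

Definition short_exact (R : realType) (J B Q : cstarType R)
    (f : J -> B) (g : B -> Q) : Prop :=
  [/\ star_hom f, star_hom g, injective f,
      forall z, exists b, g b = z &
      forall b, g b = 0 <-> exists j, f j = b].

(* [A] is exact if tensoring minimally with [A] preserves short exact
   sequences: [F] and [G] below are [f (x) id_A] and [g (x) id_A]. Quotients and
   tensor products occur through arbitrary models, as they are determined up to
   isomorphism. *)
Definition exact_cstar (R : realType) (A : cstarType R) : Prop :=
  forall (J B Q : cstarType R) (f : J -> B) (g : B -> Q),
    short_exact f g ->
  forall (TJ TB TQ : cstarType R)
         (tJ : J -> A -> TJ) (tB : B -> A -> TB) (tQ : Q -> A -> TQ),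
    is_min_tensor tJ -> is_min_tensor tB -> is_min_tensor tQ ->
  forall (F : TJ -> TB) (G : TB -> TQ),
    star_hom F -> star_hom G ->
    (forall j a, F (tJ j a) = tB (f j) a) ->
    (forall b a, G (tB b a) = tQ (g b) a) ->
    short_exact F G.

Section Relations.
Context (R : realType) (n : nat) (A : unitalCstarType R).
Implicit Types u : 'I_n -> 'I_n -> A.

Definition orthogonal_system u : Prop :=
  [/\ forall i j, adj (u i j) = u i j,
      forall i j, \sum_k u i k ** u j k = (if i == j then aone else 0) &
      forall i j, \sum_k u k i ** u k j = (if i == j then aone else 0)].

Definition cubic_system u : Prop :=
  orthogonal_system u /\
  forall i j k, i != j -> u i k ** u j k = 0 /\ u k i ** u k j = 0.

Definition equal_sums u : Prop :=
  forall i j, \sum_k u i k = \sum_k u k j.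

(* The element [r], as the sum of an arbitrary row. *)
Definition row_sum u (i : 'I_n) : A := \sum_k u i k.

Definition magic'_system u : Prop := cubic_system u /\ equal_sums u.

Definition magic_system u : Prop :=
  magic'_system u /\ forall i, row_sum u i = aone.

Definition bistochastic_sharp_system u : Prop :=
  orthogonal_system u /\ equal_sums u.

Definition bistochastic'_system u : Prop :=
  bistochastic_sharp_system u /\
  forall i j l, u i j ** row_sum u l = row_sum u l ** u i j.

Definition bistochastic_system u : Prop :=
  bistochastic'_system u /\ forall i, row_sum u i = aone.

Definition generates u : Prop :=
  forall S : set A,
    closed S -> S aone -> (forall i j, S (u i j)) ->
    (forall (c : R[i]) x y, S x -> S y -> S (c *: x + y)) ->
    (forall x y, S x -> S y -> S (x ** y)) ->
    (forall x, S x -> S (adj x)) ->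
    S = setT.

End Relations.

(* [A] is the universal unital C*-algebra generated by elements [u i j] subject
   to [P]. *)
Definition is_universal (R : realType) (n : nat)
    (P : forall A : unitalCstarType R, ('I_n -> 'I_n -> A) -> Prop)
    (A : unitalCstarType R) (u : 'I_n -> 'I_n -> A) : Prop :=
  [/\ P A u, generates u &
      forall (B : unitalCstarType R) (v : 'I_n -> 'I_n -> B), P B v ->
        exists f : A -> B,
          unital_star_hom f /\ forall i j, f (u i j) = v i j].

Definition is_A_On (R : realType) (n : nat) :=
  is_universal (@orthogonal_system R n).
Definition is_A_Bn_sharp (R : realType) (n : nat) :=
  is_universal (@bistochastic_sharp_system R n).
Definition is_A_Bn' (R : realType) (n : nat) :=
  is_universal (@bistochastic'_system R n).
Definition is_A_Bn (R : realType) (n : nat) :=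
  is_universal (@bistochastic_system R n).
Definition is_A_Hn (R : realType) (n : nat) :=
  is_universal (@cubic_system R n).
Definition is_A_Sn' (R : realType) (n : nat) :=
  is_universal (@magic'_system R n).
Definition is_A_Sn (R : realType) (n : nat) :=
  is_universal (@magic_system R n).

(* Main.v *)
(* Let [u] generate one of the seven algebras [A]. By universality a magic unitary [U] with
   entries in [B], the algebra of bounded sequences of matrices, yields a homomorphism [A -> B].
   Put [a_ij = 1 - 2 u_ij^2]; orthogonality of [u] alone makes [a_ij] a contraction in every
   representation, and [a_ij] is sent to the symmetry [s_ij = 1 - 2 U_ij]. Let [t] be the average
   of [1 (x) 1] and of all [s_ij (x) a_ij], in [B (x) A].

   If [U] has real symmetric entries, [t] fixes in each matrix block the vector
   [Omega = sum_e delta_e (x) delta_e], because [sum_e S e (x) S e = Omega] for real symmetries [S].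
   In the quotient [Q = B / J] by the sequences tending to zero, however, [t] has norm less than
   one in [Q (x) A] as soon as conjugation by the [s_ij] has a uniform spectral gap on traceless
   matrices. Indeed [<t^m v, v>] is a sum over words of length [m]; the coefficients from [A] are
   bounded, and by Cauchy-Schwarz and the gap the words in the [s_ij] sum up in [Q] to something
   exponentially smaller than the trivial bound; log-convexity of [m |-> |t^m v|^2] turns this into
   a bound on [t].

   So [v = 1 + v t] is solvable in [Q (x) A]. Were [A] exact, a lift of [v] to [B (x) A] would
   solve the equation up to an element of [J (x) A]. Applied to [Omega] in the [k]-th block it
   reads [- Omega = o(1)], a contradiction.

   A matrix unitary with a gap is found without property (T): a traceless matrix almost commuting
   with two shears of the plane over [F_2[t]] (truncated), with a Fourier transform and with the
   sign of a top coefficient is almost diagonal by a ping-pong argument, hence almost zero because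
   the Fourier transform flattens diagonal matrices. *)

From HB Require Import structures.
From mathcomp Require Import all_boot all_order all_algebra sesquilinear.
From mathcomp Require Import complex.
From mathcomp Require Import all_classical all_reals all_analysis.
From mathcomp Require Import ring lra.
Require Import Defs.

Set Implicit Arguments.
Unset Strict Implicit.
Unset Printing Implicit Defensive.

Import Order.TTheory GRing.Theory Num.Theory.
Import numFieldNormedType.Exports.

Local Open Scope classical_set_scope.
Local Open Scope ring_scope.
Local Open Scope complex_scope.
Local Open Scope cstar_scope.

(** * Real-valued norms and completeness *)

(** Everything rests on one mismatch. Conjugation by the symmetries of a block of size [N] fixes the
    scalar matrices, that is, [Omega] read as a matrix. In the bound for words of length [m] they
    contribute [d^m / N], with [d] the number of letters. For fixed [m] this vanishes as [N] grows,
    so the quotient by null sequences forgets [Omega] while every block remembers it.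

    The rest of the bound is [mu^m], with [mu < d] by the gap. Cauchy-Schwarz over the [d^m] words
    then gives as rate the geometric mean of [d] and [mu], still below [d].

    Five is two plus three: a single projection fills a 2 x 2 magic block, and a 3 x 3 magic block
    carries the spectral projections of three symmetries. The ground field has two elements so that
    shears are involutions, hence real symmetries, as [Omega] demands.

    A contradiction with exactness needs actual models of the minimal tensor products. Their norm is
    a supremum over representations on arbitrary Hilbert spaces, which is why seminorms are handled
    through their upper bounds. *)

Section RealNorm.
Context (R : realType).
Implicit Types c z : R[i].

(** Norms take values in [R[i]]. The real numbers behind them, [cnorm] for scalars and [nm] for
    vectors, live in a totally ordered field, where [lra] and square roots are at hand. *)
Definition cnorm z : R := complex.Re `|z|.

Lemma cnormE z : `|z| = (cnorm z)%:C.
Proof. by rewrite /cnorm normc_def. Qed.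

Lemma conjcE z : Num.conj z = z^*%C.
Proof. by []. Qed.

Lemma cnorm_ge0 z : 0 <= cnorm z.
Proof. by rewrite -lecR -cnormE normr_ge0. Qed.

Lemma cnormM z w : cnorm (z * w) = cnorm z * cnorm w.
Proof. by apply: complexI; rewrite rmorphM /= -!cnormE normrM. Qed.

Lemma cnormD z w : cnorm (z + w) <= cnorm z + cnorm w.
Proof. by rewrite -lecR rmorphD /= -!cnormE ler_normD. Qed.

Lemma cnormR (x : R) : cnorm x%:C = `|x|.
Proof. by rewrite /cnorm normc_def /= expr0n addr0 sqrtr_sqr. Qed.

Lemma cnormJ z : cnorm (Num.conj z) = cnorm z.
Proof. by rewrite /cnorm norm_conjC. Qed.

Lemma cnormN z : cnorm (- z) = cnorm z.
Proof. by rewrite /cnorm normrN. Qed.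

Lemma cnorm0 : cnorm 0 = 0.
Proof. by rewrite /cnorm normr0. Qed.

Lemma cnorm1 : cnorm 1 = 1.
Proof. by rewrite /cnorm normr1. Qed.

Lemma cnorm_eq0 z : cnorm z = 0 -> z = 0.
Proof. by move=> h; apply/eqP; rewrite -normr_eq0 cnormE h. Qed.

Lemma cnorm_sq z : cnorm z ^+ 2 = complex.Re z ^+ 2 + complex.Im z ^+ 2.
Proof.
by rewrite /cnorm normc_def /= sqr_sqrtr // addr_ge0 ?sqr_ge0.
Qed.

Lemma Re_le_cnorm z : `|complex.Re z| <= cnorm z.
Proof. by rewrite -lecR -cnormE normc_ge_Re. Qed.

Lemma Im_le_cnorm z : `|complex.Im z| <= cnorm z.
Proof.
rewrite -(ler_pXn2r (n := 2)) ?nnegrE ?cnorm_ge0 ?normr_ge0 //.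
by rewrite cnorm_sq real_normK ?num_real // lerDr sqr_ge0.
Qed.

Lemma cnorm_le_ReIm z : cnorm z <= `|complex.Re z| + `|complex.Im z|.
Proof.
rewrite -(ler_pXn2r (n := 2)) ?nnegrE ?cnorm_ge0 ?addr_ge0 ?normr_ge0 //.
rewrite cnorm_sq sqrrD !real_normK ?num_real // -addrA [_ *+ 2 + _]addrC addrA.
by rewrite lerDl mulrn_wge0 // mulr_ge0.
Qed.

Section Module.
Context (V : normedModType R[i]).
Implicit Types x y : V.

Definition nm x : R := complex.Re `|x|.

Lemma nmE x : `|x| = (nm x)%:C.
Proof.
by rewrite /nm; have /(ger0_real) /RRe_real -> := normr_ge0 x.
Qed.

Lemma nm_ge0 x : 0 <= nm x.
Proof. by rewrite -lecR -nmE normr_ge0. Qed.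

Lemma nmD x y : nm (x + y) <= nm x + nm y.
Proof. by rewrite -lecR rmorphD /= -!nmE ler_normD. Qed.

Lemma nmZ c x : nm (c *: x) = cnorm c * nm x.
Proof. by apply: complexI; rewrite rmorphM /= -!nmE -cnormE normrZ. Qed.

Lemma nmN x : nm (- x) = nm x.
Proof. by rewrite /nm normrN. Qed.

Lemma nm0 : nm 0 = 0.
Proof. by rewrite /nm normr0. Qed.

Lemma nm_eq0 x : nm x = 0 -> x = 0.
Proof. by move=> h; apply/eqP; rewrite -normr_eq0 nmE h. Qed.

Lemma nm_gt0 x : x != 0 -> 0 < nm x.
Proof.
by move=> x0; rewrite lt_neqAle nm_ge0 andbT eq_sym; apply: contra_neq x0 => /nm_eq0.
Qed.

Lemma nm_sub_le x y : nm x <= nm y + nm (x - y).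
Proof. by rewrite -{1}(subrK y x) addrC nmD. Qed.

Lemma nmB x y : nm (x - y) = nm (y - x).
Proof. by rewrite -nmN opprB. Qed.

Definition seq_cauchy (u : nat -> V) :=
  forall e : R, 0 < e -> exists N, forall m n, (N <= m)%N -> (N <= n)%N ->
    nm (u m - u n) <= e.

Definition seq_limit (u : nat -> V) (x : V) :=
  forall e : R, 0 < e -> exists N, forall n, (N <= n)%N -> nm (u n - x) <= e.

Lemma nm_lt_pos (e : R[i]) : 0 < e -> exists2 r : R, 0 < r & e = r%:C.
Proof.
move=> e0; exists (complex.Re e); last by rewrite RRe_real // gtr0_real.
by rewrite -ltcR RRe_real // gtr0_real.
Qed.

(** A Cauchy filter contains balls of radius [1/(n+1)]; their centres form a Cauchy sequence, whose
    limit is a limit of the filter. Completeness of the spaces built below can thus be checked on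
    sequences. *)
Lemma seq_complete_cauchy_cvg :
  (forall u, seq_cauchy u -> exists x, seq_limit u x) ->
  forall F : set_system V, ProperFilter F -> cauchy F -> cvg F.
Proof.
move=> compl F FF Fc; have F_cauchy := (cauchyP F).1 Fc.
have inv_gt0 (n : nat) : 0 < n.+1%:R^-1 :> R by rewrite invr_gt0 ltr0n.
have /choice[u hu] : forall n : nat, exists x : V, F (ball x (n.+1%:R^-1)%:C).
  by move=> n; apply: F_cauchy; rewrite ltcR.
have uu m n : nm (u m - u n) <= m.+1%:R^-1 + n.+1%:R^-1.
  have [y [ym yn]] := filter_ex (filterI (hu m) (hu n)).
  move: ym yn; rewrite -!ball_normE /= !nmE !ltcR => ym yn.
  rewrite -(subrK y (u m)) -addrA (le_trans (nmD _ _)) // lerD // ltW //.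
  by rewrite nmB.
have arch (e : R) : 0 < e -> exists N, forall n, (N <= n)%N -> n.+1%:R^-1 <= e.
  move=> e0; exists (Num.Def.archi_bound e^-1) => n hn.
  have := archi_boundP (ltW (_ : 0 < e^-1)); rewrite invr_gt0 => /(_ e0) h.
  rewrite -[leRHS]invrK lef_pV2 ?posrE ?invr_gt0 ?ltr0n //.
  by rewrite (le_trans (ltW h)) // ler_nat leqW.
have ucauchy : seq_cauchy u.
  move=> e e0; have e20 : 0 < e / 2 by rewrite divr_gt0.
  have [N hN] := arch _ e20; exists N => m n hm hn.
  by rewrite (le_trans (uu m n)) // [leRHS]splitr lerD // hN.
have [x hx] := compl _ ucauchy.
apply/cvg_ex; exists x; apply/cvgrPdist_lt => e /nm_lt_pos [r r0 ->].
have r30 : 0 < r / 3 by rewrite divr_gt0.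
have [N1 h1] := arch _ r30; have [N2 h2] := hx _ r30.
pose n := maxn N1 N2.
apply: filterS (hu n) => y; rewrite -ball_normE /= !nmE !ltcR => hy.
have -> : x - y = (x - u n) + (u n - y) by rewrite addrA subrK.
rewrite (le_lt_trans (nmD _ _)) // nmB.
have {}h1 := h1 n (leq_maxl _ _); have {}h2 := h2 n (leq_maxr _ _).
move: (lt_le_trans hy h1) h2; set a := nm _; set b := nm _ => ha hb.
lra.
Qed.

End Module.

Lemma seq_cauchy_limit (V : completeNormedModType R[i]) (u : nat -> V) :
  seq_cauchy u -> exists x, seq_limit u x.
Proof.
move=> hu.
have /cauchy_cvg /cvg_ex [x hx] : cauchy (u @ \oo).
  apply/cauchy_ballP => e /nm_lt_pos [r r0 ->].
  have r20 : 0 < r / 2 by rewrite divr_gt0.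
  have [N hN] := hu _ r20.
  near=> p => /=; rewrite -ball_normE /= nmE ltcR.
  apply: le_lt_trans (_ : r / 2 < r); last by rewrite ltr_pdivrMr // ltr_pMr // ltr1n.
  near: p.
  exists ([set u k | k in [set k | (N <= k)%N]], [set u k | k in [set k | (N <= k)%N]]).
    by split; exists N => //= k /= hk; exists k.
  by move=> [a b] /= [[m hm <-] [n hn <-]]; exact: hN.
exists x => e e0; move/cvgrPdist_le: hx => /(_ e%:C).
rewrite ltcR => /(_ e0) [N _ hN]; exists N => n hn.
by have := hN n hn; rewrite /= nmE lecR nmB.
Unshelve. all: by end_near.
Qed.

(* Picard iteration from [0] on a closed ball around [0]. *)
Lemma ball_fixed_point (V : completeNormedModType R[i]) (f : V -> V) (r q : R) :
  0 <= r -> 0 <= q -> q < 1 ->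
  (forall x, nm x <= r -> nm (f x) <= r) ->
  (forall x y, nm x <= r -> nm y <= r -> nm (f x - f y) <= q * nm (x - y)) ->
  exists2 x, nm x <= r & f x = x.
Proof.
move=> r0 q0 q1 fr fq; pose u n := iter n f 0.
have ur n : nm (u n) <= r by elim: n => [|n ih] /=; rewrite ?nm0 // fr.
have us n : nm (u n.+1 - u n) <= q ^+ n * r.
  elim: n => [|n ih]; first by rewrite expr0 mul1r subr0.
  have := fq _ _ (ur n.+1) (ur n); rewrite -[f (u n.+1)]/(u n.+2) -[f (u n)]/(u n.+1).
  by move/le_trans; apply; rewrite exprS -mulrA ler_wpM2l.
have q1' : 0 < 1 - q by rewrite subr_gt0.
have uk n k : nm (u (n + k)%N - u n) <= q ^+ n * (r / (1 - q)).
  (* With the factor [1 - q^k] the bound is the exact partial geometric sum, which is what makes the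
     induction on [k] close. *)
  suff : nm (u (n + k)%N - u n) <= q ^+ n * (r / (1 - q)) * (1 - q ^+ k).
    move/le_trans; apply; apply: ler_piMr; last by rewrite gerBl exprn_ge0.
    by rewrite mulr_ge0 ?exprn_ge0 // divr_ge0 // ltW.
  elim: k => [|k ih]; first by rewrite addn0 subrr nm0 expr0 subrr mulr0.
  rewrite addnS.
  have -> : u (n + k).+1 - u n = (u (n + k).+1 - u (n + k)%N) + (u (n + k)%N - u n).
    by rewrite addrA subrK.
  rewrite (le_trans (nmD _ _)) // (le_trans (lerD (us _) ih)) //.
  rewrite le_eqVlt; apply/orP; left; apply/eqP.
  rewrite exprD exprS; field.
  by rewrite gt_eqF.
have uc : seq_cauchy u.
  move=> e e0.
  have [N hN] : exists N, q ^+ N * (r / (1 - q)) <= e / 2.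
    have qn : `|q| < 1 by rewrite ger0_norm.
    have h0 : (fun n => q ^+ n * (r / (1 - q))) @ \oo --> 0 * (r / (1 - q)).
      by apply: cvgM; [exact: cvg_expr | exact: cvg_cst].
    move: h0; rewrite mul0r => /cvgrPdist_le /(_ (e / 2)).
    rewrite divr_gt0 // => /(_ isT) [N _ hN]; exists N.
    have := hN N (leqnn N); rewrite /= sub0r normrN ger0_norm //.
    by rewrite mulr_ge0 ?exprn_ge0 // divr_ge0 // ltW.
  exists N => m n hm hn.
  have -> : u m - u n = (u m - u N) + (u N - u n) by rewrite addrA subrK.
  rewrite (le_trans (nmD _ _)) // [leRHS]splitr lerD //.
    by have := uk N (m - N)%N; rewrite subnKC // => /le_trans; exact.
  by rewrite nmB; have := uk N (n - N)%N; rewrite subnKC // => /le_trans; exact.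
have [x hx] := seq_cauchy_limit uc.
have xr : nm x <= r.
  apply/ler_addgt0Pr => e e0; have [N hN] := hx _ e0.
  rewrite (le_trans (nm_sub_le _ (u N))) // lerD // nmB; exact: hN.
exists x => //; apply/subr0_eq/nm_eq0/eqP; rewrite eq_le nm_ge0 andbT.
apply/ler_addgt0Pr => e e0; rewrite add0r.
have e20 : 0 < e / 2 by rewrite divr_gt0.
have [N hN] := hx _ e20.
have -> : f x - x = (f x - f (u N)) + (u N.+1 - x).
  by rewrite -[u N.+1]/(f (u N)) addrA subrK.
rewrite (le_trans (nmD _ _)) // [leRHS]splitr lerD //; last by apply: hN; exact: leqnSn.
rewrite (le_trans (fq _ _ xr (ur _))) // nmB.
by rewrite (le_trans (ler_piMl _ (ltW q1))) ?nm_ge0 // hN.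
Qed.

End RealNorm.

(** * C*-algebras as completions *)

(* A *-algebra over [R[i]], given as the part [pS] of a module, with a C*-seminorm
   described by its upper bounds [pbd]; [cq] below is its Hausdorff quotient. *)
Record preCstar (R : realType) := PreCstar {
  pV :> lmodType R[i];
  pS : pV -> Prop;
  pmul : pV -> pV -> pV;
  padj : pV -> pV;
  pbd : pV -> R -> Prop;
  pS0 : pS 0;
  pSP : forall c x y, pS x -> pS y -> pS (c *: x + y);
  pSM : forall x y, pS x -> pS y -> pS (pmul x y);
  pSJ : forall x, pS x -> pS (padj x);
  pmulA : forall x y z, pS x -> pS y -> pS z ->
    pmul x (pmul y z) = pmul (pmul x y) z;
  pmulPl : forall c x y z, pS x -> pS y -> pS z ->
    pmul (c *: x + y) z = c *: pmul x z + pmul y z;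
  pmulPr : forall c x y z, pS x -> pS y -> pS z ->
    pmul z (c *: x + y) = c *: pmul z x + pmul z y;
  padjK : forall x, pS x -> padj (padj x) = x;
  padjP : forall c x y, pS x -> pS y ->
    padj (c *: x + y) = Num.conj c *: padj x + padj y;
  padjM : forall x y, pS x -> pS y -> padj (pmul x y) = pmul (padj y) (padj x);
  pbd_ge0 : forall x M, pS x -> pbd x M -> 0 <= M;
  pbd_ex : forall x, pS x -> exists M, pbd x M;
  pbd_mono : forall x M N, pS x -> M <= N -> pbd x M -> pbd x N;
  pbdD : forall x y M N, pS x -> pS y -> pbd x M -> pbd y N -> pbd (x + y) (M + N);
  pbdZ : forall c x M, pS x -> pbd x M -> pbd (c *: x) (cnorm c * M);
  pbdM : forall x y M N, pS x -> pS y -> pbd x M -> pbd y N ->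
    pbd (pmul x y) (M * N);
  pbd_star : forall x M, pS x -> 0 <= M -> pbd (pmul (padj x) x) (M ^+ 2) -> pbd x M;
  pcomplete : forall u : nat -> pV, (forall n, pS (u n)) ->
    (forall e, 0 < e -> exists N, forall m n, (N <= m)%N -> (N <= n)%N ->
      pbd (u m - u n) e) ->
    exists2 x, pS x & forall e, 0 < e ->
      exists N, forall n, (N <= n)%N -> pbd (u n - x) e
}.

Section Quotient.
Context (R : realType) (P : preCstar R).
Implicit Types (x y z : P) (c : R[i]) (M N e : R).

Lemma pSZ c x : pS x -> pS (c *: x).
Proof. by move=> Sx; rewrite -[_ *: _]addr0; exact: pSP (pS0 P). Qed.

Lemma pSD x y : pS x -> pS y -> pS (x + y).
Proof. by move=> Sx Sy; rewrite -[x]scale1r; exact: pSP. Qed.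

Lemma pSN x : pS x -> pS (- x).
Proof. by move=> Sx; rewrite -scaleN1r; exact: pSZ. Qed.

Lemma pSB x y : pS x -> pS y -> pS (x - y).
Proof. by move=> Sx Sy; exact/pSD/pSN. Qed.

Hint Resolve pS0 : core.

Definition pnorm x : R := inf [set M | pbd x M].

Lemma pbd_has_inf x : pS x -> has_inf [set M | pbd x M].
Proof.
move=> Sx; split; first exact: pbd_ex.
by exists 0 => M; exact: pbd_ge0.
Qed.

Lemma pnorm_le x M : pS x -> pbd x M -> pnorm x <= M.
Proof. by move=> Sx h; apply: ge_inf => //; exact: (pbd_has_inf Sx).2. Qed.

Lemma pnorm_lt x M : pS x -> pnorm x < M -> pbd x M.
Proof.
move=> Sx /(inf_lt (pbd_has_inf Sx).1) [N hN /ltW NM].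
exact: pbd_mono hN.
Qed.

Lemma pnorm_ge0 x : pS x -> 0 <= pnorm x.
Proof.
move=> Sx; apply: lb_le_inf; first exact: (pbd_has_inf Sx).1.
by move=> M; exact: pbd_ge0.
Qed.

Lemma pnorm_bd x e : pS x -> 0 < e -> pbd x (pnorm x + e).
Proof. by move=> Sx e0; apply: pnorm_lt => //; rewrite ltrDl. Qed.

Lemma le_of_mul (a b c : R) : 0 <= c ->
  (forall e, 0 < e -> a <= c * (b + e)) -> a <= c * b.
Proof.
rewrite le_eqVlt => /orP [/eqP <-|c0] h; first by have := h 1 ltr01; rewrite !mul0r.
apply/ler_addgt0Pr => e e0; have := h (e / c) (divr_gt0 e0 c0).
by rewrite mulrDr mulrCA divff ?gt_eqF // mulr1.
Qed.

Lemma pnormD x y : pS x -> pS y -> pnorm (x + y) <= pnorm x + pnorm y.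
Proof.
move=> Sx Sy; apply/ler_addgt0Pr => e e0.
have e20 : 0 < e / 2 by rewrite divr_gt0.
rewrite [e]splitr addrACA; apply: pnorm_le; first exact: pSD.
by apply: pbdD => //; exact: pnorm_bd.
Qed.

Lemma pnormZ_le c x : pS x -> pnorm (c *: x) <= cnorm c * pnorm x.
Proof.
move=> Sx; apply: le_of_mul (cnorm_ge0 c) _ => e e0.
by apply: pnorm_le; [exact: pSZ | exact/pbdZ/pnorm_bd].
Qed.

Lemma pnormZ c x : pS x -> pnorm (c *: x) = cnorm c * pnorm x.
Proof.
move=> Sx; apply/eqP; rewrite eq_le pnormZ_le //=.
have [->|c0] := eqVneq c 0.
  by rewrite cnorm0 mul0r; apply: pnorm_ge0; exact: pSZ.
have := pnormZ_le c^-1 (pSZ c Sx).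
rewrite scalerA mulVf // scale1r => /(ler_wpM2l (cnorm_ge0 c)).
by rewrite mulrA -cnormM divff // cnorm1 mul1r.
Qed.

Lemma pnormN x : pS x -> pnorm (- x) = pnorm x.
Proof. by move=> Sx; rewrite -scaleN1r pnormZ // cnormN cnorm1 mul1r. Qed.

Lemma pnorm0 : pnorm (0 : P) = 0.
Proof. by rewrite -(scale0r (0 : P)) pnormZ // cnorm0 mul0r. Qed.

Lemma pnormM x y : pS x -> pS y -> pnorm (pmul x y) <= pnorm x * pnorm y.
Proof.
move=> Sx Sy; apply: le_of_mul (pnorm_ge0 Sx) _ => e e0.
rewrite mulrC; apply: le_of_mul => [|d d0]; first exact/addr_ge0/ltW/e0/pnorm_ge0.
rewrite mulrC; apply: pnorm_le; first exact: pSM.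
by apply: pbdM => //; exact: pnorm_bd.
Qed.

Lemma pnorm_star_ge x : pS x -> pnorm x ^+ 2 <= pnorm (pmul (padj x) x).
Proof.
move=> Sx; have Sxx : pS (pmul (padj x) x) by apply: pSM => //; exact: pSJ.
apply/ler_addgt0Pr => e e0; set q := pnorm _ + e.
have q0 : 0 <= q by rewrite addr_ge0 ?pnorm_ge0 // ltW.
rewrite -(sqr_sqrtr q0) ler_pXn2r ?nnegrE ?sqrtr_ge0 ?pnorm_ge0 //.
apply: pnorm_le => //; apply: pbd_star; rewrite ?sqrtr_ge0 //.
by rewrite sqr_sqrtr //; exact: pnorm_bd.
Qed.

(** The involution is not assumed isometric: the inequalities [|x|^2 <= |adj x . x| <= |adj x| |x|]
    are divided by [|x|]. *)
Lemma pnorm_adj_ge x : pS x -> pnorm x <= pnorm (padj x).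
Proof.
move=> Sx; have [->|] := eqVneq (pnorm x) 0; first exact/pnorm_ge0/pSJ.
rewrite neq_lt ltNge pnorm_ge0 //= => x0.
rewrite -(ler_pM2r x0) -expr2 (le_trans (pnorm_star_ge Sx)) //.
by apply: pnormM => //; exact: pSJ.
Qed.

Lemma pnorm_adj x : pS x -> pnorm (padj x) = pnorm x.
Proof.
move=> Sx; apply/eqP; rewrite eq_le pnorm_adj_ge // andbT.
by have := pnorm_adj_ge (pSJ Sx); rewrite padjK.
Qed.

Lemma pnorm_star x : pS x -> pnorm (pmul (padj x) x) = pnorm x ^+ 2.
Proof.
move=> Sx; apply/eqP; rewrite eq_le pnorm_star_ge // andbT.
rewrite (le_trans (pnormM (pSJ Sx) Sx)) // pnorm_adj //.
Qed.

Lemma padjZ c x : pS x -> padj (c *: x) = Num.conj c *: padj x.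
Proof.
move=> Sx; have a0 : padj (0 : P) = 0.
  have := padjP 1 (pS0 P) (pS0 P); rewrite rmorph1 !scale1r addr0.
  by move/eqP; rewrite -subr_eq subrr => /eqP <-.
by rewrite -[c *: x]addr0 padjP // a0 addr0.
Qed.

Lemma padjD x y : pS x -> pS y -> padj (x + y) = padj x + padj y.
Proof.
by move=> Sx Sy; rewrite -[x in LHS]scale1r padjP // rmorph1 scale1r.
Qed.

Lemma pmulDl x y z : pS x -> pS y -> pS z -> pmul (x + y) z = pmul x z + pmul y z.
Proof. by move=> Sx Sy Sz; rewrite -[x in LHS]scale1r pmulPl // scale1r. Qed.

Lemma pmulDr x y z : pS x -> pS y -> pS z -> pmul z (x + y) = pmul z x + pmul z y.
Proof. by move=> Sx Sy Sz; rewrite -[x in LHS]scale1r pmulPr // scale1r. Qed.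

Lemma pmulZl c x z : pS x -> pS z -> pmul (c *: x) z = c *: pmul x z.
Proof.
move=> Sx Sz; have a0 : pmul 0 z = 0.
  by have := pmulDl (pS0 P) (pS0 P) Sz; rewrite addr0 => /eqP;
    rewrite -subr_eq subrr => /eqP <-.
by rewrite -[c *: x]addr0 pmulPl // a0 addr0.
Qed.

Lemma pmulZr c x z : pS x -> pS z -> pmul z (c *: x) = c *: pmul z x.
Proof.
move=> Sx Sz; have a0 : pmul z 0 = 0.
  by have := pmulDr (pS0 P) (pS0 P) Sz; rewrite addr0 => /eqP;
    rewrite -subr_eq subrr => /eqP <-.
by rewrite -[c *: x]addr0 pmulPr // a0 addr0.
Qed.

Lemma pmulBl x y z : pS x -> pS y -> pS z -> pmul (x - y) z = pmul x z - pmul y z.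
Proof.
move=> Sx Sy Sz; rewrite pmulDl //; last exact: pSN.
by rewrite -scaleN1r pmulZl // scaleN1r.
Qed.

Lemma pmulBr x y z : pS x -> pS y -> pS z -> pmul z (x - y) = pmul z x - pmul z y.
Proof.
move=> Sx Sy Sz; rewrite pmulDr //; last exact: pSN.
by rewrite -scaleN1r pmulZr // scaleN1r.
Qed.

Lemma padjB x y : pS x -> pS y -> padj (x - y) = padj x - padj y.
Proof.
move=> Sx Sy; rewrite padjD //; last exact: pSN.
by rewrite -scaleN1r padjZ // rmorphN1 scaleN1r.
Qed.

(** The quotient by null vectors is realised inside [P]: [xget] picks one element of each class, and
    the same one for all its members because the set it chooses from is the same. *)
Definition pcanon x : P := xget 0 [set y | pS y /\ pnorm (y - x) = 0].

Lemma pcanonP x : pS x -> pS (pcanon x) /\ pnorm (pcanon x - x) = 0.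
Proof.
move=> Sx; rewrite /pcanon; case: xgetP => [y _ //|/(_ x) []].
by rewrite /= subrr pnorm0.
Qed.

Lemma pnorm0_trans x y z : pS x -> pS y -> pS z ->
  pnorm (x - y) = 0 -> pnorm (y - z) = 0 -> pnorm (x - z) = 0.
Proof.
move=> Sx Sy Sz xy yz; apply/eqP; rewrite eq_le pnorm_ge0 ?andbT; last exact: pSB.
have -> : x - z = (x - y) + (y - z) by rewrite addrA subrK.
by rewrite (le_trans (pnormD _ _)) ?xy ?yz ?addr0 //; exact: pSB.
Qed.

Lemma pnorm0_sym x y : pS x -> pS y -> pnorm (x - y) = 0 -> pnorm (y - x) = 0.
Proof. by move=> Sx Sy h; rewrite -opprB pnormN //; exact: pSB. Qed.

Lemma pcanon_eq x y : pS x -> pS y -> pnorm (x - y) = 0 -> pcanon x = pcanon y.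
Proof.
move=> Sx Sy xy; congr (xget 0 _); apply/seteqP; split => z /= [Sz h]; split=> //.
  exact: pnorm0_trans h xy.
by apply: pnorm0_trans h _ => //; exact: pnorm0_sym.
Qed.

Definition cq := {x : P | `[< pS x /\ pcanon x = x >]}.
HB.instance Definition _ := Choice.on cq.

Lemma cq_subproof x : `[< pS x >] -> `[< pS (pcanon x) /\ pcanon (pcanon x) = pcanon x >].
Proof.
move=> /asboolP Sx; apply/asboolP; have [Sc h] := pcanonP Sx; split=> //.
exact: pcanon_eq.
Qed.

(** Made total by convention: arguments outside [pS] go to the class of zero. *)
Definition cqpi x : cq :=
  match pselect (pS x) with
  | left h => exist _ (pcanon x) (cq_subproof (asboolT h))
  | right _ => exist _ (pcanon 0) (cq_subproof (asboolT (pS0 P)))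
  end.

Definition cqval (a : cq) : P := sval a.

Lemma cqvalS a : pS (cqval a).
Proof. by case: a => x /= /asboolP []. Qed.

Hint Resolve cqvalS : core.

Lemma cqpiK a : cqpi (cqval a) = a.
Proof.
case: a => x h; apply: val_inj; have /asboolP [Sx ex] := h.
by rewrite /cqpi /=; case: pselect.
Qed.

Lemma cqval_pi x : pS x -> pnorm (cqval (cqpi x) - x) = 0.
Proof.
by move=> Sx; rewrite /cqpi; case: pselect => //= _; have [] := pcanonP Sx.
Qed.

Lemma cqpi_eq x y : pS x -> pS y -> pnorm (x - y) = 0 -> cqpi x = cqpi y.
Proof.
move=> Sx Sy xy; apply: val_inj; rewrite /cqpi.
case: pselect => // hx; case: pselect => // hy; exact: pcanon_eq.
Qed.

Lemma cqpiP (a : cq) : exists2 x, pS x & a = cqpi x.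
Proof. by exists (cqval a); rewrite ?cqpiK. Qed.

Definition cqadd (a b : cq) : cq := cqpi (cqval a + cqval b).
Definition cqscale c (a : cq) : cq := cqpi (c *: cqval a).
Definition cqopp (a : cq) : cq := cqpi (- cqval a).
Definition cqmul (a b : cq) : cq := cqpi (pmul (cqval a) (cqval b)).
Definition cqadj (a : cq) : cq := cqpi (padj (cqval a)).

Lemma cqaddE x y : pS x -> pS y -> cqadd (cqpi x) (cqpi y) = cqpi (x + y).
Proof.
move=> Sx Sy; apply: cqpi_eq; [exact: pSD | exact: pSD |].
rewrite opprD addrACA; apply/eqP; rewrite eq_le pnorm_ge0 ?andbT.
  by rewrite (le_trans (pnormD _ _)) ?cqval_pi ?addr0 //; exact: pSB.
by apply: pSD; exact: pSB.
Qed.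

Lemma cqscaleE c x : pS x -> cqscale c (cqpi x) = cqpi (c *: x).
Proof.
move=> Sx; apply: cqpi_eq; [exact: pSZ | exact: pSZ |].
by rewrite -scalerBr pnormZ ?cqval_pi ?mulr0 //; exact: pSB.
Qed.

Lemma cqoppE x : pS x -> cqopp (cqpi x) = cqpi (- x).
Proof.
by move=> Sx; rewrite -scaleN1r -cqscaleE // /cqscale scaleN1r.
Qed.

Lemma cqmulE x y : pS x -> pS y -> cqmul (cqpi x) (cqpi y) = cqpi (pmul x y).
Proof.
move=> Sx Sy; set a := cqval (cqpi x); set b := cqval (cqpi y).
have Sa : pS a := cqvalS _; have Sb : pS b := cqvalS _.
apply: cqpi_eq; [exact: pSM | exact: pSM |].
have -> : pmul a b - pmul x y = pmul (a - x) b + pmul x (b - y).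
  by rewrite pmulBl // pmulBr // addrA subrK.
have Sax : pS (a - x) by exact: pSB.
have Sby : pS (b - y) by exact: pSB.
apply/eqP; rewrite eq_le pnorm_ge0 ?andbT; last by apply: pSD; exact: pSM.
rewrite (le_trans (pnormD (pSM Sax Sb) (pSM Sx Sby))) //.
rewrite (le_trans (lerD (pnormM Sax Sb) (pnormM Sx Sby))) //.
by rewrite !cqval_pi // mul0r mulr0 addr0.
Qed.

Lemma cqadjE x : pS x -> cqadj (cqpi x) = cqpi (padj x).
Proof.
move=> Sx; apply: cqpi_eq; [exact: pSJ | exact: pSJ |].
have -> : padj (cqval (cqpi x)) - padj x = padj (cqval (cqpi x) - x).
  by rewrite padjB.
by rewrite pnorm_adj ?cqval_pi //; exact: pSB.
Qed.

Lemma cqaddA : associative cqadd.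
Proof.
move=> a b c; have [x Sx ->] := cqpiP a; have [y Sy ->] := cqpiP b.
by have [z Sz ->] := cqpiP c; rewrite !cqaddE ?addrA //; exact: pSD.
Qed.

Lemma cqaddC : commutative cqadd.
Proof. by move=> a b; rewrite /cqadd addrC. Qed.

Lemma cqadd0 : left_id (cqpi 0) cqadd.
Proof. by move=> a; have [x Sx ->] := cqpiP a; rewrite cqaddE // add0r. Qed.

Lemma cqaddN : left_inverse (cqpi 0) cqopp cqadd.
Proof.
move=> a; have [x Sx ->] := cqpiP a; rewrite cqoppE // cqaddE ?addNr //.
exact: pSN.
Qed.

HB.instance Definition _ := GRing.isZmodule.Build cq cqaddA cqaddC cqadd0 cqaddN.

Lemma cqpiD x y : pS x -> pS y -> cqpi (x + y) = cqpi x + cqpi y.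
Proof. by move=> Sx Sy; rewrite -cqaddE. Qed.

Lemma cqpi0 : cqpi 0 = 0. Proof. by []. Qed.

Lemma cqscaleA a b (v : cq) : cqscale a (cqscale b v) = cqscale (a * b) v.
Proof.
by have [x Sx ->] := cqpiP v; rewrite !cqscaleE ?scalerA //; exact: pSZ.
Qed.

Lemma cqscale1 : left_id 1 cqscale.
Proof. by move=> v; have [x Sx ->] := cqpiP v; rewrite cqscaleE // scale1r. Qed.

Lemma cqscaleDr : right_distributive cqscale +%R.
Proof.
move=> c a b; have [x Sx ->] := cqpiP a; have [y Sy ->] := cqpiP b.
by rewrite -cqpiD // !cqscaleE ?scalerDr ?cqpiD //; [exact: pSZ..|exact: pSD].
Qed.

Lemma cqscaleDl v : {morph cqscale^~ v : a b / a + b}.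
Proof.
move=> a b; have [x Sx ->] := cqpiP v.
by rewrite !cqscaleE // scalerDl cqpiD //; exact: pSZ.
Qed.

HB.instance Definition _ :=
  GRing.Zmodule_isLmodule.Build R[i] cq cqscaleA cqscale1 cqscaleDr cqscaleDl.

Lemma cqpiZ c x : pS x -> cqpi (c *: x) = c *: cqpi x.
Proof. by move=> Sx; rewrite -cqscaleE. Qed.

Lemma cqpiB x y : pS x -> pS y -> cqpi (x - y) = cqpi x - cqpi y.
Proof.
by move=> Sx Sy; rewrite cqpiD //; [rewrite -[- y]scaleN1r cqpiZ // scaleN1r|exact: pSN].
Qed.

Definition cqnorm (a : cq) : R[i] := (pnorm (cqval a))%:C.

Lemma pnorm_val_pi x : pS x -> pnorm (cqval (cqpi x)) = pnorm x.
Proof.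
move=> Sx; have h := cqval_pi Sx; have Sv := cqvalS (cqpi x).
apply/eqP; rewrite eq_le; apply/andP; split.
  rewrite -{1}(subrK x (cqval _)) (le_trans (pnormD _ _)) ?h ?add0r //.
  exact: pSB.
rewrite -{1}(subrK (cqval (cqpi x)) x) (le_trans (pnormD _ _)) //; first exact: pSB.
by rewrite (pnorm0_sym _ _ h) ?add0r.
Qed.

Lemma cqnormE x : pS x -> cqnorm (cqpi x) = (pnorm x)%:C.
Proof. by move=> Sx; rewrite /cqnorm pnorm_val_pi. Qed.

Lemma cqnormD a b : cqnorm (a + b) <= cqnorm a + cqnorm b.
Proof.
have [x Sx ->] := cqpiP a; have [y Sy ->] := cqpiP b.
rewrite -cqpiD // !cqnormE //; last exact: pSD.
by rewrite -rmorphD lecR pnormD.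
Qed.

Lemma cqnormZ c a : cqnorm (c *: a) = `|c| * cqnorm a.
Proof.
have [x Sx ->] := cqpiP a; rewrite -cqpiZ // !cqnormE //; last exact: pSZ.
by rewrite pnormZ // rmorphM /= cnormE.
Qed.

Lemma cqnorm0_eq0 a : cqnorm a = 0 -> a = 0.
Proof.
have [x Sx ->] := cqpiP a; rewrite cqnormE // => /complexI h.
by rewrite -cqpi0; apply: cqpi_eq => //; rewrite subr0.
Qed.

HB.instance Definition _ :=
  Lmodule_isNormed.Build R[i] cq cqnormD cqnormZ cqnorm0_eq0.

Lemma nm_cqpi x : pS x -> nm (cqpi x) = pnorm x.
Proof. by move=> Sx; rewrite /nm -[`| _ |]/(cqnorm _) cqnormE. Qed.

Lemma cq_complete (u : nat -> cq) : seq_cauchy u -> exists l, seq_limit u l.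
Proof.
move=> uc; pose v n := cqval (u n).
have uE n : u n = cqpi (v n) by rewrite cqpiK.
have Sv n : pS (v n) := cqvalS _.
have nmu m n : nm (u m - u n) = pnorm (v m - v n).
  by rewrite !uE -cqpiB // nm_cqpi //; exact: pSB.
have [|e e0|x Sx hx] := @pcomplete _ P v.
- by move=> n.
- have e20 : 0 < e / 2 by rewrite divr_gt0.
  have [N hN] := uc _ e20; exists N => m n hm hn.
  apply: pnorm_lt; first exact: pSB.
  rewrite -nmu (le_lt_trans (hN _ _ hm hn)) //.
  by rewrite ltr_pdivrMr // ltr_pMr // ltr1n.
exists (cqpi x) => e e0; have [N hN] := hx _ e0; exists N => n hn.
by rewrite uE -cqpiB // nm_cqpi; [apply: pnorm_le; [|exact: hN] |]; exact: pSB.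
Qed.

HB.instance Definition _ := Uniform_isComplete.Build cq
  (seq_complete_cauchy_cvg cq_complete).

Lemma cqmulA : associative cqmul.
Proof.
move=> a b c; have [x Sx ->] := cqpiP a; have [y Sy ->] := cqpiP b.
by have [z Sz ->] := cqpiP c; rewrite !cqmulE ?pmulA //; exact: pSM.
Qed.

Lemma cqmulDl : left_distributive cqmul +%R.
Proof.
move=> a b c; have [x Sx ->] := cqpiP a; have [y Sy ->] := cqpiP b.
have [z Sz ->] := cqpiP c; rewrite -cqpiD // !cqmulE ?pmulDl //; last exact: pSD.
by rewrite cqpiD //; exact: pSM.
Qed.

Lemma cqmulDr : right_distributive cqmul +%R.
Proof.
move=> c a b; have [x Sx ->] := cqpiP a; have [y Sy ->] := cqpiP b.
have [z Sz ->] := cqpiP c; rewrite -cqpiD // !cqmulE ?pmulDr //; last exact: pSD.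
by rewrite cqpiD //; exact: pSM.
Qed.

Lemma cqmulZl c (a b : cq) : cqmul (c *: a) b = c *: cqmul a b.
Proof.
have [x Sx ->] := cqpiP a; have [y Sy ->] := cqpiP b.
by rewrite -cqpiZ // !cqmulE ?pmulZl ?cqpiZ //; [exact: pSM | exact: pSZ].
Qed.

Lemma cqmulZr c (a b : cq) : cqmul a (c *: b) = c *: cqmul a b.
Proof.
have [x Sx ->] := cqpiP a; have [y Sy ->] := cqpiP b.
by rewrite -cqpiZ // !cqmulE ?pmulZr ?cqpiZ //; [exact: pSM | exact: pSZ].
Qed.

Lemma cqadjK : involutive cqadj.
Proof.
by move=> a; have [x Sx ->] := cqpiP a; rewrite !cqadjE ?padjK //; exact: pSJ.
Qed.

Lemma cqadjD : {morph cqadj : a b / a + b}.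
Proof.
move=> a b; have [x Sx ->] := cqpiP a; have [y Sy ->] := cqpiP b.
by rewrite -cqpiD // !cqadjE ?padjD ?cqpiD //; [exact: pSJ..|exact: pSD].
Qed.

Lemma cqadjZ c (a : cq) : cqadj (c *: a) = Num.conj c *: cqadj a.
Proof.
have [x Sx ->] := cqpiP a; rewrite -cqpiZ // !cqadjE ?padjZ ?cqpiZ //.
  exact: pSJ.
exact: pSZ.
Qed.

Lemma cqadjM (a b : cq) : cqadj (cqmul a b) = cqmul (cqadj b) (cqadj a).
Proof.
have [x Sx ->] := cqpiP a; have [y Sy ->] := cqpiP b.
by rewrite cqmulE // !cqadjE // ?cqmulE ?padjM //; [exact: pSJ..|exact: pSM].
Qed.

Lemma cqnormM (a b : cq) : `|cqmul a b| <= `|a| * `|b|.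
Proof.
have [x Sx ->] := cqpiP a; have [y Sy ->] := cqpiP b.
rewrite cqmulE // !nmE !nm_cqpi //; last exact: pSM.
by rewrite -rmorphM lecR pnormM.
Qed.

Lemma cqnorm_star (a : cq) : `|cqmul (cqadj a) a| = `|a| ^+ 2.
Proof.
have [x Sx ->] := cqpiP a.
rewrite cqadjE // cqmulE //; last exact: pSJ.
rewrite !nmE !nm_cqpi //; last by apply: pSM => //; exact: pSJ.
by rewrite pnorm_star // rmorphXn.
Qed.

HB.instance Definition _ := isCstarAlgebra.Build R cq cqmulA cqmulDl cqmulDr
  cqmulZl cqmulZr cqadjK cqadjD cqadjZ cqadjM cqnormM cqnorm_star.

Lemma cqpiM x y : pS x -> pS y -> cqpi (pmul x y) = cqpi x ** cqpi y.
Proof. by move=> Sx Sy; rewrite -cqmulE. Qed.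

Lemma cqpiJ x : pS x -> cqpi (padj x) = adj (cqpi x).
Proof. by move=> Sx; rewrite -cqadjE. Qed.

End Quotient.

Section Models.
Context (R : realType) (P : preCstar R) (A : cstarType R) (pi : P -> A).

(** This is all that is used of a completion afterwards. The last two clauses make the norm the
    infimum of the bounds; the inequality in the second one is strict because the infimum need not
    be attained. Since the projection is a parameter, the same map also serves the unital structure
    put on the same carrier. *)
Definition cq_model : Prop :=
  [/\ forall c x y, pS x -> pS y -> pi (c *: x + y) = c *: pi x + pi y,
      (forall x y, pS x -> pS y -> pi (pmul x y) = pi x ** pi y) /\
      (forall x, pS x -> pi (padj x) = adj (pi x)),
      forall a, exists2 x, pS x & a = pi x,
      forall x M, pS x -> pbd x M -> nm (pi x) <= M &
      forall x M, pS x -> nm (pi x) < M -> pbd x M].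

Hypothesis m : cq_model.

Lemma model_lin c x y : pS x -> pS y -> pi (c *: x + y) = c *: pi x + pi y.
Proof. by case: m => h _ _ _ _; exact: h. Qed.

Lemma model_mul x y : pS x -> pS y -> pi (pmul x y) = pi x ** pi y.
Proof. by case: m => _ [h _] _ _ _; exact: h. Qed.

Lemma model_adj x : pS x -> pi (padj x) = adj (pi x).
Proof. by case: m => _ [_ h] _ _ _; exact: h. Qed.

Lemma model_surj a : exists2 x, pS x & a = pi x.
Proof. by case: m. Qed.

Lemma model_le x M : pS x -> pbd x M -> nm (pi x) <= M.
Proof. by case: m => _ _ _ h _; exact: h. Qed.

Lemma model_lt x M : pS x -> nm (pi x) < M -> pbd x M.
Proof. by case: m => _ _ _ _ h; exact: h. Qed.

Lemma model_sub x y : pS x -> pS y -> pi (x - y) = pi x - pi y.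
Proof.
move=> Sx Sy; rewrite addrC -[in LHS](scaleN1r y) model_lin // scaleN1r addrC //.
Qed.

End Models.

Lemma cq_modelP (R : realType) (P : preCstar R) : cq_model (@cqpi R P).
Proof.
split.
- move=> c x y Sx Sy; rewrite -(cqpiZ c Sx); exact: cqpiD (pSZ c Sx) Sy.
- by split=> [x y Sx Sy|x Sx]; [exact: cqpiM | exact: cqpiJ].
- exact: cqpiP.
- by move=> x M Sx; rewrite nm_cqpi //; exact: pnorm_le.
- by move=> x M Sx; rewrite nm_cqpi //; exact: pnorm_lt.
Qed.

(** * Hilbert spaces, representations and formal tensors *)

Section Hilbert.
Context (R : realType) (H : hilbertType R).
Implicit Types (x y z : H) (c : R[i]).

Lemma hdotC x y : hdot x y = Num.conj (hdot y x).
Proof. by rewrite hermC /= expr0 mul1r. Qed.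

Lemma hdotDl x y z : hdot (x + y) z = hdot x z + hdot y z.
Proof. exact: linearDl. Qed.

Lemma hdotZl c x z : hdot (c *: x) z = c * hdot x z.
Proof. by rewrite linearZl_LR. Qed.

Lemma hdotDr x y z : hdot z (x + y) = hdot z x + hdot z y.
Proof. exact: linearDr. Qed.

Lemma hdotZr c x z : hdot z (c *: x) = Num.conj c * hdot z x.
Proof. by rewrite linearZr_LR. Qed.

Lemma hdotBl x y z : hdot (x - y) z = hdot x z - hdot y z.
Proof. exact: linearBl. Qed.

Lemma hdotBr x y z : hdot z (x - y) = hdot z x - hdot z y.
Proof. exact: linearBr. Qed.

Lemma hdot0l x : hdot 0 x = 0.
Proof. exact: linear0l. Qed.

Lemma hdot0r x : hdot x 0 = 0.
Proof. exact: linear0r. Qed.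

Lemma hdot_suml (I : Type) (r : seq I) (F : I -> H) z :
  hdot (\sum_(i <- r) F i) z = \sum_(i <- r) hdot (F i) z.
Proof. exact: linear_sumlz. Qed.

Lemma hdot_sumr (I : Type) (r : seq I) (F : I -> H) z :
  hdot z (\sum_(i <- r) F i) = \sum_(i <- r) hdot z (F i).
Proof. exact: linear_sumr. Qed.

Lemma hdot_nm x : hdot x x = (nm x ^+ 2)%:C.
Proof. by rewrite hdot_norm nmE rmorphXn. Qed.

Lemma conjR (a : R) : Num.conj (a%:C) = a%:C.
Proof. by rewrite conjcE conjc_real. Qed.

Lemma mulC_conj c : c * Num.conj c = (cnorm c ^+ 2)%:C.
Proof. by rewrite -normCK cnormE rmorphXn. Qed.

(** Cauchy-Schwarz, from positivity of the squared norm of [|y|^2 x - <x, y> y]. *)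
Lemma hdot_le x y : cnorm (hdot x y) <= nm x * nm y.
Proof.
have [->|y0] := eqVneq y 0; first by rewrite hdot0r cnorm0 nm0 mulr0.
have ny : 0 < nm y ^+ 2 by rewrite exprn_gt0 // nm_gt0.
set a := hdot x y; set b := nm y ^+ 2.
have : (nm (b%:C *: x - a *: y) ^+ 2)%:C =
       (b * (b * nm x ^+ 2 - cnorm a ^+ 2))%:C.
  rewrite -hdot_nm hdotBl !hdotBr !hdotZl !hdotZr [hdot y x]hdotC -/a conjR !hdot_nm -/b.
  ring: (mulC_conj a).
move/complexI => e.
have : 0 <= b * (b * nm x ^+ 2 - cnorm a ^+ 2) by rewrite -e sqr_ge0.
rewrite pmulr_rge0 // subr_ge0 /b -exprMn => h.
rewrite -(ler_pXn2r (n := 2)) ?nnegrE ?cnorm_ge0 ?mulr_ge0 ?nm_ge0 //.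
by rewrite mulrC.
Qed.

Lemma nm_le_hdot x M : 0 <= M ->
  (forall y, cnorm (hdot x y) <= M * nm y) -> nm x <= M.
Proof.
move=> M0 /(_ x); rewrite hdot_nm cnormR ger0_norm ?sqr_ge0 // expr2.
have [->|x0] := eqVneq x 0; first by rewrite nm0.
by rewrite ler_pM2r // nm_gt0.
Qed.

End Hilbert.

(** * Square roots and automatic contractivity *)

Section Cstar.
Context (R : realType) (A : cstarType R).
Implicit Types (a b h k : A) (c : R[i]).

Lemma amul0x a : 0 ** a = 0.
Proof. by have := amulZl 0 a a; rewrite !scale0r. Qed.

Lemma amulx0 a : a ** 0 = 0.
Proof. by have := amulZr 0 a a; rewrite !scale0r. Qed.

Lemma amulNl a b : (- a) ** b = - (a ** b).
Proof. by rewrite -scaleN1r amulZl scaleN1r. Qed.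

Lemma amulNr a b : a ** (- b) = - (a ** b).
Proof. by rewrite -[- b]scaleN1r amulZr scaleN1r. Qed.

Lemma amulBl a b k : (a - b) ** k = a ** k - b ** k.
Proof. by rewrite amulDl amulNl. Qed.

Lemma amulBr a b k : k ** (a - b) = k ** a - k ** b.
Proof. by rewrite amulDr amulNr. Qed.

Lemma amul_suml (I : Type) (r : seq I) (F : I -> A) b :
  (\sum_(i <- r) F i) ** b = \sum_(i <- r) F i ** b.
Proof.
by elim: r => [|i r ih]; rewrite ?big_nil ?amul0x // !big_cons amulDl ih.
Qed.

Lemma amul_sumr (I : Type) (r : seq I) (F : I -> A) b :
  b ** (\sum_(i <- r) F i) = \sum_(i <- r) b ** F i.
Proof.
by elim: r => [|i r ih]; rewrite ?big_nil ?amulx0 // !big_cons amulDr ih.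
Qed.

Lemma nmM a b : nm (a ** b) <= nm a * nm b.
Proof. by rewrite -lecR rmorphM /= -!nmE norm_amul. Qed.

Lemma nm_star a : nm (adj a ** a) = nm a ^+ 2.
Proof. by apply: complexI; rewrite rmorphXn /= -!nmE norm_cstar. Qed.

Lemma nm_adj_ge a : nm a <= nm (adj a).
Proof.
have [->|a0] := eqVneq a 0; first by rewrite nm0 nm_ge0.
by rewrite -(ler_pM2r (nm_gt0 a0)) -expr2 -nm_star nmM.
Qed.

Lemma nm_adj a : nm (adj a) = nm a.
Proof.
by apply/eqP; rewrite eq_le nm_adj_ge andbT -{2}[a]adjK nm_adj_ge.
Qed.

Lemma adjN a : adj (- a) = - adj a.
Proof. by rewrite -scaleN1r adjZ rmorphN1 scaleN1r. Qed.

Lemma adjB a b : adj (a - b) = adj a - adj b.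
Proof. by rewrite adjD adjN. Qed.

(* [1 - h = (1 - k)^2], stated without the unit. *)
Lemma selfadjoint_sqrt h : adj h = h -> nm h < 1 ->
  exists2 k, adj k = k & h = k + k - k ** k.
Proof.
(* The equation says that [k] is fixed by [k -> (h + k k) / 2]. This map preserves the ball of
   radius [nm h] and is [nm h]-Lipschitz there. *)
move=> hh h1; pose f k := (2^-1)%:C *: (h + k ** k).
have c2 : cnorm (2^-1)%:C = 2^-1 :> R by rewrite cnormR ger0_norm.
have fr k : nm k <= nm h -> nm (f k) <= nm h.
  move=> kh; rewrite nmZ c2 mulrC ler_pdivrMr // mulr_natr mulr2n.
  rewrite (le_trans (nmD _ _)) // lerD2l (le_trans (nmM _ _)) //.
  rewrite (le_trans (ler_pM (nm_ge0 _) (nm_ge0 _) kh kh)) //.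
  by rewrite ler_piMr ?nm_ge0 // ltW.
have fq k l : nm k <= nm h -> nm l <= nm h -> nm (f k - f l) <= nm h * nm (k - l).
  move=> kh lh; rewrite -scalerBr nmZ c2 mulrC ler_pdivrMr //.
  rewrite opprD addrACA subrr add0r.
  have -> : k ** k - l ** l = k ** (k - l) + (k - l) ** l.
    by rewrite amulBl amulBr addrA subrK.
  rewrite mulr_natr mulr2n (le_trans (nmD _ _)) // lerD // (le_trans (nmM _ _)) //.
    by rewrite ler_wpM2r ?nm_ge0.
  by rewrite mulrC ler_wpM2r ?nm_ge0.
have [k kh fk] := ball_fixed_point (nm_ge0 h) (nm_ge0 h) h1 fr fq.
exists k.
  (* The adjoint is another fixed point in the same ball, and a contraction has only one. *)
  have fJ : f (adj k) = adj k.
    by rewrite -{2}fk /f adjZ adjD adjM hh conjR.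
  have := fq (adj k) k; rewrite nm_adj fJ fk => /(_ kh kh) le.
  apply/subr0_eq/nm_eq0/eqP; rewrite eq_le nm_ge0 andbT leNgt; apply/negP => n0.
  by move: le; rewrite leNgt gtr_pMl ?h1.
have -> : k + k = h + k ** k; last by rewrite addrK.
rewrite -{1 2}fk /f -scalerDl -rmorphD /=.
by have -> : 2^-1 + 2^-1 = 1 :> R; [field | rewrite scale1r].
Qed.

End Cstar.

(* An action of [A] by adjointable operators on vectors represented by [V]. *)
Lemma star_action_contract (R : realType) (A : cstarType R) (L : hilbertType R)
    (V : Type) (val : V -> L) (rho : A -> V -> V) :
  (forall c a b v, val (rho (c *: a + b) v) = c *: val (rho a v) + val (rho b v)) ->
  (forall a b v, val (rho (a ** b) v) = val (rho a (rho b v))) ->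
  (forall a v w, hdot (val (rho a v)) (val w) = hdot (val v) (val (rho (adj a) w))) ->
  forall a v, nm (val (rho a v)) <= nm a * nm (val v).
Proof.
move=> rP rM rJ a v.
have r0 w : val (rho 0 w) = 0.
  by have := rP 1 0 0 w; rewrite !scale1r addr0 => /eqP;
    rewrite -subr_eq subrr eq_sym => /eqP.
have rZ c b w : val (rho (c *: b) w) = c *: val (rho b w).
  by rewrite -[c *: b]addr0 rP r0 addr0.
have rD b b' w : val (rho (b + b') w) = val (rho b w) + val (rho b' w).
  by rewrite -[b]scale1r rP !scale1r.
have rN b w : val (rho (- b) w) = - val (rho b w) by rewrite -scaleN1r rZ scaleN1r.
have key b : nm b < 1 -> nm (val (rho b v)) <= nm (val v).
  move=> b1.
  have [|| k kk hk] := @selfadjoint_sqrt _ _ (adj b ** b).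
  - by rewrite adjM adjK.
  - by rewrite nm_star expr_lt1 // nm_ge0.
  (* With [adj b ** b = 2 k - k^2] one gets [|v|^2 - |b v|^2 = |v - k v|^2]. No boundedness of the
     action is assumed; it comes out of the existence of adjoints. *)
  rewrite -(ler_pXn2r (n := 2)) ?nnegrE ?nm_ge0 // -subr_ge0.
  suff -> : nm (val v) ^+ 2 - nm (val (rho b v)) ^+ 2 =
            nm (val v - val (rho k v)) ^+ 2 by exact: sqr_ge0.
  apply: complexI; rewrite rmorphB /= -!hdot_nm hdotBl !hdotBr.
  rewrite rJ -rM hk !rD rN !rM hdotBr hdotDr !rJ kk; ring.
(* A general [a] is divided by [nm a + e], which is positive even when [a] is zero. *)
suff h (e : R) : 0 < e -> nm (val (rho a v)) <= (nm a + e) * nm (val v).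
  rewrite mulrC; apply: le_of_mul (nm_ge0 _) _ => e e0.
  by rewrite mulrC h.
move=> e0; have n0 : 0 < nm a + e by rewrite (lt_le_trans e0) // lerDr nm_ge0.
have /key : nm (((nm a + e)^-1)%:C *: a) < 1.
  rewrite nmZ cnormR ger0_norm ?invr_ge0 ?ltW // mulrC.
  by rewrite ltr_pdivrMr // mul1r ltrDl.
by rewrite rZ nmZ cnormR ger0_norm ?invr_ge0 ?(ltW n0) // ler_pdivrMl.
Qed.

Section Representation.
Context (R : realType) (A : cstarType R) (H : hilbertType R) (pi : A -> H -> H).
Hypothesis hpi : is_rep pi.
Implicit Types (a b : A) (x y : H) (c : R[i]).

Lemma repP c a b x : pi (c *: a + b) x = c *: pi a x + pi b x.
Proof. by case: hpi. Qed.

Lemma rep0 x : pi 0 x = 0.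
Proof.
by have := repP 1 0 0 x; rewrite !scale1r addr0 => /eqP;
  rewrite -subr_eq subrr eq_sym => /eqP.
Qed.

Lemma repZ c a x : pi (c *: a) x = c *: pi a x.
Proof. by rewrite -[c *: a]addr0 repP rep0 addr0. Qed.

Lemma repD a b x : pi (a + b) x = pi a x + pi b x.
Proof. by rewrite -[a]scale1r repP !scale1r. Qed.

Lemma repN a x : pi (- a) x = - pi a x.
Proof. by rewrite -scaleN1r repZ scaleN1r. Qed.

Lemma repB a b x : pi (a - b) x = pi a x - pi b x.
Proof. by rewrite repD repN. Qed.

Lemma rep_sum (I : Type) (r : seq I) (F : I -> A) x :
  pi (\sum_(i <- r) F i) x = \sum_(i <- r) pi (F i) x.
Proof.
by elim: r => [|i r ih]; rewrite ?big_nil ?rep0 // !big_cons repD ih.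
Qed.

Lemma repM a b x : pi (a ** b) x = pi a (pi b x).
Proof. by case: hpi. Qed.

Lemma repJ a x y : hdot (pi a x) y = hdot x (pi (adj a) y).
Proof. by case: hpi. Qed.

Lemma repVP a c x y : pi a (c *: x + y) = c *: pi a x + pi a y.
Proof. by case: hpi => h _ _ _; have [hl _] := h a; exact: hl. Qed.

Lemma rep_contract a x : nm (pi a x) <= nm a * nm x.
Proof.
apply: (star_action_contract (val := id)) => *; [exact: repP|exact: repM|exact: repJ].
Qed.

End Representation.

Lemma is_rep_comp (R : realType) (A B : cstarType R) (f : A -> B)
    (H : hilbertType R) (pi : B -> H -> H) :
  star_hom f -> is_rep pi -> is_rep (fun a => pi (f a)).
Proof.
move=> [fl fM fJ] hpi; split.
- by move=> a; case: hpi => h _ _ _; exact: h.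
- by move=> c a b x; rewrite -(repP hpi) -fl.
- by move=> a b x; rewrite fM (repM hpi).
- by move=> a x y; rewrite fJ (repJ hpi).
Qed.

(** * Formal tensors acting on formal vectors *)

Section FormalTensor.
Context (R : realType) (B A : cstarType R).
Implicit Types s : seq (B * A).

Definition smul s s' : seq (B * A) :=
  [seq (q.1 ** q'.1, q.2 ** q'.2) | q <- s, q' <- s'].
Definition sadj s : seq (B * A) := [seq (adj q.1, adj q.2) | q <- s].
Definition sscale (c : R[i]) s : seq (B * A) := [seq (c *: q.1, q.2) | q <- s].

Section Action.
Context (H K L : hilbertType R) (t : H -> K -> L).
Context (pi : B -> H -> H) (sigma : A -> K -> K).
Hypotheses (ht : is_hilbert_tensor t) (hpi : is_rep pi) (hs : is_rep sigma).
Implicit Types v w : seq (H * K).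

Definition tval v : L := \sum_(p <- v) t p.1 p.2.
(** No operator on [L] is ever built: tensors act on lists of pairs, which stand for finite sums
    through [tval], and only values of [tval] are compared. *)
Definition fev s v : seq (H * K) :=
  [seq (pi q.1 p.1, sigma q.2 p.2) | q <- s, p <- v].

Lemma tens_dot x x' y y' : hdot (t x y) (t x' y') = hdot x x' * hdot y y'.
Proof. by case: ht. Qed.

Lemma tensPl c x x' y : t (c *: x + x') y = c *: t x y + t x' y.
Proof. by case: ht => -[h _] _ _; exact: h. Qed.

Lemma tensPr c x y y' : t x (c *: y + y') = c *: t x y + t x y'.
Proof. by case: ht => -[_ h] _ _; exact: h. Qed.

Lemma tens0l y : t 0 y = 0.
Proof.
by have := tensPl 1 0 0 y; rewrite !scale1r addr0 => /eqP;
  rewrite -subr_eq subrr eq_sym => /eqP.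
Qed.

Lemma tensZl c x y : t (c *: x) y = c *: t x y.
Proof. by rewrite -[c *: x]addr0 tensPl tens0l addr0. Qed.

Lemma tval_fev s v :
  tval (fev s v) = \sum_(q <- s) \sum_(p <- v) t (pi q.1 p.1) (sigma q.2 p.2).
Proof. by rewrite /tval /fev big_allpairs_dep. Qed.

Lemma tval_cat v w : tval (v ++ w) = tval v + tval w.
Proof. by rewrite /tval big_cat. Qed.

Lemma hdot_tval v w :
  hdot (tval v) (tval w) =
  \sum_(p <- v) \sum_(p' <- w) hdot p.1 p'.1 * hdot p.2 p'.2.
Proof.
rewrite /tval hdot_suml; apply: eq_bigr => p _.
by rewrite hdot_sumr; apply: eq_bigr => p' _; rewrite tens_dot.
Qed.

Lemma hdot_fev s v w :
  hdot (tval (fev s v)) (tval w) = hdot (tval v) (tval (fev (sadj s) w)).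
Proof.
rewrite !hdot_tval /fev big_allpairs_dep exchange_big; apply: eq_bigr => p _ /=.
rewrite big_allpairs_dep /sadj big_map; apply: eq_bigr => q _.
by apply: eq_bigr => p' _; rewrite (repJ hpi) (repJ hs).
Qed.

Lemma fev_smul s s' v : tval (fev (smul s s') v) = tval (fev s (fev s' v)).
Proof.
rewrite !tval_fev /smul big_allpairs_dep; apply: eq_bigr => q _.
rewrite /fev big_allpairs_dep; apply: eq_bigr => q' _; apply: eq_bigr => p _ /=.
by rewrite (repM hpi) (repM hs).
Qed.

Lemma fev_cat s s' v : tval (fev (s ++ s') v) = tval (fev s v) + tval (fev s' v).
Proof. by rewrite !tval_fev big_cat. Qed.

Lemma fev_scale c s v : tval (fev (sscale c s) v) = c *: tval (fev s v).
Proof.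
rewrite !tval_fev /sscale big_map scaler_sumr; apply: eq_bigr => q _.
rewrite scaler_sumr; apply: eq_bigr => p _ /=.
by rewrite (repZ hpi) tensZl.
Qed.

(** The action of [b (x) a] is that of [1 (x) a] followed by that of [b (x) 1]. Each one-sided
    action is by adjointable operators on lists, hence contractive by [star_action_contract]. *)
Lemma fev1_contract b a v :
  nm (tval (fev [:: (b, a)] v)) <= nm b * nm a * nm (tval v).
Proof.
pose l (b : B) v := [seq (pi b p.1, p.2) | p <- v].
pose r (a : A) v := [seq (p.1, sigma a p.2) | p <- v].
have -> : fev [:: (b, a)] v = l b (r a v).
  by rewrite /fev /= cats0 /l /r -map_comp.
have lb w : nm (tval (l b w)) <= nm b * nm (tval w).
  apply: (star_action_contract (val := tval)) => [c b1 b2 u|b1 b2 u|b1 u u'].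
  - rewrite /tval !big_map scaler_sumr -big_split; apply: eq_bigr => p _ /=.
    by rewrite (repP hpi) tensPl.
  - by rewrite /tval !big_map; apply: eq_bigr => p _ /=; rewrite (repM hpi).
  - rewrite !hdot_tval !big_map; apply: eq_bigr => p _.
    by rewrite big_map; apply: eq_bigr => p' _; rewrite (repJ hpi).
have ra w : nm (tval (r a w)) <= nm a * nm (tval w).
  apply: (star_action_contract (val := tval)) => [c b1 b2 u|b1 b2 u|b1 u u'].
  - rewrite /tval !big_map scaler_sumr -big_split; apply: eq_bigr => p _ /=.
    by rewrite (repP hs) tensPr.
  - by rewrite /tval !big_map; apply: eq_bigr => p _ /=; rewrite (repM hs).
  - rewrite !hdot_tval !big_map; apply: eq_bigr => p _.
    by rewrite big_map; apply: eq_bigr => p' _; rewrite (repJ hs).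
by rewrite (le_trans (lb _)) // -mulrA ler_wpM2l ?nm_ge0.
Qed.

Lemma fev_contract s v :
  nm (tval (fev s v)) <= (\sum_(q <- s) nm q.1 * nm q.2) * nm (tval v).
Proof.
elim: s => [|[b a] s ih].
  by rewrite tval_fev !big_nil nm0 mul0r.
rewrite -cat1s fev_cat big_cat mulrDl (le_trans (nmD _ _)) // lerD //.
by rewrite big_seq1 fev1_contract.
Qed.

End Action.
End FormalTensor.

(** * The minimal tensor product *)

Section Staircase.
Context (R : realType) (V : zmodType) (bd : nat -> V -> R -> Prop).
Hypothesis bdD : forall k x y z e f, bd k (x - y) e -> bd k (y - z) f -> bd k (x - z) (e + f).
Hypothesis bd_mono : forall k x M N, M <= N -> bd k x M -> bd k x N.

(* The diagonal sequence follows [u (n j)] between the thresholds [K j] and [K j.+1]. *)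
Lemma staircase_limit (u : nat -> nat -> V) :
  (forall e, 0 < e -> exists N, forall m n, (N <= m)%N -> (N <= n)%N ->
     exists K, forall k, (K <= k)%N -> bd k (u m k - u n k) e) ->
  exists2 x : nat -> V, (forall k, exists n, x k = u n k) &
  forall e, 0 < e -> exists N, forall n, (N <= n)%N ->
    exists K, forall k, (K <= k)%N -> bd k (u n k - x k) e.
Proof.
move=> uc; pose e_ (j : nat) : R := j.+1%:R^-1.
have e_gt0 j : 0 < e_ j by rewrite invr_gt0 ltr0n.
have /choice [N hN] : forall j, exists N, forall m n, (N <= m)%N -> (N <= n)%N ->
    exists K, forall k, (K <= k)%N -> bd k (u m k - u n k) (e_ j).
  by move=> j; exact: uc.
(* The index [n_ j] is admissible for all precisions [e_ i] with [i <= j] at once. Beyond [K (i, j)]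
   the sequences number [n_ i] and [n_ j] agree up to [e_ i]. *)
pose n_ j := (\max_(i < j.+1) N i)%N.
have n_ge i j : (i <= j)%N -> (N i <= n_ j)%N.
  move=> ij; exact: (@leq_bigmax _ (fun i : 'I_j.+1 => N i) (Ordinal (ij : (i < j.+1)%N))).
have /choice [K hK] : forall p : nat * nat, exists K, (p.1 <= p.2)%N ->
    forall k, (K <= k)%N -> bd k (u (n_ p.1) k - u (n_ p.2) k) (e_ p.1).
  move=> [i j] /=; case: (leqP i j) => ij; last by exists 0%N.
  by have [K hK] := hN i (n_ i) (n_ j) (n_ge _ _ (leqnn _)) (n_ge _ _ ij); exists K.
pose T j := maxn j (\max_(i < j.+1) K (i : nat, j)).
have TK i j : (i <= j)%N -> (K (i, j) <= T j)%N.
  move=> ij; rewrite leq_max; apply/orP; right.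
  exact: (@leq_bigmax _ (fun i : 'I_j.+1 => K (i : nat, j)) (Ordinal (ij : (i < j.+1)%N))).
have Tj j : (j <= T j)%N by rewrite leq_maxl.
(* The last stage whose threshold has been passed at [k]. Since [j <= T j], looking at [j <= k] is
   enough; the default zero before the first threshold is harmless, as only large [k] matter. *)
pose J k := (\max_(j < k.+1 | T j <= k) j)%N.
have JP i k : (T i <= k)%N -> (i <= J k)%N /\ (T (J k) <= k)%N.
  move=> Tik; have ik : (i < k.+1)%N by rewrite ltnS (leq_trans (Tj i)).
  split.
    exact: (@leq_bigmax_cond _ (fun j : 'I_k.+1 => T j <= k)%N (fun j => j) (Ordinal ik)).
  pose Q := [pred j : 'I_k.+1 | (T j <= k)%N].
  have /(eq_bigmax_cond (fun j : 'I_k.+1 => j : nat)) [j Qj eJ] : (0 < #|Q|)%N.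
    by apply/card_gt0P; exists (Ordinal ik).
  have -> : J k = j by rewrite -eJ; exact: eq_bigl.
  exact: Qj.
exists (fun k => u (n_ (J k)) k) => [k|e e0]; first by exists (n_ (J k)).
have [i hi] : exists i, e_ i + e_ i <= e.
  exists (Num.Def.archi_bound (2 / e)); set b := Num.Def.archi_bound _.
  have := archi_boundP (ltW (divr_gt0 (ltr0n R 2) e0 : 0 < 2 / e)); rewrite -/b => h.
  rewrite -mulr2n -[_ *+ 2]mulr_natl /e_ ler_pdivrMr ?ltr0n //.
  rewrite mulrC -ler_pdivrMr // (le_trans (ltW h)) // ler_nat; exact: leqnSn.
exists (N i) => n hn; have [K1 hK1] := hN i n (n_ i) hn (n_ge _ _ (leqnn _)).
exists (maxn K1 (T i)) => k; rewrite geq_max => /andP [k1 k2].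
apply: (bd_mono hi); have [iJ TJ] := JP _ _ k2.
apply: bdD (hK1 _ k1) _; apply: (hK (i, J k)) => //=.
exact: leq_trans (TK _ _ iJ) TJ.
Qed.

End Staircase.

Section MinTensor.
Context (R : realType) (B A : cstarType R).

(* An element of the free vector space on [B * A], as a functional on all maps
   [B -> A -> R[i]]. *)
Definition ften := (B -> A -> R[i]) -> R[i]^o.
Implicit Types (phi psi chi : ften) (M N : R).

Definition fdn (s : seq (R[i] * B * A)) : ften :=
  fun beta => \sum_(q <- s) q.1.1 * beta q.1.2 q.2.

Definition isf phi := exists s, phi = fdn s.

Definition fmul phi psi : ften := fun beta =>
  phi (fun b a => psi (fun b' a' => beta (b ** b') (a ** a'))).
Definition fadj phi : ften := fun beta =>
  Num.conj (phi (fun b a => Num.conj (beta (adj b) (adj a)))).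

Definition uncoef (s : seq (R[i] * B * A)) : seq (B * A) :=
  [seq (q.1.1 *: q.1.2, q.2) | q <- s].

Definition cform (H K L : hilbertType R) (t : H -> K -> L) (pi : B -> H -> H)
    (sigma : A -> K -> K) v w (b : B) (a : A) : R[i] :=
  hdot (tval t (fev pi sigma [:: (b, a)] v)) (tval t w).

(** A formal tensor is a functional on scalar maps, so an operator bound is tested on the matrix
    coefficients [<. v, w>] of all pairs of representations. Only upper bounds are named, never the
    supremum itself. *)
Definition fbd phi M := 0 <= M /\
  forall (H K L : hilbertType R) (t : H -> K -> L) pi sigma,
    is_hilbert_tensor t -> is_rep pi -> is_rep sigma -> forall v w,
    cnorm (phi (cform t pi sigma v w)) <= M * nm (tval t v) * nm (tval t w).

Lemma fdn_cform (H K L : hilbertType R) (t : H -> K -> L) pi sigma v w s :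
  is_hilbert_tensor t -> is_rep pi -> is_rep sigma ->
  fdn s (cform t pi sigma v w) =
  hdot (tval t (fev pi sigma (uncoef s) v)) (tval t w).
Proof.
move=> ht hpi hs; rewrite tval_fev /uncoef big_map hdot_suml.
apply: eq_bigr => q _ /=; rewrite /cform -hdotZl; congr (hdot _ _).
rewrite tval_fev big_seq1 scaler_sumr; apply: eq_bigr => p _ /=.
by rewrite (repZ hpi) (tensZl ht).
Qed.

Lemma fbd_fdn s M : 0 <= M ->
  fbd (fdn s) M <->
  forall (H K L : hilbertType R) (t : H -> K -> L) pi sigma,
    is_hilbert_tensor t -> is_rep pi -> is_rep sigma -> forall v,
    nm (tval t (fev pi sigma (uncoef s) v)) <= M * nm (tval t v).
Proof.
move=> M0; split=> [[_ h] H K L t pi sigma ht hpi hs v|h].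
  have Mv : 0 <= M * nm (tval t v) by rewrite mulr_ge0 ?nm_ge0.
  have := h H K L t pi sigma ht hpi hs v (fev pi sigma (uncoef s) v).
  rewrite fdn_cform // hdot_nm cnormR ger0_norm ?sqr_ge0 // expr2.
  have [->|x0] := eqVneq (tval t (fev pi sigma (uncoef s) v)) 0; first by rewrite nm0.
  by rewrite ler_pM2r // nm_gt0.
split=> // H K L t pi sigma ht hpi hs v w.
rewrite fdn_cform // (le_trans (hdot_le _ _)) // ler_wpM2r ?nm_ge0 //.
exact: h.
Qed.

Lemma fdn_ex s : exists M, fbd (fdn s) M.
Proof.
exists (\sum_(q <- uncoef s) nm q.1 * nm q.2); apply/fbd_fdn.
  by apply: sumr_ge0 => q _; rewrite mulr_ge0 ?nm_ge0.
by move=> H K L t pi sigma ht hpi hs v; exact: fev_contract.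
Qed.

Lemma fdn_lin s c (be be' : B -> A -> R[i]) :
  fdn s (fun b a => c * be b a + be' b a) = c * fdn s be + fdn s be'.
Proof.
rewrite /fdn mulr_sumr -big_split; apply: eq_bigr => q _ /=.
by rewrite mulrDr mulrCA.
Qed.

Lemma isf0 : isf 0.
Proof. by exists [::]; apply/funext => be; rewrite /fdn big_nil. Qed.

Lemma isfP c phi psi : isf phi -> isf psi -> isf (c *: phi + psi).
Proof.
move=> [s ->] [s' ->]; exists ([seq (c * q.1.1, q.1.2, q.2) | q <- s] ++ s').
apply/funext => be; rewrite /fdn big_cat big_map /=.
congr (_ + _); rewrite -[LHS]/(c * _) mulr_sumr.
by apply: eq_bigr => q _; rewrite mulrA.
Qed.

Lemma isfM phi psi : isf phi -> isf psi -> isf (fmul phi psi).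
Proof.
move=> [s ->] [s' ->].
exists [seq (q.1.1 * q'.1.1, q.1.2 ** q'.1.2, q.2 ** q'.2) | q <- s, q' <- s'].
apply/funext => be; rewrite /fmul /fdn big_allpairs_dep; apply: eq_bigr => q _.
by rewrite mulr_sumr; apply: eq_bigr => q' _ /=; rewrite mulrA.
Qed.

Lemma isfJ phi : isf phi -> isf (fadj phi).
Proof.
move=> [s ->]; exists [seq (Num.conj q.1.1, adj q.1.2, adj q.2) | q <- s].
apply/funext => be; rewrite /fadj /fdn big_map rmorph_sum; apply: eq_bigr => q _ /=.
by rewrite rmorphM /= conjCK.
Qed.

Lemma fmulA phi psi chi : fmul phi (fmul psi chi) = fmul (fmul phi psi) chi.
Proof.
apply/funext => be; rewrite /fmul; congr phi; apply/funext => b; apply/funext => a.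
congr psi; apply/funext => b'; apply/funext => a'.
by congr chi; apply/funext => b2; apply/funext => a2; rewrite !amulA.
Qed.

Lemma fmulPl c phi psi chi : fmul (c *: phi + psi) chi = c *: fmul phi chi + fmul psi chi.
Proof. by []. Qed.

Lemma fmulPr c phi psi chi : isf chi ->
  fmul chi (c *: phi + psi) = c *: fmul chi phi + fmul chi psi.
Proof. by move=> [s ->]; apply/funext => be; rewrite /fmul -[RHS]fdn_lin. Qed.

Lemma fadjK phi : fadj (fadj phi) = phi.
Proof.
apply/funext => be; rewrite /fadj conjCK; congr phi.
by apply/funext => b; apply/funext => a; rewrite !adjK conjCK.
Qed.

Lemma fadjP c phi psi : fadj (c *: phi + psi) = Num.conj c *: fadj phi + fadj psi.
Proof.
by apply/funext => be; rewrite /fadj -[RHS]/(_ * _ + _) -rmorphM -rmorphD.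
Qed.

Lemma fadjM phi psi : isf phi -> isf psi ->
  fadj (fmul phi psi) = fmul (fadj psi) (fadj phi).
Proof.
move=> [s ->] [s' ->]; apply/funext => be; rewrite /fadj /fmul /fdn.
congr Num.conj.
transitivity (\sum_(q <- s) \sum_(q' <- s') q.1.1 * (q'.1.1 *
    Num.conj (be (adj (q.1.2 ** q'.1.2)) (adj (q.2 ** q'.2))))).
  by apply: eq_bigr => q _; rewrite mulr_sumr.
rewrite exchange_big; apply: eq_bigr => q' _; rewrite conjCK mulr_sumr.
by apply: eq_bigr => q _; rewrite mulrCA !adjM.
Qed.

Lemma fbd_mono phi M N : M <= N -> fbd phi M -> fbd phi N.
Proof.
move=> MN [M0 h]; split=> [|H K L t pi sigma ht hpi hs v w]; first exact: le_trans MN.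
by rewrite (le_trans (h _ _ _ _ _ _ ht hpi hs v w)) // !ler_wpM2r ?nm_ge0.
Qed.

Lemma fbdD phi psi M N : fbd phi M -> fbd psi N -> fbd (phi + psi) (M + N).
Proof.
move=> [M0 h] [N0 k]; split=> [|H K L t pi sigma ht hpi hs v w]; first exact: addr_ge0.
rewrite (le_trans (cnormD _ _)) // !mulrDl lerD //; [exact: h | exact: k].
Qed.

Lemma fbdZ c phi M : fbd phi M -> fbd (c *: phi) (cnorm c * M).
Proof.
move=> [M0 h]; split=> [|H K L t pi sigma ht hpi hs v w].
  by rewrite mulr_ge0 ?cnorm_ge0.
rewrite -[(c *: phi) _]/(c * _) cnormM -!mulrA ler_wpM2l ?cnorm_ge0 // mulrA.
exact: h.
Qed.

Lemma fbdM phi psi M N : isf phi -> isf psi -> fbd phi M -> fbd psi N ->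
  fbd (fmul phi psi) (M * N).
Proof.
move=> [s ->] [s' ->] bM bN; have [M0 _] := bM; have [N0 _] := bN.
split=> [|H K L t pi sigma ht hpi hs v w]; first exact: mulr_ge0.
have -> : fmul (fdn s) (fdn s') (cform t pi sigma v w) =
    fdn s (cform t pi sigma (fev pi sigma (uncoef s') v) w).
  rewrite /fmul; congr fdn; apply/funext => b; apply/funext => a.
  rewrite {2}/cform hdot_fev // -fdn_cform // /fdn; apply: eq_bigr => q' _ /=.
  congr (_ * _); rewrite /cform -[[:: (_ ** _, _)]]/(smul [:: (b, a)] [:: (q'.1.2, q'.2)]).
  by rewrite fev_smul // hdot_fev.
rewrite fdn_cform // (le_trans (hdot_le _ _)) // ler_wpM2r ?nm_ge0 //.
rewrite (le_trans ((fbd_fdn s M0).1 bM _ _ _ _ _ _ ht hpi hs _)) // -mulrA ler_wpM2l //.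
exact: ((fbd_fdn s' N0).1 bN).
Qed.

Lemma fadj_cform phi (H K L : hilbertType R) (t : H -> K -> L) pi sigma v w :
  is_hilbert_tensor t -> is_rep pi -> is_rep sigma -> 
  fadj phi (cform t pi sigma v w) = Num.conj (phi (cform t pi sigma w v)).
Proof.
move=> ht hpi hs; rewrite /fadj; congr (Num.conj (phi _)).
apply/funext => b; apply/funext => a; rewrite /cform -hdotC.
by rewrite hdot_fev //= -[_ w in LHS]/(tval _ _) !adjK.
Qed.

Lemma fbdJ phi M : fbd phi M -> fbd (fadj phi) M.
Proof.
move=> [M0 h]; split=> // H K L t pi sigma ht hpi hs v w.
by rewrite fadj_cform // cnormJ mulrAC h.
Qed.

Lemma fbd_star phi M : isf phi -> 0 <= M -> fbd (fmul (fadj phi) phi) (M ^+ 2) ->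
  fbd phi M.
Proof.
move=> [s ->] M0 [_ h]; apply/fbd_fdn => // H K L t pi sigma ht hpi hs v.
have hv := h H K L t pi sigma ht hpi hs v v.
rewrite -(ler_pXn2r (n := 2)) ?nnegrE ?mulr_ge0 ?nm_ge0 // exprMn [X in _ * X]expr2 mulrA.
apply: le_trans hv.
suff -> : fmul (fadj (fdn s)) (fdn s) (cform t pi sigma v v) =
    (nm (tval t (fev pi sigma (uncoef s) v)) ^+ 2)%:C.
  by rewrite cnormR ger0_norm ?sqr_ge0.
have -> : fmul (fadj (fdn s)) (fdn s) (cform t pi sigma v v) =
    fadj (fdn s) (cform t pi sigma (fev pi sigma (uncoef s) v) v).
  rewrite /fmul; congr fadj; apply/funext => b; apply/funext => a.
  rewrite {2}/cform hdot_fev // -fdn_cform // /fdn; apply: eq_bigr => q' _ /=.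
  congr (_ * _); rewrite /cform -[[:: (_ ** _, _)]]/(smul [:: (b, a)] [:: (q'.1.2, q'.2)]).
  by rewrite fev_smul // hdot_fev.
by rewrite fadj_cform // fdn_cform // -hdotC hdot_nm.
Qed.

End MinTensor.

Section MinTensorAlgebra.
Context (R : realType) (B A : cstarType R).
Implicit Types (x y : nat -> ften B A) (M : R).

Definition tcauchy x := forall e : R, 0 < e ->
  exists N, forall m n, (N <= m)%N -> (N <= n)%N -> fbd (x m - x n) e.
Definition tS x := (forall n, isf (x n)) /\ tcauchy x.
(** For a Cauchy sequence the infimum of the eventual bounds is the limit of the norms, so the
    quotient of these sequences by null sequences is the completion. *)
Definition tbd x M := exists N, forall n, (N <= n)%N -> fbd (x n) M.
Definition tmul x y : nat -> ften B A := fun n => fmul (x n) (y n).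
Definition tadj x : nat -> ften B A := fun n => fadj (x n).

Lemma fbd0 (phi : ften B A) : isf phi -> fbd (0 : ften B A) 0.
Proof.
move=> _; have [M hM] := fdn_ex ([::] : seq (R[i] * B * A)).
by have := fbdZ 0 hM; rewrite scale0r cnorm0 mul0r.
Qed.

Lemma isfB (phi psi : ften B A) : isf phi -> isf psi -> isf (phi - psi).
Proof. by move=> h k; rewrite addrC -scaleN1r; exact: isfP. Qed.

Lemma fbdN (phi : ften B A) M : fbd phi M -> fbd (- phi) M.
Proof. by move=> /(fbdZ (-1)); rewrite scaleN1r cnormN cnorm1 mul1r. Qed.

Lemma fbdB (phi psi chi : ften B A) (M N : R) :
  fbd (phi - psi) M -> fbd (psi - chi) N -> fbd (phi - chi) (M + N).
Proof. by move=> h k; have := fbdD h k; rewrite addrA subrK. Qed.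

Lemma tbd_ex x : tS x -> exists M, tbd x M.
Proof.
move=> [xf /(_ 1 ltr01) [N hN]]; have [s hs] := xf N.
have [M hM] := fdn_ex s; exists (1 + M), N => n hn.
rewrite -[x n](subrK (x N)); apply: fbdD; first exact: hN.
by rewrite hs.
Qed.

Lemma tbdD x y (M N : R) : tbd x M -> tbd y N -> tbd (x + y) (M + N).
Proof.
move=> [K hK] [K' hK']; exists (maxn K K') => n; rewrite geq_max => /andP [k k'].
by apply: fbdD; [exact: hK | exact: hK'].
Qed.

Lemma tbdM x y (M N : R) : tS x -> tS y -> tbd x M -> tbd y N -> tbd (tmul x y) (M * N).
Proof.
move=> [xf _] [yf _] [K hK] [K' hK']; exists (maxn K K') => n.
rewrite geq_max => /andP [k k'].
by apply: fbdM; [exact: xf | exact: yf | exact: hK | exact: hK'].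
Qed.

Lemma tS0 : tS 0.
Proof.
split=> [n|e e0]; first exact: isf0.
exists 0%N => m n _ _; rewrite subrr; apply: fbd_mono (ltW e0) _.
exact: fbd0 (isf0 B A).
Qed.

Lemma tSP c x y : tS x -> tS y -> tS (c *: x + y).
Proof.
move=> [xf xc] [yf yc]; split=> [n|e e0]; first exact: isfP.
have c1 : 0 < cnorm c + 1 by rewrite ltr_wpDl // cnorm_ge0.
have e1 : 0 < e / 2 / (cnorm c + 1) by rewrite !divr_gt0.
have [K hK] := xc _ e1; have [K' hK'] := yc (e / 2) (divr_gt0 e0 (ltr0n _ 2)).
exists (maxn K K') => m n; rewrite !geq_max => /andP [m1 m2] /andP [n1 n2].
have -> : (c *: x + y) m - (c *: x + y) n = c *: (x m - x n) + (y m - y n).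
  by rewrite scalerBr opprD addrACA.
rewrite [e]splitr; apply: fbdD (hK' _ _ m2 n2).
apply: fbd_mono (fbdZ c (hK _ _ m1 n1)).
rewrite mulrA ler_pdivrMr // mulrC ler_wpM2l ?divr_ge0 ?(ltW e0) //.
by rewrite lerDl.
Qed.

Lemma tSM x y : tS x -> tS y -> tS (tmul x y).
Proof.
move=> Sx Sy; have [xf xc] := Sx; have [yf yc] := Sy.
split=> [n|e e0]; first exact: isfM.
have [M [K hK]] := tbd_ex Sx; have [N [K' hK']] := tbd_ex Sy.
have M0 : 0 <= M by have [] := hK K (leqnn _).
have N0 : 0 <= N by have [] := hK' K' (leqnn _).
have MN : 0 < M + N + 1 by rewrite ltr_wpDl // addr_ge0.
have e1 : 0 < e / (M + N + 1) by rewrite divr_gt0.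
have [K1 h1] := xc _ e1; have [K2 h2] := yc _ e1.
exists (maxn (maxn K K') (maxn K1 K2)) => m n; rewrite !geq_max.
move=> /andP [/andP [m1 m2] /andP [m3 m4]] /andP [/andP [n1 n2] /andP [n3 n4]].
have -> : tmul x y m - tmul x y n =
    fmul (x m) (y m - y n) + fmul (x m - x n) (y n).
  have -> : y m - y n = -1 *: y n + y m by rewrite scaleN1r addrC.
  have -> : x m - x n = -1 *: x n + x m by rewrite scaleN1r addrC.
  rewrite fmulPr; last exact: xf.
  rewrite fmulPl !scaleN1r /tmul [- fmul (x m) _ + _]addrC -addrA; congr (_ + _).
  by rewrite addrCA addNr addr0.
apply: (@fbd_mono _ _ _ _ (M * (e / (M + N + 1)) + e / (M + N + 1) * N)).
  rewrite [X in _ + X]mulrC -mulrDl mulrA ler_pdivrMr // mulrC ler_wpM2l ?(ltW e0) //.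
  by rewrite lerDl.
apply: fbdD; apply: fbdM => //; do ?[exact: isfB|exact: hK|exact: hK'].
  exact: h2.
exact: h1.
Qed.

Lemma tSJ x : tS x -> tS (tadj x).
Proof.
move=> [xf xc]; split=> [n|e e0]; first exact: isfJ.
have [K hK] := xc e e0; exists K => m n hm hn.
have -> : tadj x m - tadj x n = fadj (x m - x n); last exact/fbdJ/hK.
have -> : x m - x n = -1 *: x n + x m by rewrite scaleN1r addrC.
by rewrite fadjP rmorphN1 scaleN1r addrC.
Qed.

(** The staircase lemma, with a bound that ignores its block index, gives the usual diagonal
    sequence. It is Cauchy by comparison with one fixed [u N]. *)
Lemma tcomplete (u : nat -> nat -> ften B A) : (forall n, tS (u n)) ->
  (forall e, 0 < e -> exists N, forall m n, (N <= m)%N -> (N <= n)%N ->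
    tbd (u m - u n) e) ->
  exists2 x, tS x & forall e, 0 < e ->
    exists N, forall n, (N <= n)%N -> tbd (u n - x) e.
Proof.
move=> uS uc; have [||x xu hx] := @staircase_limit R _ (fun _ => @fbd R B A) _ _ u uc.
- by move=> _ p q r e f; exact: fbdB.
- by move=> _ p M N; exact: fbd_mono.
exists x => //; split=> [n|e e0]; first by have [k ->] := xu n; have [] := uS k.
have e3 : 0 < e / 3 by rewrite divr_gt0.
have [N hN] := hx _ e3; have [K hK] := hN N (leqnn _).
have [_ /(_ _ e3) [K' hK']] := uS N.
exists (maxn K K') => m n; rewrite !geq_max => /andP [m1 m2] /andP [n1 n2].
have -> : e = e / 3 + e / 3 + e / 3 by field.
apply: fbdB (hK _ n1); apply: fbdB (hK' _ _ m2 n2).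
by rewrite -opprB; exact/fbdN/hK.
Qed.

Definition tpre : preCstar R.
Proof.
refine (@PreCstar R (nat -> ften B A) tS tmul tadj tbd
  tS0 tSP tSM tSJ _ _ _ _ _ _ _ tbd_ex _ _ _ tbdM _ tcomplete).
- by move=> x y z _ _ _; apply/funext => n; exact: fmulA.
- by move=> c x y z _ _ _; apply/funext => n; exact: fmulPl.
- by move=> c x y z _ _ [zf _]; apply/funext => n; exact: fmulPr.
- by move=> x _; apply/funext => n; exact: fadjK.
- by move=> c x y _ _; apply/funext => n; exact: fadjP.
- by move=> x y [xf _] [yf _]; apply/funext => n; exact: fadjM.
- by move=> x M _ [K /(_ K (leqnn _))] [].
- by move=> x M N _ MN [K hK]; exists K => n hn; apply: fbd_mono MN (hK _ hn).
- by move=> x y M N _ _; exact: tbdD.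
- by move=> c x M _ [K hK]; exists K => n hn; exact/fbdZ/hK.
- move=> x M [xf _] M0 [K hK]; exists K => n hn.
  by apply: fbd_star => //; exact: hK.
Defined.

Lemma tpre_ext (x y : nat -> ften B A) : (forall n be, x n be = y n be) -> x = y :> tpre.
Proof. by move=> h; apply/funext => n; apply/funext => be. Qed.

Definition mtens : cstarType R := cq tpre.

Definition etens (b : B) (a : A) : mtens :=
  cqpi ((fun _ => fdn [:: (1, b, a)]) : tpre).

Lemma tS_const (phi : ften B A) : isf phi -> tS (fun _ => phi).
Proof.
move=> h; split=> // e e0; exists 0%N => m n _ _; rewrite subrr.
exact: fbd_mono (ltW e0) (fbd0 h).
Qed.

Lemma isf_fdn s : isf (fdn s : ften B A).
Proof. by exists s. Qed.

Lemma pnorm_const (phi : ften B A) M : isf phi -> 0 <= M ->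
  pnorm ((fun _ => phi) : tpre) <= M <-> fbd phi M.
Proof.
move=> hphi M0; have Sc : pS ((fun _ => phi) : tpre) by exact: tS_const.
split=> [h|h]; last first.
  by apply: (pnorm_le Sc); exists 0%N => n _.
have he e : 0 < e -> fbd phi (M + e).
  move=> e0; have Me : M < M + e by rewrite ltrDl.
  by have [K hK] := pnorm_lt Sc (le_lt_trans h Me); exact: hK (leqnn K).
split=> // H K L t pi sigma ht hpi hs v w; rewrite -mulrA mulrC.
apply: le_of_mul; first by rewrite mulr_ge0 ?nm_ge0.
move=> e e0; rewrite mulrC mulrA; have [_ h'] := he _ e0; exact: h'.
Qed.

(** The free vector space on [B * A] knows nothing of bilinearity. It enters here: coefficients of
    representations are bilinear, and formal tensors with the same coefficients have the same
    class. *)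
Lemma cqpi_const_eq (phi psi : ften B A) : isf phi -> isf psi ->
  (forall (H K L : hilbertType R) (t : H -> K -> L) pi sigma,
    is_hilbert_tensor t -> is_rep pi -> is_rep sigma -> forall v w,
    phi (cform t pi sigma v w) = psi (cform t pi sigma v w)) ->
  cqpi ((fun _ => phi) : tpre) = cqpi ((fun _ => psi) : tpre).
Proof.
move=> hphi hpsi h; have S1 : pS ((fun _ => phi) : tpre) by exact: tS_const.
have S2 : pS ((fun _ => psi) : tpre) by exact: tS_const.
apply: cqpi_eq => //; apply/eqP; rewrite eq_le pnorm_ge0 ?andbT; last exact: pSB.
have -> : ((fun _ => phi) : tpre) - (fun _ => psi) = ((fun _ => phi - psi) : tpre) by [].
apply/pnorm_const => //; first exact: isfB.
split=> // H K L t pi sigma ht hpi hs v w.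
by rewrite -[(phi - psi) _]/(_ - _) h // subrr cnorm0 !mul0r.
Qed.

Lemma etens_bilinear : is_bilinear etens.
Proof.
have Sc b a : pS ((fun _ => fdn [:: (1, b, a)]) : tpre) by exact/tS_const/isf_fdn.
split=> [a|b] c x y; rewrite /etens -cqpiZ // -cqpiD //; do ?exact: pSZ.
  apply: (@cqpi_const_eq (fdn [:: (1, c *: x + y, a)])
    (c *: fdn [:: (1, x, a)] + fdn [:: (1, y, a)])).
  - exact: isf_fdn.
  - by apply: isfP; exact: isf_fdn.
  - move=> H K L t pi sigma ht hpi hs v w.
    rewrite -[RHS]/(c * _ + _) !fdn_cform // !tval_fev /uncoef /= !big_seq1 /=.
    rewrite !scale1r -hdotZl -hdotDl scaler_sumr -big_split; congr (hdot _ _).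
    by apply: eq_bigr => p _ /=; rewrite (repP hpi) (tensPl ht).
apply: (@cqpi_const_eq (fdn [:: (1, b, c *: x + y)])
  (c *: fdn [:: (1, b, x)] + fdn [:: (1, b, y)])).
- exact: isf_fdn.
- by apply: isfP; exact: isf_fdn.
- move=> H K L t pi sigma ht hpi hs v w.
  rewrite -[RHS]/(c * _ + _) !fdn_cform // !tval_fev /uncoef /= !big_seq1 /=.
  rewrite !scale1r -hdotZl -hdotDl scaler_sumr -big_split; congr (hdot _ _).
  by apply: eq_bigr => p _ /=; rewrite (repP hs) (tensPr ht).
Qed.

Lemma etens_sum (m : nat) (b : 'I_m -> B) (a : 'I_m -> A) :
  \sum_i etens (b i) (a i) =
  cqpi ((fun _ => fdn [seq (1, b i, a i) | i <- enum 'I_m]) : tpre).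
Proof.
have Sc s : pS ((fun _ => fdn s) : tpre) by exact/tS_const/isf_fdn.
rewrite -big_enum /=; elim: (enum _) => [|i r ih].
  rewrite big_nil /= -cqpi0; congr (cqpi (P := tpre) _); apply: tpre_ext => n be.
  by rewrite /fdn big_nil.
rewrite big_cons ih /etens -cqpiD //; congr (cqpi (P := tpre) _); apply: tpre_ext => n be.
by rewrite -[LHS]/(fdn _ be + fdn _ be) /fdn /= !big_cons big_nil addr0.
Qed.

Lemma mtens_dense : dense (tensor_span etens).
Proof.
move=> O [z Oz] Oo; have [x Sx ez] := cqpiP z.
have /nbhs_ballP [e e0 he] : nbhs z O by exact: open_nbhs_nbhs.
have [r r0 er] := nm_lt_pos e0.
have [xf xc] := Sx; have [N hN] := xc (r / 2) (divr_gt0 r0 (ltr0n _ 2)).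
have [s hs] := xf N.
have Sc : pS ((fun _ => fdn s) : tpre) by exact/tS_const/isf_fdn.
exists (cqpi ((fun _ => fdn s) : tpre)); split.
  apply: he; rewrite -ball_normE /= ez -cqpiB // nmE nm_cqpi; last exact: pSB.
  rewrite er ltcR; apply: (@le_lt_trans _ _ (r / 2)); last first.
    by rewrite ltr_pdivrMr // ltr_pMr // ltr1n.
  apply: pnorm_le; first exact: pSB.
  by exists N => n hn; rewrite -[(_ - _) n]/(x n - fdn s) -hs; exact: hN.
exists (size s), (fun i => (tnth (in_tuple s) i).1.1 *: (tnth (in_tuple s) i).1.2),
  (fun i => (tnth (in_tuple s) i).2).
rewrite etens_sum; apply: cqpi_const_eq; [exact: isf_fdn..|].
move=> H K L t pi sigma ht hpi hs' v w.
rewrite /fdn big_map big_enum /= (big_tnth _ _ s).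
apply: eq_bigr => i _ /=; rewrite mul1r /cform -hdotZl; congr (hdot _ _).
rewrite !tval_fev !big_seq1 scaler_sumr; apply: eq_bigr => p _ /=.
by rewrite (repZ hpi) (tensZl ht).
Qed.

Lemma etens_min : is_min_tensor etens.
Proof.
have Sc s : pS ((fun _ => fdn s) : tpre) by exact/tS_const/isf_fdn.
split.
- exact: etens_bilinear.
- move=> b b' a a'; rewrite /etens -cqpiM //; congr (cqpi (P := tpre) _).
  apply: tpre_ext => n be.
  rewrite -[LHS]/(fmul (fdn [:: (1, b, a)]) (fdn [:: (1, b', a')]) be).
  by rewrite /fmul /fdn !big_seq1 /= !mul1r.
- move=> b a; rewrite /etens -cqpiJ //; congr (cqpi (P := tpre) _).
  apply: tpre_ext => n be.
  by rewrite -[LHS]/(fadj (fdn [:: (1, b, a)]) be) /fadj /fdn !big_seq1 /= !mul1r conjCK.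
- exact: mtens_dense.
move=> m b a M0 hM0; have M0r : M0 = (complex.Re M0)%:C.
  by rewrite RRe_real // ger0_real.
move: hM0; rewrite M0r; set M := complex.Re M0; rewrite ler0c => M_ge0.
rewrite etens_sum nmE lecR nm_cqpi // pnorm_const //; last exact: isf_fdn.
set s := [seq _ | _ <- _].
have Es (H K L : hilbertType R) (t : H -> K -> L) pi sigma v :
    tval t (fev pi sigma (uncoef s) v) =
    \sum_(p <- v) \sum_i t (pi (b i) p.1) (sigma (a i) p.2).
  rewrite tval_fev exchange_big; apply: eq_bigr => p _ /=.
  rewrite /uncoef /s -map_comp big_map big_enum /=; apply: eq_bigr => i _.
  by rewrite scale1r.
rewrite fbd_fdn //; split=> h H K L t pi sigma ht hpi hs.
  move=> p x y; pose v := [seq (x k, y k) | k <- enum 'I_p].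
  have := h H K L t pi sigma ht hpi hs v.
  rewrite Es /tval /v !big_map => hv.
  by rewrite !nmE -rmorphM lecR.
move=> v; have := h H K L t pi sigma ht hpi hs (size v)
  (fun k => (tnth (in_tuple v) k).1) (fun k => (tnth (in_tuple v) k).2).
by rewrite !nmE -rmorphM lecR Es /tval !(big_tnth _ _ v).
Qed.

End MinTensorAlgebra.

(** * Tensoring a homomorphism with the identity *)

Section TensorMap.
Context (R : realType) (B B' A : cstarType R) (f : B -> B').
Hypothesis hf : star_hom f.

Definition fmap (phi : ften B A) : ften B' A := fun be => phi (fun b a => be (f b) a).

Lemma isf_fmap phi : isf phi -> isf (fmap phi).
Proof.
move=> [s ->]; exists [seq (q.1.1, f q.1.2, q.2) | q <- s].
by apply/funext => be; rewrite /fmap /fdn big_map.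
Qed.

(** Representations of [B'] composed with [f] are among the representations of [B] over which the
    bound is taken. Hence [f (x) id] is contractive. *)
Lemma fbd_fmap phi M : fbd phi M -> fbd (fmap phi) M.
Proof.
move=> [M0 h]; split=> // H K L t pi sigma ht hpi hs v w.
exact: (h H K L t (fun b => pi (f b)) sigma ht (is_rep_comp hf hpi) hs).
Qed.

Definition tmap0 (x : tpre B A) : tpre B' A := fun n => fmap (x n).

Lemma tS_tmap x : pS x -> pS (tmap0 x).
Proof.
move=> [xf xc]; split=> [n|e e0]; first exact: isf_fmap.
by have [N hN] := xc e e0; exists N => m n hm hn; exact: fbd_fmap (hN _ _ hm hn).
Qed.

Lemma pnorm_tmap x : pS x -> pnorm (tmap0 x) <= pnorm x.
Proof.
move=> Sx; apply/ler_addgt0Pr => e e0; apply: pnorm_le; first exact: tS_tmap.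
by have [N hN] := pnorm_bd Sx e0; exists N => n hn; exact/fbd_fmap/hN.
Qed.

Definition tmap (z : mtens B A) : mtens B' A := cqpi (tmap0 (cqval z)).

Lemma tmapE x : pS x -> tmap (cqpi x) = cqpi (tmap0 x).
Proof.
move=> Sx; have Sv := cqvalS (cqpi x).
apply: cqpi_eq; [exact: tS_tmap | exact: tS_tmap |].
apply/eqP; rewrite eq_le pnorm_ge0 ?andbT; last by apply: pSB; exact: tS_tmap.
have -> : tmap0 (cqval (cqpi x)) - tmap0 x = tmap0 (cqval (cqpi x) - x) by [].
by rewrite (le_trans (pnorm_tmap _)) ?cqval_pi //; exact: pSB.
Qed.

Lemma tmap_hom : star_hom tmap.
Proof.
have [fl fM fJ] := hf; split.
- move=> c z z'; have [x Sx ->] := cqpiP z; have [y Sy ->] := cqpiP z'.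
  have Scx : pS (c *: x) by exact: pSZ.
  rewrite -cqpiZ // -cqpiD // !tmapE //; last exact: pSD.
  by rewrite -cqpiZ -?cqpiD //; do ?apply: pSZ; exact: tS_tmap.
- move=> z z'; have [x Sx ->] := cqpiP z; have [y Sy ->] := cqpiP z'.
  rewrite -cqpiM // !tmapE //; last exact: pSM.
  rewrite -cqpiM; do ?exact: tS_tmap; congr (cqpi (P := tpre _ _) _); apply: tpre_ext => n be.
  rewrite -[LHS]/(fmul (x n) (y n) (fun b a => be (f b) a)).
  rewrite -[RHS]/(fmul (fmap (x n)) (fmap (y n)) be).
  rewrite /fmul /fmap; congr (x n _); apply/funext => b; apply/funext => a.
  by congr (y n _); apply/funext => b'; apply/funext => a'; rewrite fM.
- move=> z; have [x Sx ->] := cqpiP z.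
  rewrite -cqpiJ // !tmapE //; last exact: pSJ.
  rewrite -cqpiJ; last exact: tS_tmap.
  congr (cqpi (P := tpre _ _) _); apply: tpre_ext => n be.
  rewrite -[LHS]/(fadj (x n) (fun b a => be (f b) a)) -[RHS]/(fadj (fmap (x n)) be).
  rewrite /fadj /fmap; congr (Num.conj (x n _)); apply/funext => b; apply/funext => a.
  by rewrite fJ.
Qed.

Lemma tmap_le z : nm (tmap z) <= nm z.
Proof.
have [x Sx ->] := cqpiP z; rewrite tmapE // !nm_cqpi //; first exact: pnorm_tmap.
exact: tS_tmap.
Qed.

Lemma tmap_etens b a : tmap (etens b a) = etens (f b) a.
Proof.
rewrite /etens tmapE; last exact/tS_const/isf_fdn.
congr (cqpi (P := tpre _ _) _); apply: tpre_ext => n be.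
by rewrite -[LHS]/(fdn [:: (1, b, a)] (fun b a => be (f b) a)) /fdn !big_seq1.
Qed.

End TensorMap.

(** * Algebras of sequences of matrices *)

Section RealVectors.
Context (R : realType) (T : finType).
Implicit Types u v : T -> R.

Definition l2 u : R := Num.sqrt (\sum_i u i ^+ 2).

Lemma sumsq_ge0 u : 0 <= \sum_i u i ^+ 2.
Proof. by apply: sumr_ge0 => i _; exact: sqr_ge0. Qed.

Lemma l2_ge0 u : 0 <= l2 u.
Proof. exact: sqrtr_ge0. Qed.

Lemma l2_sq u : l2 u ^+ 2 = \sum_i u i ^+ 2.
Proof. by rewrite sqr_sqrtr ?sumsq_ge0. Qed.

Lemma l2_le u c : 0 <= c -> (l2 u <= c) = (\sum_i u i ^+ 2 <= c ^+ 2).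
Proof.
by move=> c0; rewrite -l2_sq ler_pXn2r ?nnegrE ?l2_ge0.
Qed.

Lemma l2_coord u i : `|u i| <= l2 u.
Proof.
rewrite -(ler_pXn2r (n := 2)) ?nnegrE ?l2_ge0 ?normr_ge0 // l2_sq real_normK ?num_real //.
by rewrite (bigD1 i) //= lerDl; apply: sumr_ge0 => j _; exact: sqr_ge0.
Qed.

Lemma l2_mono u v : (forall i, `|u i| <= v i) -> l2 u <= l2 v.
Proof.
move=> uv; rewrite l2_le ?l2_ge0 // l2_sq; apply: ler_sum => i _.
rewrite -(real_normK (num_real (u i))) ler_pXn2r ?nnegrE //.
by rewrite (le_trans _ (uv i)).
Qed.

Lemma l2_dot u v : `|\sum_i u i * v i| <= l2 u * l2 v.
Proof.
set b := \sum_i _; have a0 := sumsq_ge0 v; set a := \sum_i v i ^+ 2 in a0.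
rewrite -(ler_pXn2r (n := 2)) ?nnegrE ?normr_ge0 ?mulr_ge0 ?l2_ge0 //.
rewrite real_normK ?num_real // exprMn !l2_sq -/a mulrC.
have : 0 <= \sum_i (a * u i - b * v i) ^+ 2 by exact: sumsq_ge0.
have -> : \sum_i (a * u i - b * v i) ^+ 2 = a * (a * (\sum_i u i ^+ 2) - b ^+ 2).
  rewrite (eq_bigr (fun i => a ^+ 2 * u i ^+ 2 +
    (- 2 * a * b * (u i * v i) + b ^+ 2 * v i ^+ 2))); last by move=> i _; ring.
  rewrite !big_split /= -!mulr_sumr -/a -/b; ring.
move: a0; rewrite le_eqVlt => /orP [/eqP a0 _|a0]; last by rewrite pmulr_rge0 // subr_ge0.
have v0 i : v i = 0.
  apply/eqP; rewrite -sqrf_eq0; apply/eqP.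
  exact: (psumr_eq0P (fun i _ => sqr_ge0 (v i)) (esym a0)).
have -> : b = 0 by rewrite /b big1 // => i _; rewrite v0 mulr0.
by rewrite -a0 expr0n mul0r.
Qed.

Lemma l2D u v : l2 (fun i => u i + v i) <= l2 u + l2 v.
Proof.
rewrite l2_le ?addr_ge0 ?l2_ge0 // sqrrD !l2_sq.
have -> : \sum_i (u i + v i) ^+ 2 =
    \sum_i u i ^+ 2 + (\sum_i u i * v i) *+ 2 + \sum_i v i ^+ 2.
  rewrite (eq_bigr (fun i => u i ^+ 2 + 2 * (u i * v i) + v i ^+ 2)).
    by rewrite !big_split /= -mulr_sumr mulr_natl.
  by move=> i _; ring.
rewrite lerD2r lerD2l ler_wMn2r // (le_trans _ (l2_dot u v)) //.
exact: ler_norm.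
Qed.

Lemma l2Z c u : l2 (fun i => c * u i) = `|c| * l2 u.
Proof.
rewrite /l2; under eq_bigr => i _ do rewrite exprMn.
by rewrite -mulr_sumr sqrtrM ?sqr_ge0 // sqrtr_sqr.
Qed.

Lemma l2_le_sum u : l2 u <= \sum_i `|u i|.
Proof.
have s0 : 0 <= \sum_i `|u i| by apply: sumr_ge0.
rewrite l2_le // expr2 mulr_suml; apply: ler_sum => i _.
rewrite -(real_normK (num_real (u i))) expr2 ler_wpM2l //.
by rewrite (bigD1 i) //= lerDl; apply: sumr_ge0.
Qed.

Lemma l2_eq0 u : l2 u = 0 -> forall i, u i = 0.
Proof.
move=> h i; apply/eqP; rewrite -normr_eq0 eq_le normr_ge0 andbT -h.
exact: l2_coord.
Qed.

End RealVectors.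

Lemma finite_eventually (I : finType) (Q : I -> nat -> Prop) :
  (forall i, exists N, forall n, (N <= n)%N -> Q i n) ->
  exists N, forall i n, (N <= n)%N -> Q i n.
Proof.
move=> /choice [N hN]; exists (\max_i N i)%N => i n hn; apply: hN.
exact: leq_trans (leq_bigmax i) hn.
Qed.

Section ComplexLimits.
Context (R : realType).

Lemma real_cauchy_limit (u : nat -> R) :
  (forall e, 0 < e -> exists N, forall m n, (N <= m)%N -> (N <= n)%N ->
     `|u m - u n| <= e) ->
  exists l, forall e, 0 < e -> exists N, forall n, (N <= n)%N -> `|u n - l| <= e.
Proof.
move=> hu.
have /cauchy_cvg /cvg_ex [x hx] : cauchy (u @ \oo).
  apply/cauchy_ballP => e e0.
  have [N hN] := hu _ (divr_gt0 e0 (ltr0n _ 2)).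
  near=> p => /=; rewrite -ball_normE /=.
  apply: le_lt_trans (_ : e / 2 < e); last by rewrite ltr_pdivrMr // ltr_pMr // ltr1n.
  near: p.
  exists ([set u k | k in [set k | (N <= k)%N]], [set u k | k in [set k | (N <= k)%N]]).
    by split; exists N => //= k /= hk; exists k.
  by move=> [a b] /= [[m hm <-] [n hn <-]]; exact: hN.
exists x => e e0; move/cvgrPdist_le: hx => /(_ e e0) [N _ hN].
by exists N => n hn; have := hN n hn; rewrite /= distrC.
Unshelve. all: by end_near.
Qed.

Lemma complex_cauchy_limit (u : nat -> R[i]) :
  (forall e, 0 < e -> exists N, forall m n, (N <= m)%N -> (N <= n)%N ->
     cnorm (u m - u n) <= e) ->
  exists l, forall e, 0 < e -> exists N, forall n, (N <= n)%N -> cnorm (u n - l) <= e.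
Proof.
move=> hu.
have ReB (z w : R[i]) : complex.Re (z - w) = complex.Re z - complex.Re w.
  by case: z w => [a b] [c d].
have ImB (z w : R[i]) : complex.Im (z - w) = complex.Im z - complex.Im w.
  by case: z w => [a b] [c d].
have [|a ha] := @real_cauchy_limit (fun n => complex.Re (u n)).
  move=> e e0; have [N hN] := hu _ e0; exists N => m n hm hn.
  by rewrite -ReB (le_trans (Re_le_cnorm _)) // hN.
have [|b hb] := @real_cauchy_limit (fun n => complex.Im (u n)).
  move=> e e0; have [N hN] := hu _ e0; exists N => m n hm hn.
  by rewrite -ImB (le_trans (Im_le_cnorm _)) // hN.
exists (a +i* b) => e e0; have e2 := divr_gt0 e0 (ltr0n R 2).
have [N hN] := ha _ e2; have [K hK] := hb _ e2.
exists (maxn N K) => n; rewrite geq_max => /andP [n1 n2].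
rewrite (le_trans (cnorm_le_ReIm _)) // [e]splitr ReB ImB /= lerD //; [exact: hN|exact: hK].
Qed.

End ComplexLimits.

(** * Finite-dimensional Hilbert spaces and their tensor products *)

Section Ell2.
Context (R : realType) (T : finType).

Definition ell2 := T -> R[i]^o.
HB.instance Definition _ := GRing.Lmodule.on ell2.
Implicit Types x y z : ell2.

Definition ell2norm x : R[i] := (l2 (fun i => cnorm (x i)))%:C.

Lemma ell2normD x y : ell2norm (x + y) <= ell2norm x + ell2norm y.
Proof.
rewrite -rmorphD lecR (le_trans _ (l2D _ _)) //; apply: l2_mono => i.
by rewrite ger0_norm ?cnorm_ge0 // cnormD.
Qed.

Lemma ell2normZ c x : ell2norm (c *: x) = `|c| * ell2norm x.
Proof.
rewrite /ell2norm.
have -> : l2 (fun i => cnorm ((c *: x) i)) = cnorm c * l2 (fun i => cnorm (x i)).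
  rewrite -[X in X * _]ger0_norm ?cnorm_ge0 // -l2Z.
  by congr l2; apply/funext => i; rewrite -cnormM.
by rewrite rmorphM /= -cnormE.
Qed.

Lemma ell2norm_eq0 x : ell2norm x = 0 -> x = 0.
Proof.
by move=> /complexI /l2_eq0 h; apply/funext => i; exact/cnorm_eq0/h.
Qed.

HB.instance Definition _ :=
  Lmodule_isNormed.Build R[i] ell2 ell2normD ell2normZ ell2norm_eq0.

Lemma nm_ell2 x : nm x = l2 (fun i => cnorm (x i)).
Proof. by []. Qed.

Lemma ell2_coord x i : cnorm (x i) <= nm x.
Proof.
by rewrite -[cnorm _]ger0_norm ?cnorm_ge0 // (l2_coord (fun i => cnorm (x i))).
Qed.

Lemma ell2_le_sum x : nm x <= \sum_i cnorm (x i).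
Proof.
rewrite (le_trans (l2_le_sum _)) //; apply: ler_sum => i _.
by rewrite ger0_norm ?cnorm_ge0.
Qed.

Lemma ell2_complete (u : nat -> ell2) : seq_cauchy u -> exists l, seq_limit u l.
Proof.
move=> hu; have /choice [l hl] : forall i : T, exists l, forall e, 0 < e ->
    exists N, forall n, (N <= n)%N -> cnorm (u n i - l) <= e.
  move=> i; apply: complex_cauchy_limit => e e0; have [N hN] := hu _ e0.
  exists N => m n hm hn; apply: le_trans (hN m n hm hn).
  exact: (ell2_coord (u m - u n) i).
exists l => e e0.
have e1 : 0 < e / #|T|.+1%:R by rewrite divr_gt0 ?ltr0n.
have [N hN] := finite_eventually (fun i => hl i _ e1).
exists N => n hn; rewrite (le_trans (ell2_le_sum _)) //.
apply: (@le_trans _ _ (\sum_(i : T) e / #|T|.+1%:R)).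
  by apply: ler_sum => i _; exact: hN.
rewrite sumr_const -[leLHS]mulr_natl mulrCA ger_pMr // ler_pdivrMr ?ltr0n // mul1r.
by rewrite ler_nat leqnSn.
Qed.

HB.instance Definition _ := Uniform_isComplete.Build ell2
  (seq_complete_cauchy_cvg ell2_complete).

Definition ell2dot x y : R[i] := \sum_i x i * Num.conj (y i).

Lemma ell2dot_bilinear :
  bilinear_for ( *%R : GRing.Scale.law _ _) (Num.conj \; *%R : GRing.Scale.law _ _) ell2dot.
Proof.
split=> [y c x x'|x c y y'] /=; rewrite /ell2dot mulr_sumr -big_split;
  apply: eq_bigr => i _ /=.
  by rewrite -[(c *: x + x') i]/(c * x i + x' i) mulrDl mulrA.
by rewrite -[(c *: y + y') i]/(c * y i + y' i) rmorphD rmorphM mulrDr mulrCA.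
Qed.

Lemma ell2dotC x y : ell2dot x y = (-1) ^+ false * Num.conj (ell2dot y x).
Proof.
rewrite expr0 mul1r /ell2dot rmorph_sum; apply: eq_bigr => i _ /=.
by rewrite rmorphM /= conjCK mulrC.
Qed.

Lemma ell2dot_norm x : ell2dot x x = `|x| ^+ 2.
Proof.
rewrite nmE -rmorphXn nm_ell2 l2_sq rmorph_sum; apply: eq_bigr => i _.
by rewrite mulC_conj.
Qed.

Lemma ell2dot_gt0 x : x != 0 -> 0 < ell2dot x x.
Proof. by move=> x0; rewrite ell2dot_norm exprn_gt0 // normr_gt0. Qed.

HB.instance Definition _ := bilinear_isBilinear.Build _ _ _ _ _ _ ell2dot ell2dot_bilinear.
HB.instance Definition _ := isHermitianSesquilinear.Build _ _ false Num.conj ell2dot ell2dotC.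
HB.instance Definition _ := isDotProduct.Build _ _ ell2dot ell2dot_gt0.

HB.instance Definition _ := isHilbertSpace.Build R ell2 ell2dot_norm.

Lemma hdot_ell2 x y : hdot x y = \sum_i x i * Num.conj (y i).
Proof. by []. Qed.

Definition delta (i : T) : ell2 := fun j => (j == i)%:R.

End Ell2.

Lemma bounded_linear_continuous (R : realType) (U V : normedModType R[i])
    (f : U -> V) M : linear f -> (forall x, nm (f x) <= M * nm x) -> continuous f.
Proof.
move=> fl fM x; apply/cvgrPdist_lt => e /nm_lt_pos [r r0 ->].
have M1 : 0 < `|M| + 1 by rewrite ltr_wpDl.
have d0 : 0 < (r / (`|M| + 1))%:C :> R[i] by rewrite ltcR divr_gt0.
near=> y; have -> : f x - f y = f (x - y).
  have f0 : f 0 = 0.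
    by have := fl 1 0 0; rewrite !scale1r addr0 => /eqP;
      rewrite -subr_eq subrr eq_sym => /eqP.
  have fN z : f (- z) = - f z.
    by rewrite -[- z]scaleN1r -[_ *: z]addr0 fl f0 addr0 scaleN1r.
  by rewrite -{2}[x]scale1r fl scale1r fN.
rewrite nmE ltcR (le_lt_trans (fM _)) //.
have : `|x - y| < (r / (`|M| + 1))%:C by near: y; exact: cvgr_dist_lt.
rewrite nmE ltcR ltr_pdivlMr // => h.
apply: le_lt_trans h; rewrite mulrC ler_wpM2l ?nm_ge0 //.
by rewrite (le_trans (ler_norm M)) // lerDl.
Unshelve. all: by end_near.
Qed.

Section Ell2Tensor.
Context (R : realType) (T T' : finType).

Definition ell2tens (x : ell2 R T) (y : ell2 R T') : ell2 R (T * T')%type :=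
  fun p => x p.1 * y p.2.

Lemma ell2_hilbert_tensor : is_hilbert_tensor ell2tens.
Proof.
split.
- split=> [y|x] c u v; apply/funext => p; rewrite /ell2tens.
    by rewrite -[(c *: u + v) _]/(c * u _ + v _) mulrDl -mulrA.
  by rewrite -[(c *: u + v) _]/(c * u _ + v _) mulrDr mulrCA.
- move=> x x' y y'; rewrite !hdot_ell2 mulr_suml.
  rewrite -(pair_bigA _ (fun i j => ell2tens x y (i, j) * Num.conj (ell2tens x' y' (i, j)))) /=.
  apply: eq_bigr => i _; rewrite mulr_sumr; apply: eq_bigr => j _.
  by rewrite /ell2tens /= rmorphM mulrACA.
- move=> O [z Oz] _; exists z; split=> //.
  exists #|{: T * T'}|, (fun k => z (enum_val k) *: delta R (enum_val k).1),
    (fun k => delta R (enum_val k).2).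
  apply/funext => p; rewrite fct_sumE (bigD1 (enum_rank p)) //= big1 ?addr0.
    rewrite enum_rankK /ell2tens -[(z p *: _) _]/(z p * _) /delta /=.
    by rewrite !eqxx !mulr1.
  move=> k kp; rewrite /ell2tens -[(_ *: delta _ _) _]/(z (enum_val k) * _) /delta.
  have : p != enum_val k by apply: contra kp => /eqP ->; rewrite enum_valK.
  rewrite -pair_eqE negb_and => /orP [] /negbTE ->; first by rewrite mulr0 mul0r.
  by rewrite mulr0.
Qed.

End Ell2Tensor.

Lemma cnorm_sum (R : realType) (I : Type) (r : seq I) (F : I -> R[i]) :
  cnorm (\sum_(i <- r) F i) <= \sum_(i <- r) cnorm (F i).
Proof.
elim: r => [|a r ih]; first by rewrite !big_nil cnorm0.
by rewrite !big_cons (le_trans (cnormD _ _)) // lerD2l.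
Qed.

Section MatrixSequences.
Context (R : realType) (T : nat -> finType).

(** A sequence of matrices of varying size is stored as one function on dependent pairs, so that it
    inherits the pointwise module structure. *)
Definition kidx := {k : nat & (T k * T k)%type}.
Definition kvec := kidx -> R[i]^o.
HB.instance Definition _ := GRing.Lmodule.on kvec.
Implicit Types (x y z : kvec) (k : nat) (M N : R).

Definition ent x k (i j : T k) : R[i] := x (existT _ k (i, j)).

Definition kmul x y : kvec := fun q =>
  \sum_(l : T (tag q)) ent x (tagged q).1 l * ent y l (tagged q).2.
Definition kadj x : kvec := fun q => Num.conj (ent x (tagged q).2 (tagged q).1).
Definition kact x k (xi : ell2 R (T k)) : ell2 R (T k) :=
  fun i => \sum_j ent x i j * xi j.
Definition kone : kvec := fun q => ((tagged q).1 == (tagged q).2)%:R.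

Lemma kvec_ext x y : (forall k (i j : T k), ent x i j = ent y i j) -> x = y.
Proof. by move=> h; apply/funext => -[k [i j]]; exact: h. Qed.

Lemma entP c x y k (i j : T k) : ent (c *: x + y) i j = c * ent x i j + ent y i j.
Proof. by []. Qed.

Lemma ent_mul x y k (i j : T k) : ent (kmul x y) i j = \sum_l ent x i l * ent y l j.
Proof. by []. Qed.

Lemma ent_adj x k (i j : T k) : ent (kadj x) i j = Num.conj (ent x j i).
Proof. by []. Qed.

Lemma kmulA : associative kmul.
Proof.
move=> x y z; apply: kvec_ext => k i j; rewrite !ent_mul.
under eq_bigr => l _ do rewrite ent_mul mulr_sumr.
rewrite exchange_big; apply: eq_bigr => m _ /=; rewrite ent_mul mulr_suml.
by apply: eq_bigr => l _; rewrite mulrA.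
Qed.

Lemma kmulPl c x y z : kmul (c *: x + y) z = c *: kmul x z + kmul y z.
Proof.
apply: kvec_ext => k i j; rewrite entP !ent_mul mulr_sumr -big_split.
by apply: eq_bigr => l _ /=; rewrite entP mulrDl mulrA.
Qed.

Lemma kmulPr c x y z : kmul z (c *: x + y) = c *: kmul z x + kmul z y.
Proof.
apply: kvec_ext => k i j; rewrite entP !ent_mul mulr_sumr -big_split.
by apply: eq_bigr => l _ /=; rewrite entP mulrDr mulrCA.
Qed.

Lemma kadjK : involutive kadj.
Proof. by move=> x; apply: kvec_ext => k i j; rewrite !ent_adj conjCK. Qed.

Lemma kadjP c x y : kadj (c *: x + y) = Num.conj c *: kadj x + kadj y.
Proof.
by apply: kvec_ext => k i j; rewrite entP !ent_adj entP rmorphD rmorphM.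
Qed.

Lemma kadjM x y : kadj (kmul x y) = kmul (kadj y) (kadj x).
Proof.
apply: kvec_ext => k i j; rewrite ent_adj !ent_mul rmorph_sum.
by apply: eq_bigr => l _ /=; rewrite !ent_adj rmorphM mulrC.
Qed.

Lemma kact_linear x k : linear (kact x (k := k)).
Proof.
move=> c xi eta; apply/funext => i; rewrite -[RHS]/(c * _ + _) /kact mulr_sumr.
rewrite -big_split; apply: eq_bigr => j _ /=.
by rewrite -[(c *: xi + eta) j]/(c * xi j + eta j) mulrDr mulrCA.
Qed.

Lemma kactP c x y k (xi : ell2 R (T k)) :
  kact (c *: x + y) xi = c *: kact x xi + kact y xi.
Proof.
apply/funext => i; rewrite -[RHS]/(c * _ + _) /kact mulr_sumr -big_split.
by apply: eq_bigr => j _ /=; rewrite entP mulrDl mulrA.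
Qed.

Lemma kactD x y k (xi : ell2 R (T k)) : kact (x + y) xi = kact x xi + kact y xi.
Proof. by rewrite -[x]scale1r kactP !scale1r. Qed.

Lemma kact0 k (xi : ell2 R (T k)) : kact 0 xi = 0.
Proof.
by apply/funext => i; rewrite /kact big1 // => j _; rewrite /ent mul0r.
Qed.

Lemma kactZ c x k (xi : ell2 R (T k)) : kact (c *: x) xi = c *: kact x xi.
Proof. by rewrite -[c *: x]addr0 kactP kact0 addr0. Qed.

Lemma kactM x y k (xi : ell2 R (T k)) : kact (kmul x y) xi = kact x (kact y xi).
Proof.
apply/funext => i; rewrite /kact.
under eq_bigr => j _ do rewrite ent_mul mulr_suml.
rewrite exchange_big; apply: eq_bigr => l _ /=; rewrite mulr_sumr.
by apply: eq_bigr => j _; rewrite mulrA.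
Qed.

Lemma kactJ x k (xi eta : ell2 R (T k)) : hdot (kact x xi) eta = hdot xi (kact (kadj x) eta).
Proof.
rewrite !hdot_ell2; under eq_bigr => i _ do rewrite mulr_suml.
rewrite exchange_big; apply: eq_bigr => j _ /=; rewrite rmorph_sum mulr_sumr.
by apply: eq_bigr => i _ /=; rewrite ent_adj rmorphM /= conjCK mulrA [ent x i j * _]mulrC.
Qed.

Lemma kact1 k (xi : ell2 R (T k)) : kact kone xi = xi.
Proof.
apply/funext => i; rewrite /kact (bigD1 i) //= big1 ?addr0.
  by rewrite /ent /kone /= eqxx mul1r.
by move=> j /negbTE ji; rewrite /ent /kone /= eq_sym ji mul0r.
Qed.

Definition kbd k x (M : R) := 0 <= M /\ forall xi : ell2 R (T k), nm (kact x xi) <= M * nm xi.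

Lemma kbd_mono k x M N : M <= N -> kbd k x M -> kbd k x N.
Proof.
move=> MN [M0 h]; split=> [|xi]; first exact: le_trans MN.
by rewrite (le_trans (h xi)) // ler_wpM2r ?nm_ge0.
Qed.

Lemma kbdD k x y M N : kbd k x M -> kbd k y N -> kbd k (x + y) (M + N).
Proof.
move=> [M0 hx] [N0 hy]; split=> [|xi]; first exact: addr_ge0.
by rewrite kactD (le_trans (nmD _ _)) // mulrDl lerD.
Qed.

Lemma kbdZ k c x M : kbd k x M -> kbd k (c *: x) (cnorm c * M).
Proof.
move=> [M0 hx]; split=> [|xi]; first by rewrite mulr_ge0 ?cnorm_ge0.
by rewrite kactZ nmZ -mulrA ler_wpM2l ?cnorm_ge0.
Qed.

Lemma kbdN k x M : kbd k x M -> kbd k (- x) M.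
Proof. by move=> /(kbdZ (-1)); rewrite scaleN1r cnormN cnorm1 mul1r. Qed.

Lemma kbdB k x y z M N : kbd k (x - y) M -> kbd k (y - z) N -> kbd k (x - z) (M + N).
Proof. by move=> h h'; have := kbdD h h'; rewrite addrA subrK. Qed.

Lemma kbdM k x y M N : kbd k x M -> kbd k y N -> kbd k (kmul x y) (M * N).
Proof.
move=> [M0 hx] [N0 hy]; split=> [|xi]; first exact: mulr_ge0.
by rewrite kactM (le_trans (hx _)) // -mulrA ler_wpM2l.
Qed.

Lemma kbd_star k x M : 0 <= M -> kbd k (kmul (kadj x) x) (M ^+ 2) -> kbd k x M.
Proof.
move=> M0 [_ h]; split=> // xi.
rewrite -(ler_pXn2r (n := 2)) ?nnegrE ?mulr_ge0 ?nm_ge0 //.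
have -> : nm (kact x xi) ^+ 2 = cnorm (hdot xi (kact (kmul (kadj x) x) xi)).
  by rewrite kactM -kactJ hdot_nm cnormR ger0_norm ?sqr_ge0.
rewrite (le_trans (hdot_le _ _)) // exprMn [X in _ <= _ * X]expr2 mulrCA.
by rewrite ler_wpM2l ?nm_ge0 //; exact: h.
Qed.

Lemma kbdJ k x M : kbd k x M -> kbd k (kadj x) M.
Proof.
move=> [M0 h]; split=> // xi; apply: nm_le_hdot => [|eta].
  by rewrite mulr_ge0 ?nm_ge0.
rewrite kactJ kadjK (le_trans (hdot_le _ _)) // [M * _]mulrC -mulrA.
by rewrite ler_wpM2l ?nm_ge0 //; exact: h.
Qed.

Lemma kbd0 k : kbd k 0 0.
Proof. by split=> // xi; rewrite kact0 nm0 mul0r. Qed.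

Lemma kbd1 k : kbd k kone 1.
Proof. by split=> [|xi]; rewrite ?ler01 // kact1 mul1r. Qed.

Lemma kact_delta x k (i j : T k) : kact x (delta R j) i = ent x i j.
Proof.
rewrite /kact (bigD1 j) //= big1 ?addr0; first by rewrite /delta eqxx mulr1.
by move=> l /negbTE lj; rewrite /delta lj mulr0.
Qed.

Lemma nm_delta k (i : T k) : nm (delta R i) = 1.
Proof.
apply/eqP; rewrite -(eqrXn2 (n := 2)) ?nm_ge0 ?ler01 // expr1n nm_ell2 l2_sq.
rewrite (bigD1 i) //= /delta eqxx cnorm1 big1 ?addr0 ?expr1n // => j /negbTE ->.
by rewrite cnorm0 expr0n.
Qed.

Lemma kbd_ent k x M (i j : T k) : kbd k x M -> cnorm (ent x i j) <= M.
Proof.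
move=> [_ /(_ (delta R j))]; rewrite nm_delta mulr1; apply: le_trans.
by rewrite -kact_delta; exact: ell2_coord.
Qed.

Lemma kbd_sum_ent k x : kbd k x (\sum_(i : T k) \sum_(j : T k) cnorm (ent x i j)).
Proof.
have s0 : 0 <= \sum_(i : T k) \sum_(j : T k) cnorm (ent x i j).
  by apply: sumr_ge0 => i _; apply: sumr_ge0 => j _; exact: cnorm_ge0.
split=> // xi; rewrite (le_trans (ell2_le_sum _)) // mulr_suml; apply: ler_sum => i _.
rewrite mulr_suml.
rewrite (le_trans (cnorm_sum _ _)) //; apply: ler_sum => j _.
by rewrite cnormM ler_wpM2l ?cnorm_ge0 // ell2_coord.
Qed.

End MatrixSequences.

Section SequenceAlgebras.
Context (R : realType) (T : nat -> finType).
Implicit Types (x y : kvec R T) (M : R).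

Definition bbd x M := forall k, kbd k x M.
Definition bS x := exists M, bbd x M.
(** The infimum of these bounds is the limit superior of the block norms, the norm of bounded
    sequences modulo null sequences. The quotient algebra is thus one more completion, for a coarser
    seminorm on the same sequences. *)
Definition qbd x M := exists K, forall k, (K <= k)%N -> kbd k x M.
Definition jS x := bS x /\ forall e, 0 < e -> qbd x e.

(** The finitely many blocks before the threshold are bounded by the sums of the moduli of their
    entries. *)
Lemma qbd_bS x M : qbd x M -> bS x.
Proof.
move=> [K hK]; pose F k := \sum_(i : T k) \sum_(j : T k) cnorm (ent x i j).
have F0 k : 0 <= F k.
  by apply: sumr_ge0 => i _; apply: sumr_ge0 => j _; exact: cnorm_ge0.
have M0 : 0 <= M by have [] := hK K (leqnn _).
exists (M + \sum_(k < K) F k) => k.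
case: (leqP K k) => hk.
  by apply: kbd_mono (hK k hk); rewrite lerDl; apply: sumr_ge0.
apply: kbd_mono (kbd_sum_ent k x); rewrite -/(F k) (bigD1 (Ordinal hk)) //=.
by rewrite addrCA lerDl addr_ge0 //; apply: sumr_ge0.
Qed.

Lemma bbd_qbd x M : bbd x M -> qbd x M.
Proof. by move=> h; exists 0%N => k _. Qed.

Lemma bbdP c x y M N : bbd x M -> bbd y N -> bbd (c *: x + y) (cnorm c * M + N).
Proof. by move=> hx hy k; apply: kbdD => //; exact: kbdZ. Qed.

Lemma bSP c x y : bS x -> bS y -> bS (c *: x + y).
Proof. by move=> [M hM] [N hN]; eexists; exact: bbdP hM hN. Qed.

Lemma bSM x y : bS x -> bS y -> bS (kmul x y).
Proof. by move=> [M hM] [N hN]; exists (M * N) => k; exact: kbdM. Qed.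

Lemma bSJ x : bS x -> bS (kadj x).
Proof. by move=> [M hM]; exists M => k; exact: kbdJ. Qed.

Lemma bS0 : bS 0.
Proof. by exists 0 => k; exact: kbd0. Qed.

Lemma bcomplete (u : nat -> kvec R T) : (forall n, bS (u n)) ->
  (forall e, 0 < e -> exists N, forall m n, (N <= m)%N -> (N <= n)%N ->
    bbd (u m - u n) e) ->
  exists2 x, bS x & forall e, 0 < e ->
    exists N, forall n, (N <= n)%N -> bbd (u n - x) e.
Proof.
move=> uS uc.
have /choice [x hx] : forall q : kidx T, exists l, forall e, 0 < e ->
    exists N, forall n, (N <= n)%N -> cnorm (u n q - l) <= e.
  move=> [k [i j]]; apply: complex_cauchy_limit => e e0; have [N hN] := uc _ e0.
  exists N => m n hm hn; exact: (kbd_ent i j (hN m n hm hn k)).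
(* The limit is taken entrywise. In block [k] it is compared with one [u m] whose finitely many
   entries there are close to it; [m] depends on the block and the vector, while [N] does not. *)
have ux e : 0 < e -> exists N, forall n, (N <= n)%N -> bbd (u n - x) e.
  move=> e0; have [N hN] := uc _ e0; exists N => n hn k; split=> [|xi]; first exact: ltW.
  apply/ler_addgt0Pr => d d0.
  pose c := #|{: T k * T k}|.+1%:R * (nm xi + 1).
  have c0 : 0 < c by rewrite mulr_gt0 ?ltr0n // ltr_wpDl ?nm_ge0.
  have [N1 hN1] := finite_eventually (fun p : T k * T k =>
    hx (existT _ k (p.1, p.2)) _ (divr_gt0 d0 c0)).
  pose m := maxn N N1.
  have -> : u n - x = (u n - u m) + (u m - x) by rewrite addrA subrK.
  rewrite kactD (le_trans (nmD _ _)) // lerD //.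
    by have [_] := hN n m hn (leq_maxl _ _) k; exact.
  have [_ /(_ xi) h] := kbd_sum_ent k (u m - x); rewrite (le_trans h) //.
  apply: (@le_trans _ _ (#|{: T k * T k}|.+1%:R * (d / c) * (nm xi + 1))); last first.
    by rewrite mulrAC -/c mulrC divfK // gt_eqF.
  apply: ler_pM; rewrite ?nm_ge0 //; last by rewrite lerDl.
    by apply: sumr_ge0 => i _; apply: sumr_ge0 => j _; exact: cnorm_ge0.
  rewrite pair_bigA /=.
  apply: (@le_trans _ _ (\sum_(p : T k * T k) d / c)).
    by apply: ler_sum => -[i j] _; exact: (hN1 (i, j) m (leq_maxr _ _)).
  rewrite sumr_const -[leLHS]mulr_natl ler_wpM2r ?ler_nat ?leqnSn //.
  by rewrite divr_ge0 // ltW.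
exists x => //; have [N hN] := ux 1 ltr01; have [M hM] := uS N.
exists (1 + M) => k; have := kbdD (kbdN (hN N (leqnn _) k)) (hM k).
by rewrite opprB subrK.
Qed.

Definition bpre : preCstar R.
Proof.
refine (@PreCstar R (kvec R T) bS (@kmul R T) (@kadj R T) bbd
  bS0 bSP bSM bSJ _ _ _ _ _ _ _ _ _ _ _ _ _ bcomplete).
- by move=> *; exact: kmulA.
- by move=> *; exact: kmulPl.
- by move=> *; exact: kmulPr.
- by move=> *; exact: kadjK.
- by move=> *; exact: kadjP.
- by move=> *; exact: kadjM.
- by move=> x M _ /(_ 0%N) [].
- by [].
- by move=> x M N _ MN h k; exact: kbd_mono MN (h k).
- by move=> x y M N _ _ h h' k; exact: kbdD.
- by move=> c x M _ h k; exact: kbdZ.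
- by move=> x y M N _ _ h h' k; exact: kbdM.
- by move=> x M _ M0 h k; exact: kbd_star.
Defined.

Lemma jSP c x y : jS x -> jS y -> jS (c *: x + y).
Proof.
move=> [Sx hx] [Sy hy]; split=> [|e e0]; first exact: bSP.
have c1 : 0 < cnorm c + 1 by rewrite ltr_wpDl // cnorm_ge0.
have [K hK] := hx (e / 2 / (cnorm c + 1)) (divr_gt0 (divr_gt0 e0 (ltr0n _ 2)) c1).
have [K' hK'] := hy (e / 2) (divr_gt0 e0 (ltr0n _ 2)).
exists (maxn K K') => k; rewrite geq_max => /andP [k1 k2].
rewrite [e]splitr; apply: kbdD (hK' _ k2); apply: kbd_mono (kbdZ c (hK _ k1)).
rewrite mulrA ler_pdivrMr // mulrC ler_wpM2l ?divr_ge0 ?(ltW e0) //.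
by rewrite lerDl.
Qed.

Lemma jSM x y : jS x -> jS y -> jS (kmul x y).
Proof.
move=> [Sx hx] [Sy hy]; split=> [|e e0]; first exact: bSM.
have [M hM] := Sx; have M0 : 0 <= M by have [] := hM 0%N.
have M1 : 0 < M + 1 by rewrite ltr_wpDl.
have [K hK] := hy (e / (M + 1)) (divr_gt0 e0 M1).
exists K => k hk; apply: kbd_mono (kbdM (hM k) (hK k hk)).
by rewrite mulrA ler_pdivrMr // mulrC ler_wpM2l ?(ltW e0) // lerDl.
Qed.

Lemma jSJ x : jS x -> jS (kadj x).
Proof.
move=> [Sx hx]; split=> [|e e0]; first exact: bSJ.
by have [K hK] := hx e e0; exists K => k hk; exact/kbdJ/hK.
Qed.

Lemma jS0 : jS 0.
Proof.
split=> [|e e0]; first exact: bS0.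
by exists 0%N => k _; exact: kbd_mono (ltW e0) (kbd0 _ _ _).
Qed.

Lemma jcomplete (u : nat -> kvec R T) : (forall n, jS (u n)) ->
  (forall e, 0 < e -> exists N, forall m n, (N <= m)%N -> (N <= n)%N ->
    bbd (u m - u n) e) ->
  exists2 x, jS x & forall e, 0 < e ->
    exists N, forall n, (N <= n)%N -> bbd (u n - x) e.
Proof.
move=> uS uc; have [|x Sx hx] := @bcomplete u _ uc; first by move=> n; have [] := uS n.
exists x => //; split=> // e e0; have e2 := divr_gt0 e0 (ltr0n R 2).
have [N hN] := hx _ e2; have [_ /(_ _ e2) [K hK]] := uS N.
exists K => k hk; have := kbdD (kbdN (hN N (leqnn _) k)) (hK k hk).
by rewrite opprB subrK -splitr.
Qed.

Definition jpre : preCstar R.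
Proof.
refine (@PreCstar R (kvec R T) jS (@kmul R T) (@kadj R T) bbd
  jS0 jSP jSM jSJ _ _ _ _ _ _ _ _ _ _ _ _ _ jcomplete).
- by move=> *; exact: kmulA.
- by move=> *; exact: kmulPl.
- by move=> *; exact: kmulPr.
- by move=> *; exact: kadjK.
- by move=> *; exact: kadjP.
- by move=> *; exact: kadjM.
- by move=> x M _ /(_ 0%N) [].
- by move=> x [].
- by move=> x M N _ MN h k; exact: kbd_mono MN (h k).
- by move=> x y M N _ _ h h' k; exact: kbdD.
- by move=> c x M _ h k; exact: kbdZ.
- by move=> x y M N _ _ h h' k; exact: kbdM.
- by move=> x M _ M0 h k; exact: kbd_star.
Defined.

Lemma qcomplete (u : nat -> kvec R T) : (forall n, bS (u n)) ->
  (forall e, 0 < e -> exists N, forall m n, (N <= m)%N -> (N <= n)%N ->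
    qbd (u m - u n) e) ->
  exists2 x, bS x & forall e, 0 < e ->
    exists N, forall n, (N <= n)%N -> qbd (u n - x) e.
Proof.
move=> uS uc.
(* The staircase chooses a sequence index for each block separately. Cutting out block [k] makes
   block bounds into bounds on vectors, and [y] below glues the chosen blocks together. *)
pose cut (w : kvec R T) (k : nat) : kvec R T := fun q => if tag q == k then w q else 0.
have cutE w k (xi : ell2 R (T k)) : kact (cut w k) xi = kact w xi.
  by apply/funext => i; apply: eq_bigr => j _; rewrite /ent /cut /= eqxx.
have kbd_cut w k e : kbd k (cut w k) e <-> kbd k w e.
  by split=> -[e0 h]; split=> // xi; have := h xi; rewrite cutE.
have cutB v w k : cut v k - cut w k = cut (v - w) k.
  by apply/funext => q; rewrite -[LHS]/(_ - _) /cut -[(v - w) q]/(v q - w q);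
    case: ifP; rewrite ?subr0.
have [||e e0|x xu hx] := @staircase_limit R _ (fun k => @kbd R T k) _ _ (fun n k => cut (u n) k).
- by move=> k v w z e f; exact: kbdB.
- by move=> k v M N; exact: kbd_mono.
- have [N hN] := uc e e0; exists N => m n hm hn; have [K hK] := hN m n hm hn.
  by exists K => k hk; rewrite cutB kbd_cut; exact: hK.
pose y : kvec R T := fun q => x (tag q) q.
have cuty k : cut y k = cut (x k) k.
  apply/funext => -[k' p]; rewrite /cut /y /=.
  by case: eqP => // e; subst k'.
have uy e : 0 < e -> exists N, forall n, (N <= n)%N -> qbd (u n - y) e.
  move=> e0; have [N hN] := hx e e0; exists N => n hn; have [K hK] := hN n hn.
  exists K => k hk; rewrite -kbd_cut -cutB cuty cutB.
  have := hK k hk; rewrite -kbd_cut.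
  have -> : cut (cut (u n) k - x k) k = cut (u n - x k) k => //.
  by apply/funext => q; rewrite /cut -[(_ - x k) q]/((if _ then _ else _) - x k q);
    case: ifP => // ->.
exists y => //; have [N hN] := uy 1 ltr01; have [K hK] := hN N (leqnn _).
have [M hM] := uS N; apply: (@qbd_bS _ (1 + M)); exists K => k hk.
have := kbdD (kbdN (hK k hk)) (hM k).
by rewrite opprB subrK.
Qed.

Definition qpre : preCstar R.
Proof.
refine (@PreCstar R (kvec R T) bS (@kmul R T) (@kadj R T) qbd
  bS0 bSP bSM bSJ _ _ _ _ _ _ _ _ _ _ _ _ _ qcomplete).
- by move=> *; exact: kmulA.
- by move=> *; exact: kmulPl.
- by move=> *; exact: kmulPr.
- by move=> *; exact: kadjK.
- by move=> *; exact: kadjP.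
- by move=> *; exact: kadjM.
- by move=> x M _ [K /(_ K (leqnn _))] [].
- by move=> x [M hM]; exists M; exact: bbd_qbd.
- by move=> x M N _ MN [K hK]; exists K => k hk; exact: kbd_mono MN (hK k hk).
- move=> x y M N _ _ [K hK] [K' hK']; exists (maxn K K') => k.
  by rewrite geq_max => /andP [k1 k2]; apply: kbdD; [exact: hK|exact: hK'].
- by move=> c x M _ [K hK]; exists K => k hk; exact/kbdZ/hK.
- move=> x y M N _ _ [K hK] [K' hK']; exists (maxn K K') => k.
  by rewrite geq_max => /andP [k1 k2]; apply: kbdM; [exact: hK|exact: hK'].
- by move=> x M _ M0 [K hK]; exists K => k hk; exact/kbd_star/hK.
Defined.

Lemma b_one_S : bS (@kone R T).
Proof. by exists 1 => k; exact: kbd1. Qed.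

Lemma kmul1x : left_id (@kone R T) (@kmul R T).
Proof.
move=> x; apply: kvec_ext => k i j; rewrite ent_mul (bigD1 i) //= big1 ?addr0.
  by rewrite /ent /kone /= eqxx mul1r.
by move=> l /negbTE li; rewrite /ent /kone /= eq_sym li mul0r.
Qed.

Lemma kmulx1 : right_id (@kone R T) (@kmul R T).
Proof.
move=> x; apply: kvec_ext => k i j; rewrite ent_mul (bigD1 j) //= big1 ?addr0.
  by rewrite /ent /kone /= eqxx mulr1.
by move=> l /negbTE lj; rewrite /ent /kone /= lj mulr0.
Qed.

Lemma unital_model : exists (A : unitalCstarType R) (pi : kvec R T -> A),
  cq_model (P := bpre) pi /\ pi (@kone R T) = aone.
Proof.
have m := cq_modelP bpre; set pi := @cqpi R bpre in m.
have pM := model_mul m; have psurj := model_surj m.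
have one1 : left_id (pi (@kone R T)) (@amul R (cq bpre)).
  move=> z; have [x Sx ->] := psurj z; rewrite -(pM _ _ b_one_S Sx).
  by congr pi; exact: kmul1x.
have one2 : right_id (pi (@kone R T)) (@amul R (cq bpre)).
  move=> z; have [x Sx ->] := psurj z; rewrite -(pM _ _ Sx b_one_S).
  by congr pi; exact: kmulx1.
pose U : unitalCstarType R := HB.pack (cq bpre)
  (CstarAlgebra_isUnital.Build R (cq bpre) one1 one2).
by exists U, pi.
Qed.

End SequenceAlgebras.

Section SequenceModels.
Context (R : realType) (T : nat -> finType).
Context (B J Q : cstarType R) (bpi : kvec R T -> B) (jpi : kvec R T -> J)
  (qpi : kvec R T -> Q).
Hypotheses (mb : cq_model (P := bpre R T) bpi) (mj : cq_model (P := jpre R T) jpi)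
  (mq : cq_model (P := qpre R T) qpi).
Implicit Types (x y : kvec R T) (M : R).

Lemma bpi_inj x y : bS x -> bS y -> bpi x = bpi y -> x = y.
Proof.
move=> Sx Sy e; have Sd : bS (x - y) by exact: (@pSB _ (bpre R T)).
have e0 : nm (bpi (x - y)) = 0.
  by rewrite (model_sub mb Sx Sy) e subrr nm0.
apply: kvec_ext => k i j; apply/subr0_eq/cnorm_eq0/eqP.
rewrite eq_le cnorm_ge0 andbT; apply/ler_addgt0Pr => d d0; rewrite add0r.
have d1 : nm (bpi (x - y)) < d by rewrite e0.
exact: (kbd_ent i j (model_lt mb Sd d1 k)).
Qed.

Lemma model_fun (P : kvec R T -> Prop) (A : cstarType R) (pi : kvec R T -> A) :
  (forall z : A, exists2 x, P x & z = pi x) ->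
  exists val : A -> kvec R T, forall z, P (val z) /\ pi (val z) = z.
Proof.
move=> h; have /choice [v hv] : forall z : A, exists x, P x /\ pi x = z.
  by move=> z; have [x Px ->] := h z; exists x.
by exists v.
Qed.

(** All three algebras are presented by the same sequences, so both maps are the identity on
    representatives; they are well defined because [J] and [B] have the same bounds and a bounded
    sequence is determined by its class in [B]. A class dies in [Q] exactly when its block norms
    tend to zero, which is membership in [jS]. *)
Lemma models_exact : exists (f : J -> B) (g : B -> Q), [/\ short_exact f g,
  forall x, jS x -> f (jpi x) = bpi x & forall x, bS x -> g (bpi x) = qpi x].
Proof.
have [jv jvP] := model_fun (model_surj mj); have [bv bvP] := model_fun (model_surj mb).
pose f z := bpi (jv z); pose g z := qpi (bv z).
have fE x : jS x -> f (jpi x) = bpi x.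
  move=> Jx; have [Jv ev] := jvP (jpi x); rewrite /f.
  have [Bv _] : jS (jv (jpi x)) := Jv; have [Bx _] := Jx.
  apply/subr0_eq; rewrite -(model_sub mb Bv Bx); apply: nm_eq0.
  have e0 : nm (jpi (jv (jpi x) - x)) = 0 by rewrite (model_sub mj Jv Jx) ev subrr nm0.
  apply/eqP; rewrite eq_le nm_ge0 andbT; apply/ler_addgt0Pr => d d0; rewrite add0r.
  have d1 : nm (jpi (jv (jpi x) - x)) < d by rewrite e0.
  have Jd : jS (jv (jpi x) - x) by exact: (@pSB _ (jpre R T)).
  have Bd : bS (jv (jpi x) - x) by case: Jd.
  by apply: (model_le mb Bd); exact: (model_lt mj Jd d1).
have gE x : bS x -> g (bpi x) = qpi x.
  move=> Bx; have [Bv ev] := bvP (bpi x); rewrite /g.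
  by rewrite (bpi_inj Bv Bx ev).
have jP (z : J) : exists2 x, jS x & z = jpi x by exact: (model_surj mj).
have bP (z : B) : exists2 x, bS x & z = bpi x by exact: (model_surj mb).
have qP (z : Q) : exists2 x, bS x & z = qpi x by exact: (model_surj mq).
exists f, g; split=> //; split.
- split.
  + move=> c z z'; have [x Jx ->] := jP z; have [y Jy ->] := jP z'.
    have [Bx _] := Jx; have [By _] := Jy.
    by rewrite -(model_lin mj c Jx Jy) (fE _ (jSP c Jx Jy)) !fE // (model_lin mb c Bx By).
  + move=> z z'; have [x Jx ->] := jP z; have [y Jy ->] := jP z'.
    have [Bx _] := Jx; have [By _] := Jy.
    by rewrite -(model_mul mj Jx Jy) (fE _ (jSM Jx Jy)) !fE // (model_mul mb Bx By).
  + move=> z; have [x Jx ->] := jP z; have [Bx _] := Jx.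
    by rewrite -(model_adj mj Jx) (fE _ (jSJ Jx)) fE // (model_adj mb Bx).
- split.
  + move=> c z z'; have [x Bx ->] := bP z; have [y By ->] := bP z'.
    by rewrite -(model_lin mb c Bx By) (gE _ (bSP c Bx By)) !gE // (model_lin mq c Bx By).
  + move=> z z'; have [x Bx ->] := bP z; have [y By ->] := bP z'.
    by rewrite -(model_mul mb Bx By) (gE _ (bSM Bx By)) !gE // (model_mul mq Bx By).
  + move=> z; have [x Bx ->] := bP z.
    by rewrite -(model_adj mb Bx) (gE _ (bSJ Bx)) gE // (model_adj mq Bx).
- move=> z z'; have [x Jx ->] := jP z; have [y Jy ->] := jP z'.
  have [Bx _] := Jx; have [By _] := Jy.
  by rewrite !fE // => /(bpi_inj Bx By) ->.
- by move=> z; have [x Bx ->] := qP z; exists (bpi x); exact: gE.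
move=> z; have [x Bx ->] := bP z; rewrite gE //; split.
  move=> h; have Jx : jS x.
    by split=> // e e0; apply: (model_lt mq Bx); rewrite h nm0.
  by exists (jpi x); rewrite fE.
move=> [w]; have [y Jy ->] := jP w; have [By hy] := Jy.
rewrite fE // => /(bpi_inj By Bx) <-; apply: nm_eq0.
apply/eqP; rewrite eq_le nm_ge0 andbT; apply/ler_addgt0Pr => e e0; rewrite add0r.
by apply: (model_le mq By); exact: hy.
Qed.

Lemma matrix_rep k : exists rho : B -> ell2 R (T k) -> ell2 R (T k),
  is_rep rho /\ forall x xi, bS x -> rho (bpi x) xi = kact x xi.
Proof.
have [bv bvP] := model_fun (model_surj mb).
pose rho z (xi : ell2 R (T k)) := kact (bv z) xi.
have rE x xi : bS x -> rho (bpi x) xi = kact x xi.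
  by move=> Bx; have [Bv ev] := bvP (bpi x); rewrite /rho (bpi_inj Bv Bx ev).
have bP (z : B) : exists2 x, bS x & z = bpi x by exact: (model_surj mb).
exists rho; split=> //; split.
- move=> z; split; first exact: kact_linear.
  have [x Bx ->] := bP z; have [M hM] := Bx.
  apply: (@bounded_linear_continuous _ _ _ _ M); first exact: kact_linear.
  by move=> xi; rewrite rE //; have [_ h] := hM k; exact: h.
- move=> c a b xi; have [x Bx ->] := bP a; have [y By ->] := bP b.
  by rewrite -(model_lin mb c Bx By) (rE _ _ (bSP c Bx By)) !rE // kactP.
- move=> a b xi; have [x Bx ->] := bP a; have [y By ->] := bP b.
  by rewrite -(model_mul mb Bx By) (rE _ _ (bSM Bx By)) !rE // kactM.
- move=> a xi eta; have [x Bx ->] := bP a.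
  by rewrite -(model_adj mb Bx) (rE _ _ (bSJ Bx)) !rE // kactJ.
Qed.

End SequenceModels.

(** * Real matrices and near-commutation *)

Section RealKernels.
Context (R : realType) (T : finType).

Definition rk := T -> T -> R^o.
HB.instance Definition _ := GRing.Lmodule.on rk.
Implicit Types (X Y Z : rk) (c d : R).

Definition rmul X Y : rk := fun i j => \sum_l X i l * Y l j.
Definition r1 : rk := fun i j => (i == j)%:R.
Definition rtr X : rk := fun i j => X j i.
(** The Hilbert-Schmidt inner product; [rN] is its norm, and the spectral gap is stated for it. *)
Definition rdot X Y : R := \sum_i \sum_j X i j * Y i j.
Definition rN X : R := l2 (fun p : T * T => X p.1 p.2).
Definition rcomm Y X : rk := rmul Y X - rmul X Y.

Lemma rk_ext X Y : (forall i j, X i j = Y i j) -> X = Y.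
Proof. by move=> h; apply/funext => i; apply/funext => j. Qed.

Lemma rkD X Y i j : (X + Y) i j = X i j + Y i j. Proof. by []. Qed.
Lemma rkN X i j : (- X) i j = - X i j. Proof. by []. Qed.
Lemma rkZ c X i j : (c *: X) i j = c * X i j. Proof. by []. Qed.
Lemma rk0 i j : (0 : rk) i j = 0. Proof. by []. Qed.

Definition rkE := (rkD, rkN, rkZ, rk0).

Lemma rmulA X Y Z : rmul X (rmul Y Z) = rmul (rmul X Y) Z.
Proof.
apply: rk_ext => i j; rewrite /rmul.
under eq_bigr => l _ do rewrite mulr_sumr.
rewrite exchange_big; apply: eq_bigr => m _ /=; rewrite mulr_suml.
by apply: eq_bigr => l _; rewrite mulrA.
Qed.

Lemma rmulDl X Y Z : rmul (X + Y) Z = rmul X Z + rmul Y Z.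
Proof.
apply: rk_ext => i j; rewrite rkD /rmul -big_split.
by apply: eq_bigr => l _; rewrite rkD mulrDl.
Qed.

Lemma rmulDr X Y Z : rmul Z (X + Y) = rmul Z X + rmul Z Y.
Proof.
apply: rk_ext => i j; rewrite rkD /rmul -big_split.
by apply: eq_bigr => l _; rewrite rkD mulrDr.
Qed.

Lemma rmulZl c X Y : rmul (c *: X) Y = c *: rmul X Y.
Proof.
apply: rk_ext => i j; rewrite rkZ /rmul mulr_sumr.
by apply: eq_bigr => l _; rewrite rkZ mulrA.
Qed.

Lemma rmulZr c X Y : rmul X (c *: Y) = c *: rmul X Y.
Proof.
apply: rk_ext => i j; rewrite rkZ /rmul mulr_sumr.
by apply: eq_bigr => l _; rewrite rkZ mulrCA.
Qed.

Lemma rmulNl X Y : rmul (- X) Y = - rmul X Y.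
Proof. by rewrite -scaleN1r rmulZl scaleN1r. Qed.

Lemma rmulNr X Y : rmul X (- Y) = - rmul X Y.
Proof. by rewrite -[- Y]scaleN1r rmulZr scaleN1r. Qed.

Lemma rmul0l X : rmul 0 X = 0.
Proof. by have := rmulZl 0 0 X; rewrite !scale0r. Qed.

Lemma rmul0r X : rmul X 0 = 0.
Proof. by have := rmulZr 0 X 0; rewrite !scale0r. Qed.

Lemma rmul1l X : rmul r1 X = X.
Proof.
apply: rk_ext => i j; rewrite /rmul (bigD1 i) //= big1 ?addr0 /r1 ?eqxx ?mul1r //.
by move=> l /negbTE li; rewrite eq_sym li mul0r.
Qed.

Lemma rmul1r X : rmul X r1 = X.
Proof.
apply: rk_ext => i j; rewrite /rmul (bigD1 j) //= big1 ?addr0 /r1 ?eqxx ?mulr1 //.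
by move=> l /negbTE lj; rewrite lj mulr0.
Qed.

Lemma rmul_suml (I : Type) (r : seq I) (F : I -> rk) X :
  rmul (\sum_(i <- r) F i) X = \sum_(i <- r) rmul (F i) X.
Proof.
by elim: r => [|i r ih]; rewrite ?big_nil ?rmul0l // !big_cons rmulDl ih.
Qed.

Lemma rmul_sumr (I : Type) (r : seq I) (F : I -> rk) X :
  rmul X (\sum_(i <- r) F i) = \sum_(i <- r) rmul X (F i).
Proof.
by elim: r => [|i r ih]; rewrite ?big_nil ?rmul0r // !big_cons rmulDr ih.
Qed.

Lemma rtrK X : rtr (rtr X) = X. Proof. by []. Qed.

Lemma rtrM X Y : rtr (rmul X Y) = rmul (rtr Y) (rtr X).
Proof. by apply: rk_ext => i j; apply: eq_bigr => l _; rewrite mulrC. Qed.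

Lemma rdotC X Y : rdot X Y = rdot Y X.
Proof. by apply: eq_bigr => i _; apply: eq_bigr => j _; rewrite mulrC. Qed.

Lemma rdotDl X Y Z : rdot (X + Y) Z = rdot X Z + rdot Y Z.
Proof.
rewrite /rdot -big_split; apply: eq_bigr => i _ /=; rewrite -big_split.
by apply: eq_bigr => j _ /=; rewrite rkD mulrDl.
Qed.

Lemma rdotZl c X Z : rdot (c *: X) Z = c * rdot X Z.
Proof.
rewrite /rdot mulr_sumr; apply: eq_bigr => i _; rewrite mulr_sumr.
by apply: eq_bigr => j _; rewrite rkZ mulrA.
Qed.

Lemma rdotNl X Z : rdot (- X) Z = - rdot X Z.
Proof. by rewrite -scaleN1r rdotZl mulN1r. Qed.

Lemma rdotDr X Y Z : rdot Z (X + Y) = rdot Z X + rdot Z Y.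
Proof. by rewrite rdotC rdotDl ![rdot _ Z]rdotC. Qed.

Lemma rdotNr X Z : rdot Z (- X) = - rdot Z X.
Proof. by rewrite rdotC rdotNl rdotC. Qed.

Lemma rdotZr c X Z : rdot Z (c *: X) = c * rdot Z X.
Proof. by rewrite rdotC rdotZl rdotC. Qed.

Lemma rdotBr X Y Z : rdot Z (X - Y) = rdot Z X - rdot Z Y.
Proof. by rewrite rdotDr rdotNr. Qed.

Lemma rN_sq X : rN X ^+ 2 = rdot X X.
Proof.
rewrite l2_sq /rdot pair_bigA /=; apply: eq_bigr => p _; by rewrite expr2.
Qed.

Lemma rN_ge0 X : 0 <= rN X. Proof. exact: l2_ge0. Qed.

Lemma rdot_le X Y : `|rdot X Y| <= rN X * rN Y.
Proof. by rewrite /rdot pair_bigA /= l2_dot. Qed.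

Lemma rND X Y : rN (X + Y) <= rN X + rN Y.
Proof. exact: l2D. Qed.

Lemma rNZ c X : rN (c *: X) = `|c| * rN X.
Proof. by rewrite /rN -l2Z. Qed.

Lemma rNN X : rN (- X) = rN X.
Proof. by rewrite -scaleN1r rNZ normrN normr1 mul1r. Qed.

Lemma rN0 : rN 0 = 0.
Proof. by have := rNZ 0 0; rewrite scale0r normr0 mul0r. Qed.

Lemma rN_tr X : rN (rtr X) = rN X.
Proof.
rewrite /rN /l2; congr Num.sqrt.
rewrite -(pair_bigA _ (fun i j => rtr X i j ^+ 2)) exchange_big /=.
by rewrite pair_bigA.
Qed.

Lemma rdot_mull X Y Z : rdot (rmul X Y) Z = rdot Y (rmul (rtr X) Z).
Proof.
rewrite /rdot /rmul.
under eq_bigr => i _ do under eq_bigr => j _ do rewrite mulr_suml.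
under eq_bigr => i _ do rewrite exchange_big.
rewrite exchange_big; apply: eq_bigr => l _ /=.
rewrite exchange_big; apply: eq_bigr => j _ /=; rewrite mulr_sumr.
by apply: eq_bigr => i _; rewrite mulrAC mulrC.
Qed.

Lemma rdot_tr X Y : rdot (rtr X) (rtr Y) = rdot X Y.
Proof. by rewrite /rdot exchange_big. Qed.

Definition rsa X := rtr X = X.
Definition rproj X := rsa X /\ rmul X X = X.
(** A real symmetric involution, that is, a symmetry with eigenvalues 1 and -1; the name does not
    mean an inverse. *)
Definition rinv X := rsa X /\ rmul X X = r1.

Definition rcontr Y := forall X, rN (rmul Y X) <= rN X /\ rN (rmul X Y) <= rN X.

Lemma rproj_le P X : rproj P -> rN (rmul P X) <= rN X.
Proof.
move=> [sP iP]; have [->|n0] := eqVneq (rN (rmul P X)) 0; first exact: rN_ge0.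
have n1 : 0 < rN (rmul P X) by rewrite lt_neqAle eq_sym n0 rN_ge0.
rewrite -(ler_pM2r n1) -expr2 rN_sq rdot_mull sP rmulA iP.
exact: le_trans (ler_norm _) (rdot_le _ _).
Qed.

Lemma riso_le Y X : rproj (rmul (rtr Y) Y) -> rN (rmul Y X) <= rN X.
Proof.
move=> hP; rewrite -(ler_pXn2r (n := 2)) ?nnegrE ?rN_ge0 //.
rewrite rN_sq rdot_mull rmulA (le_trans (ler_norm _)) // (le_trans (rdot_le _ _)) //.
by rewrite expr2 ler_wpM2l ?rN_ge0 // rproj_le.
Qed.

Lemma riso_contr Y : rproj (rmul (rtr Y) Y) -> rproj (rmul Y (rtr Y)) -> rcontr Y.
Proof.
move=> h1 h2 X; split; first exact: riso_le.
rewrite -rN_tr rtrM -[leRHS]rN_tr; apply: riso_le; by rewrite rtrK.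
Qed.

Lemma rproj_contr P : rproj P -> rcontr P.
Proof. by move=> hP; have [sP iP] := hP; apply: riso_contr; rewrite sP iP. Qed.

Lemma rproj1 : rproj r1.
Proof.
split; last exact: rmul1l.
by apply: rk_ext => i j; rewrite /rtr /r1 eq_sym.
Qed.

Lemma rinv_contr S : rinv S -> rcontr S.
Proof. by move=> [sS iS]; apply: riso_contr; rewrite sS iS; exact: rproj1. Qed.

Lemma rcontrM Y Z : rcontr Y -> rcontr Z -> rcontr (rmul Y Z).
Proof.
move=> hY hZ X; split.
  by rewrite -rmulA (le_trans (hY _).1) //; exact: (hZ _).1.
by rewrite rmulA (le_trans (hZ _).2) //; exact: (hY _).2.
Qed.

Lemma rinv_N S X : rinv S -> rN (rmul S X) = rN X.
Proof.
move=> hS; apply/eqP; rewrite eq_le (rinv_contr hS X).1 /=.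
by rewrite -{1}[X]rmul1l -hS.2 -rmulA (rinv_contr hS _).1.
Qed.

Lemma rinv_Nr S X : rinv S -> rN (rmul X S) = rN X.
Proof.
move=> hS; apply/eqP; rewrite eq_le (rinv_contr hS X).2 /=.
by rewrite -{1}[X]rmul1r -hS.2 rmulA (rinv_contr hS _).2.
Qed.

Lemma rinv_comm S X : rinv S -> rN (rmul (rmul S X) S - X) = rN (rcomm S X).
Proof.
move=> hS; rewrite -(rinv_Nr (rcomm S X) hS) /rcomm rmulDl rmulNl.
by rewrite -[rmul (rmul X S) S]rmulA hS.2 rmul1r.
Qed.

Lemma rcommD Y Z X : rcomm (Y + Z) X = rcomm Y X + rcomm Z X.
Proof. by rewrite /rcomm rmulDl rmulDr opprD addrACA. Qed.

Lemma rcommZ c Y X : rcomm (c *: Y) X = c *: rcomm Y X.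
Proof. by rewrite /rcomm rmulZl rmulZr scalerBr. Qed.

Lemma rcomm1 X : rcomm r1 X = 0.
Proof. by rewrite /rcomm rmul1l rmul1r subrr. Qed.

Lemma rcommM Y Z X : rcomm (rmul Y Z) X = rmul Y (rcomm Z X) + rmul (rcomm Y X) Z.
Proof.
rewrite /rcomm rmulDr rmulNr rmulDl rmulNl !rmulA.
by rewrite addrA subrK.
Qed.

(** By the Leibniz rule commutator errors add up along products of contractions. This lets an
    approximate commutant be handled almost like a commutant. *)
Lemma rN_commM Y Z X : rcontr Y -> rcontr Z ->
  rN (rcomm (rmul Y Z) X) <= rN (rcomm Y X) + rN (rcomm Z X).
Proof.
move=> hY hZ; rewrite rcommM (le_trans (rND _ _)) // addrC lerD //.
  exact: (hZ _).2.
exact: (hY _).1.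
Qed.

Lemma rN_comm_sum (I : Type) (r : seq I) (F : I -> rk) X c :
  (forall i, rN (rcomm (F i) X) <= c) ->
  rN (rcomm (\sum_(i <- r) F i) X) <= c *+ size r.
Proof.
move=> h; elim: r => [|i r ih]; first by rewrite big_nil /rcomm rmul0l rmul0r subrr rN0.
by rewrite big_cons rcommD /= mulrS (le_trans (rND _ _)) // lerD.
Qed.

(* The trace is taken against the identity, so that it is bounded by [rdot_le]. *)
Definition rtrace X : R := \sum_i X i i.

Lemma rtraceE X Y : rtrace (rmul X Y) = rdot X (rtr Y).
Proof. by []. Qed.

Lemma rtrace_mulC X Y : rtrace (rmul X Y) = rtrace (rmul Y X).
Proof. by rewrite !rtraceE -rdot_tr rtrK rdotC. Qed.

Lemma rtraceD X Y : rtrace (X + Y) = rtrace X + rtrace Y.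
Proof. by rewrite /rtrace -big_split. Qed.

Lemma rtraceN X : rtrace (- X) = - rtrace X.
Proof. by rewrite /rtrace sumrN. Qed.

Lemma rtraceZ c X : rtrace (c *: X) = c * rtrace X.
Proof. by rewrite /rtrace mulr_sumr. Qed.

Lemma rtrace1 : rtrace r1 = #|T|%:R.
Proof.
rewrite /rtrace (eq_bigr (fun _ => 1)) ?sumr_const // => i _.
by rewrite /r1 eqxx.
Qed.

End RealKernels.

Section TensorKernels.
Context (R : realType) (I G : finType).

Definition tk (E : rk R I) (r : rk R G) : rk R (I * G)%type :=
  fun i j => E i.1 j.1 * r i.2 j.2.

Lemma tkM E E' r r' : rmul (tk E r) (tk E' r') = tk (rmul E E') (rmul r r').
Proof.
apply: rk_ext => i j; rewrite /rmul /tk mulr_suml.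
rewrite -(pair_bigA _ (fun a g => E i.1 a * r i.2 g * (E' a j.1 * r' g j.2))) /=.
apply: eq_bigr => a _; rewrite mulr_sumr; apply: eq_bigr => g _.
by rewrite mulrACA.
Qed.

Lemma tk_tr E r : rtr (tk E r) = tk (rtr E) (rtr r).
Proof. by []. Qed.

Lemma tkDl E E' r : tk (E + E') r = tk E r + tk E' r.
Proof. by apply: rk_ext => i j; rewrite /tk !rkE mulrDl. Qed.

Lemma tkDr E r r' : tk E (r + r') = tk E r + tk E r'.
Proof. by apply: rk_ext => i j; rewrite /tk !rkE mulrDr. Qed.

Lemma tkZl c E r : tk (c *: E) r = c *: tk E r.
Proof. by apply: rk_ext => i j; rewrite /tk !rkE mulrA. Qed.

Lemma tkZr c E r : tk E (c *: r) = c *: tk E r.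
Proof. by apply: rk_ext => i j; rewrite /tk !rkE mulrCA. Qed.

Lemma tk0l r : tk 0 r = 0.
Proof. by apply: rk_ext => i j; rewrite /tk !rkE mul0r. Qed.

Lemma tk0r E : tk E 0 = 0.
Proof. by apply: rk_ext => i j; rewrite /tk !rkE mulr0. Qed.

Lemma tk1 : tk (@r1 R I) (@r1 R G) = @r1 R _.
Proof.
apply: rk_ext => -[a g] [b h]; rewrite /tk /r1 /= -natrM mulnb.
by rewrite -pair_eqE.
Qed.

Lemma tk_suml (J : Type) (s : seq J) (F : J -> rk R I) r :
  tk (\sum_(j <- s) F j) r = \sum_(j <- s) tk (F j) r.
Proof.
by elim: s => [|j s ih]; rewrite ?big_nil ?tk0l // !big_cons tkDl ih.
Qed.

Lemma tk_proj E r : rproj E -> rproj r -> rproj (tk E r).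
Proof.
by move=> [sE iE] [sr ir]; split; rewrite /rsa ?tk_tr ?tkM ?sE ?sr ?iE ?ir.
Qed.

Definition eu (a b : I) : rk R I := fun i j => ((i == a) && (j == b))%:R.

Lemma eu_tr a b : rtr (eu a b) = eu b a.
Proof. by apply: rk_ext => i j; rewrite /rtr /eu andbC. Qed.

Lemma euM a b c d : rmul (eu a b) (eu c d) = (b == c)%:R *: eu a d.
Proof.
apply: rk_ext => i j; rewrite rkZ /rmul (bigD1 b) //= big1 ?addr0.
  rewrite /eu eqxx andbT -!natrM !mulnb; congr (_%:R); do !case: eqP => //.
by move=> l /negbTE lb; rewrite /eu lb andbF mul0r.
Qed.

Lemma euMe a b c : rmul (eu a b) (eu b c) = eu a c.
Proof. by rewrite euM eqxx scale1r. Qed.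

Lemma eu_proj a : rproj (eu a a).
Proof. by split; [rewrite /rsa eu_tr | rewrite euMe]. Qed.

Lemma eu_sum : \sum_a eu a a = @r1 R I.
Proof.
apply: rk_ext => i j; rewrite !fct_sumE (bigD1 i) //= big1 ?addr0.
  by rewrite /eu eqxx /r1 eq_sym.
by move=> a /negbTE ai; rewrite /eu eq_sym ai.
Qed.

Lemma eu_sandwich (E : rk R I) a b : rmul (rmul (eu a a) E) (eu b b) = E a b *: eu a b.
Proof.
have h1 i l : rmul (eu a a) E i l = (i == a)%:R * E a l.
  rewrite /rmul (bigD1 a) //= big1 ?addr0 /eu ?eqxx ?andbT //.
  by move=> m /negbTE ma; rewrite ma andbF mul0r.
apply: rk_ext => i j; rewrite rkZ {1}/rmul (bigD1 b) //= big1 ?addr0.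
  by rewrite h1 /eu eqxx /= -mulnb natrM mulrCA mulrA.
by move=> m /negbTE mb; rewrite /eu mb mulr0.
Qed.

Lemma tk_eu_contr a b r : rinv r -> rcontr (tk (eu a b) r).
Proof.
move=> [sr ir]; apply: riso_contr; rewrite tk_tr tkM eu_tr sr ir euMe.
  by apply: tk_proj; [exact: eu_proj | exact: rproj1].
by apply: tk_proj; [exact: eu_proj | exact: rproj1].
Qed.

Lemma rinv1 : rinv (@r1 R G).
Proof. by have [] := @rproj1 R G. Qed.

End TensorKernels.

(** * Recovering matrix units and four symmetries from one magic block and one projection *)

Section Amplification.
Context (R : realType) (G : finType) (r : 'I_3 -> rk R G) (rf : rk R G).
Hypotheses (hr : forall c, rinv (r c)) (hf : rinv rf).

Definition qhalf (s : rk R G) : rk R G := 2^-1 *: (@r1 R G + s).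

Lemma rinvN (s : rk R G) : rinv s -> rinv (- s).
Proof.
move=> [ss is_]; split; last by rewrite rmulNl rmulNr opprK.
by rewrite /rsa -{2}ss.
Qed.

Lemma qhalf_proj s : rinv s -> rproj (qhalf s).
Proof.
move=> [ss is_]; split.
  apply: rk_ext => i j; rewrite /rtr /qhalf !rkE {1}/r1 eq_sym -/(@r1 R G i j).
  by rewrite -{2}ss.
rewrite /qhalf rmulZl rmulZr scalerA rmulDl rmul1l rmulDr rmul1r is_.
apply: rk_ext => i j; rewrite !rkE; lra.
Qed.

Lemma qhalf_orth s : rinv s -> rmul (qhalf s) (qhalf (- s)) = 0.
Proof.
move=> [ss is_]; rewrite /qhalf rmulZl rmulZr scalerA rmulDl rmul1l rmulDr rmul1r.
by rewrite rmulNr is_; apply: rk_ext => i j; rewrite !rkE; ring.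
Qed.

(* A 3 x 3 magic unitary: the spectral projections [qe c], [qo c] of [r c] in the matrix blocks
   [c], [c] are spread along the lines [k - i = c] and [i + k = c]. Near-commutation with its
   entries and with [pp], which mixes the three blocks, gives back the matrix units, the [r c]
   and [rf]. *)
Definition qe (c : 'I_3) := tk (eu R c c) (qhalf (r c)).
Definition qo (c : 'I_3) := tk (eu R c c) (qhalf (- r c)).
Definition ub (i k : 'I_3) := qe (k - i) + qo (i + k).

(** [Jm] and [Psi] are the projections onto the lines of [(1, 1, 1)] and [(0, 1, -1)]. These are
    orthogonal, so [pp] is a projection for any symmetry [rf]. The vanishing row and column of [Psi]
    leave blocks of [pp] that are multiples of matrix units, while [rf] is read off from the
    others. *)
Definition Jm : rk R 'I_3 := fun i j => 3^-1.
Definition Psi : rk R 'I_3 := fun i j =>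
  if (i == 0) || (j == 0) then 0 else if i == j then 2^-1 else - 2^-1.
Definition pp := tk Jm (@r1 R G) + tk Psi (qhalf rf).

Lemma qe_proj c : rproj (qe c).
Proof. by apply: tk_proj; [exact: eu_proj | exact: qhalf_proj]. Qed.

Lemma qo_proj c : rproj (qo c).
Proof. by apply: tk_proj; [exact: eu_proj | exact/qhalf_proj/rinvN]. Qed.

Lemma qeM a b : rmul (qe a) (qe b) = (a == b)%:R *: qe a.
Proof.
rewrite tkM euM; have [<-|_] := eqVneq a b; last by rewrite !scale0r tk0l.
by rewrite !scale1r (qhalf_proj (hr a)).2.
Qed.

Lemma qoM a b : rmul (qo a) (qo b) = (a == b)%:R *: qo a.
Proof.
rewrite tkM euM; have [<-|_] := eqVneq a b; last by rewrite !scale0r tk0l.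
by rewrite !scale1r (qhalf_proj (rinvN (hr a))).2.
Qed.

Lemma qeoM a b : rmul (qe a) (qo b) = 0.
Proof.
rewrite tkM euM; have [<-|_] := eqVneq a b; last by rewrite !scale0r tk0l.
by rewrite (qhalf_orth (hr a)) tk0r.
Qed.

Lemma qoeM a b : rmul (qo a) (qe b) = 0.
Proof.
rewrite tkM euM; have [<-|_] := eqVneq a b; last by rewrite !scale0r tk0l.
by have := qhalf_orth (rinvN (hr a)); rewrite opprK => ->; rewrite tk0r.
Qed.

Lemma qeoD c : qe c + qo c = tk (eu R c c) (@r1 R G).
Proof.
rewrite -tkDr; congr tk; apply: rk_ext => i j; rewrite /qhalf !rkE; lra.
Qed.

Lemma ubM i i' k k' : rmul (ub i k) (ub i' k') =
  (k - i == k' - i')%:R *: qe (k - i) + (i + k == i' + k')%:R *: qo (i + k).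
Proof.
by rewrite /ub rmulDl !rmulDr qeM qoM qeoM qoeM addr0 add0r.
Qed.

Lemma ub_proj i k : rproj (ub i k).
Proof.
split; last by rewrite ubM !eqxx !scale1r.
by rewrite /rsa -[LHS]/(rtr (qe (k - i)) + rtr (qo (i + k))) (qe_proj _).1 (qo_proj _).1.
Qed.

Lemma sum_qeo : \sum_c qe c + \sum_c qo c = @r1 R _.
Proof.
rewrite -big_split /= -tk1 -eu_sum tk_suml; apply: eq_bigr => c _.
exact: qeoD.
Qed.

(** For fixed [i] both [k - i] and [i + k] run once through the integers modulo three, so every
    [qe c] and every [qo c] occurs exactly once. *)
Lemma ub_row i : \sum_k ub i k = @r1 R _.
Proof.
rewrite big_split /= -sum_qeo; congr (_ + _).
  by rewrite [RHS](reindex_inj (addIr (- i))).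
by rewrite [RHS](reindex_inj (addrI i)).
Qed.

Lemma ub_col k : \sum_i ub i k = @r1 R _.
Proof.
rewrite big_split /= -sum_qeo; congr (_ + _).
  have hinj : injective (fun i : 'I_3 => k - i) by move=> a b /addrI /oppr_inj.
  by rewrite [RHS](reindex_inj hinj).
by rewrite [RHS](reindex_inj (addIr k)).
Qed.

Lemma Jm_proj : rproj Jm.
Proof.
split=> //; apply: rk_ext => i j; rewrite /rmul !big_ord_recl big_ord0 /Jm; lra.
Qed.

Lemma Psi_proj : rproj Psi.
Proof.
split.
  by apply: rk_ext => i j; rewrite /rtr /Psi orbC [j == i]eq_sym.
apply: rk_ext => -[[|[|[|i]]] hi] [[|[|[|j]]] hj] //;
  rewrite /rmul !big_ord_recl big_ord0 /Psi /=; lra.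
Qed.

Lemma Jm_Psi : rmul Jm Psi = 0 /\ rmul Psi Jm = 0.
Proof.
split; apply: rk_ext => -[[|[|[|i]]] hi] [[|[|[|j]]] hj] //;
  rewrite /rmul !big_ord_recl big_ord0 /Psi /Jm /= rk0; lra.
Qed.

Lemma pp_proj : rproj pp.
Proof.
have [sJ iJ] := Jm_proj; have [sP iP] := Psi_proj; have [se ie] := qhalf_proj hf.
have [s1 _] := @rproj1 R G.
split; first by rewrite /rsa -[LHS]/(rtr (tk _ _) + rtr (tk _ _)) !tk_tr sJ s1 sP se.
rewrite /pp rmulDl !rmulDr !tkM Jm_Psi.1 Jm_Psi.2 !tk0l iJ iP ie rmul1l.
by rewrite addr0 add0r.
Qed.

Context (X : rk R ('I_3 * G)%type) (d : R).
Hypotheses (hp : rN (rcomm pp X) <= d) (hu : forall i k, rN (rcomm (ub i k) X) <= d).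

Let nc (Y : rk R ('I_3 * G)%type) (c : R) := rN (rcomm Y X) <= c * d.

Lemma amplify_d0 : 0 <= d.
Proof. exact: le_trans (rN_ge0 _) hp. Qed.

Let nc_w Y c c' : c <= c' -> nc Y c -> nc Y c'.
Proof. by move=> cc h; rewrite /nc (le_trans h) // ler_wpM2r // amplify_d0. Qed.

Let ncM Y Z c c' : rcontr Y -> rcontr Z -> nc Y c -> nc Z c' -> nc (rmul Y Z) (c + c').
Proof. by move=> kY kZ hY hZ; rewrite /nc (le_trans (rN_commM _ kY kZ)) // mulrDl lerD. Qed.

Let ncD Y Z c c' : nc Y c -> nc Z c' -> nc (Y + Z) (c + c').
Proof. by move=> hY hZ; rewrite /nc rcommD (le_trans (rND _ _)) // mulrDl lerD. Qed.

Let ncZ a Y c : nc Y c -> nc (a *: Y) (`|a| * c).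
Proof. by move=> hY; rewrite /nc rcommZ rNZ -mulrA ler_wpM2l. Qed.

Let nc_u i k : nc (ub i k) 1.
Proof. by rewrite /nc mul1r. Qed.

Let ub0 c : ub 0 c = tk (eu R c c) (@r1 R G).
Proof. by rewrite /ub subr0 add0r qeoD. Qed.

Let E1 (a b : 'I_3) := tk (eu R a b) (@r1 R G).

Let E1_contr a b : rcontr (E1 a b).
Proof. by apply: tk_eu_contr; exact: rinv1. Qed.

Let E1M a b c : rmul (E1 a b) (E1 b c) = E1 a c.
Proof. by rewrite tkM euMe rmul1l. Qed.

Let nc_Ecc c : nc (E1 c c) 1.
Proof. by rewrite /E1 -ub0. Qed.

Let nc_rc (c : 'I_3) : nc (tk (eu R c c) (r c)) 5.
Proof.
(* The positions [(0, c)] and [(1, c + 1)] have the same difference [c] but different sums [c] and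
   [c + 2]. The product of the two entries is therefore [qe c], and twice it minus the matrix unit
   is the symmetry. The cost is [2 (1 + 1) + 1 = 5]. *)
have -> : tk (eu R c c) (r c) = 2 *: rmul (ub 0 c) (ub 1 (c + 1)) + -1 *: ub 0 c.
  rewrite ubM subr0 addrK eqxx add0r scale1r.
  have -> : (c == 1 + (c + 1)) = false.
    by rewrite [1 + _]addrCA -subr_eq0 opprD addrA subrr add0r oppr_eq0.
  rewrite scale0r addr0 ub0 -tkZr -tkZr -tkDr; congr tk.
  by apply: rk_ext => i j; rewrite /qhalf !rkE; lra.
apply: nc_w (ncD (ncZ 2 (ncM _ _ (nc_u 0 c) (nc_u 1 (c + 1)))) (ncZ (-1) (nc_u 0 c))).
- by rewrite normrN normr1 ger0_norm //; lra.
- exact/rproj_contr/ub_proj.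
- exact/rproj_contr/ub_proj.
Qed.

Let pp_block a b : rmul (rmul (E1 a a) pp) (E1 b b) =
  tk (eu R a b) (3^-1 *: @r1 R G + Psi a b *: qhalf rf).
Proof.
rewrite /pp rmulDr rmulDl !tkM !rmul1l !rmul1r !eu_sandwich /Jm !tkZl.
by rewrite tkDr !tkZr.
Qed.

Let nc_block a b : nc (rmul (rmul (E1 a a) pp) (E1 b b)) 3.
Proof.
have kp : rcontr pp by exact/rproj_contr/pp_proj.
have -> : (3 : R) = 1 + 1 + 1 by ring.
apply: ncM (nc_Ecc b) => //; first exact: rcontrM.
by apply: ncM => //; rewrite /nc mul1r.
Qed.

Let nc_E0 (a b : 'I_3) : (a == 0) || (b == 0) -> nc (E1 a b) 9.
Proof.
move=> ab; have -> : E1 a b = 3 *: rmul (rmul (E1 a a) pp) (E1 b b).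
  rewrite pp_block /Psi ab scale0r addr0 -tkZr scalerA.
  by have -> : (3 * 3^-1 = 1 :> R); [lra | rewrite scale1r].
by apply: nc_w (ncZ 3 (nc_block a b)); rewrite ger0_norm //; lra.
Qed.

Let nc_E a b : nc (E1 a b) 18.
Proof.
have h1 : nc (E1 a 0) 9 by apply: nc_E0; rewrite orbT.
have h2 : nc (E1 0 b) 9 by exact: nc_E0.
rewrite -(E1M a 0 b); apply: nc_w (ncM (E1_contr _ _) (E1_contr _ _) h1 h2).
by lra.
Qed.

(** Matrix units carry a block found at one position to all three diagonal positions: two of them
    cost [18 + 18], and there are three summands. *)
Let nc_sandwich (Y : 'I_3 -> rk R ('I_3 * G)%type) (u v : 'I_3 -> 'I_3) c :
  (forall a, rcontr (Y a)) -> (forall a, nc (Y a) c) -> 0 <= c ->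
  nc (\sum_a rmul (rmul (E1 a (u a)) (Y a)) (E1 (v a) a)) (3 * (36 + c)).
Proof.
move=> kY hY c0; have d0 := amplify_d0.
have h a : nc (rmul (rmul (E1 a (u a)) (Y a)) (E1 (v a) a)) (36 + c).
  apply: (nc_w (c := 18 + c + 18)); first by lra.
  apply: ncM => //; first by apply: rcontrM.
  exact: ncM.
rewrite /nc -[X in _ <= X]mulrA.
apply: le_trans (rN_comm_sum _ (c := (36 + c) * d) _) _; first by move=> i; exact: h.
by rewrite -[index_enum _]enumT size_enum_ord mulr_natl.
Qed.

(** The common constant 200 is a round number above the actual ones: 18 here, [3 (36 + 5) = 123] for
    the [r c] and [3 (36 + 18) = 162] for [rf]. *)
Lemma amplify_eu (a b : 'I_3) : rN (rcomm (tk (eu R a b) (@r1 R G)) X) <= 200 * d.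
Proof. by apply: nc_w (nc_E a b); lra. Qed.

Let tk_scalar (s : rk R G) : tk (@r1 R 'I_3) s = \sum_a tk (eu R a a) s.
Proof. by rewrite -eu_sum tk_suml. Qed.

Lemma amplify_r (c : 'I_3) : rN (rcomm (tk (@r1 R 'I_3) (r c)) X) <= 200 * d.
Proof.
have -> : tk (@r1 R 'I_3) (r c) =
    \sum_a rmul (rmul (E1 a c) (tk (eu R c c) (r c))) (E1 c a).
  rewrite tk_scalar; apply: eq_bigr => a _.
  by rewrite !tkM !euMe rmul1l rmul1r.
apply: nc_w (nc_sandwich _ _ _ (fun _ => nc_rc c) _); first by lra.
  by move=> _; exact: tk_eu_contr.
by lra.
Qed.

Lemma amplify_f : rN (rcomm (tk (@r1 R 'I_3) rf) X) <= 200 * d.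
Proof.
pose o1 : 'I_3 := 1; pose o2 : 'I_3 := 1 + 1.
have hY : nc (tk (eu R o1 o2) rf) 18.
  (* The block [(1, 2)] of [pp] is [1/3 - (1 + rf) / 4], solved here for [rf]. The cost is
     [18 / 3 + 4 * 3 = 18]. *)
  have -> : tk (eu R o1 o2) rf =
      3^-1 *: E1 o1 o2 + (-4) *: rmul (rmul (E1 o1 o1) pp) (E1 o2 o2).
    rewrite pp_block /Psi /= /E1 -!tkZr -tkDr; congr tk.
    by apply: rk_ext => i j; rewrite /qhalf !rkE; lra.
  apply: nc_w (ncD (ncZ 3^-1 (nc_E o1 o2)) (ncZ (-4) (nc_block o1 o2))).
  by rewrite normrN !ger0_norm ?invr_ge0 //; lra.
have -> : tk (@r1 R 'I_3) rf =
    \sum_a rmul (rmul (E1 a o1) (tk (eu R o1 o2) rf)) (E1 o2 a).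
  rewrite tk_scalar; apply: eq_bigr => a _.
  by rewrite !tkM !euMe rmul1l rmul1r.
apply: nc_w (nc_sandwich _ _ _ (fun _ => hY) _); first by lra.
  by move=> _; exact: tk_eu_contr.
by lra.
Qed.

End Amplification.

(** * The plane over polynomials of bounded degree *)

(* Bit strings as polynomials of degree at most [k] over the field with two elements. *)
Section Bits.
Context (k : nat).

Definition bits := {ffun 'I_k.+1 -> bool}.
HB.instance Definition _ := Finite.on bits.
Implicit Types x y z : bits.

Definition bxor x y : bits := [ffun i => x i (+) y i].
Definition bzero : bits := [ffun _ => false].
(** Multiplication by [t], truncated: the top coefficient is lost. The degree of a nonzero
    polynomial goes up as long as [btop] is false. *)
Definition bshift x : bits := [ffun i : 'I_k.+1 => (0 < i)%N && x (inord i.-1)].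
Definition btop x : bool := x ord_max.
(* One more than the degree. *)
Definition bsize x : nat := \max_(i < k.+1 | x i) i.+1.

Lemma bxorC : commutative bxor.
Proof. by move=> x y; apply/ffunP => i; rewrite !ffunE addbC. Qed.

Lemma bxor0 x : bxor x bzero = x.
Proof. by apply/ffunP => i; rewrite !ffunE addbF. Qed.

Lemma bxorK x y : bxor (bxor x y) y = x.
Proof. by apply/ffunP => i; rewrite !ffunE addbK. Qed.

Lemma bxorxx x : bxor x x = bzero.
Proof. by apply/ffunP => i; rewrite !ffunE addbb. Qed.

Lemma bxorACA x y z w : bxor (bxor x y) (bxor z w) = bxor (bxor x z) (bxor y w).
Proof. by apply/ffunP => i; rewrite !ffunE addbACA. Qed.

Lemma bshiftD x y : bshift (bxor x y) = bxor (bshift x) (bshift y).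
Proof. by apply/ffunP => i; rewrite !ffunE; case: (0 < i)%N. Qed.

Lemma bsize_gt x i : x i -> (i < bsize x)%N.
Proof. by move=> xi; exact: (@leq_bigmax_cond _ (fun i => x i) (fun i : 'I_k.+1 => i.+1) i xi). Qed.

Lemma bsize_le x m : (forall i : 'I_k.+1, x i -> (i < m)%N) -> (bsize x <= m)%N.
Proof. by move=> h; apply/bigmax_leqP. Qed.

Lemma bsize_witness x : (0 < bsize x)%N -> exists2 i : 'I_k.+1, x i & i.+1 = bsize x.
Proof.
move=> h; have [i xi|e] := pickP (fun i => x i); last first.
  by move: h; rewrite /bsize big_pred0.
have c0 : (0 < #|[pred i | x i]|)%N by apply/card_gt0P; exists i.
have [j xj ej] := eq_bigmax_cond (fun i : 'I_k.+1 => i.+1) c0; exists j; first exact: xj.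
by rewrite -ej; exact: eq_bigl.
Qed.

Lemma bsize0 x : bsize x = 0%N -> x = bzero.
Proof.
move=> h; apply/ffunP => i; rewrite ffunE; apply/negbTE/negP => /bsize_gt.
by rewrite h.
Qed.

Lemma bsizeD_lt x y : (bsize y < bsize x)%N -> bsize (bxor x y) = bsize x.
Proof.
move=> yx; apply/eqP; rewrite eqn_leq; apply/andP; split.
  apply: bsize_le => i; rewrite ffunE; have [/bsize_gt //|_ /=] := boolP (x i).
  by move=> /bsize_gt h; exact: ltn_trans h yx.
have [i xi ei] := bsize_witness (leq_ltn_trans (leq0n _) yx).
rewrite -ei; apply: bsize_gt; rewrite ffunE xi /=; apply/negP => /bsize_gt.
by rewrite ltnNge -ltnS ei yx.
Qed.

(** Over two elements, leading coefficients in the same degree are equal, so they cancel. *)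
Lemma bsizeD_eq x y : (0 < bsize x)%N -> bsize x = bsize y ->
  (bsize (bxor x y) < bsize x)%N.
Proof.
move=> x0 xy; have [i xi ei] := bsize_witness x0.
have y0 : (0 < bsize y)%N by rewrite -xy.
have [j yj ej] := bsize_witness y0.
have ij : i = j by apply/val_inj/succn_inj; rewrite ei ej.
rewrite -ei ltnS; apply: bsize_le => l; rewrite ffunE => h.
have li : (l <= i)%N.
  rewrite -ltnS ei; have [/bsize_gt //|/negbTE xl] := boolP (x l).
  by move: h; rewrite xl /= xy => /bsize_gt.
rewrite ltn_neqAle li andbT; apply/eqP => /val_inj e.
by move: h; rewrite e xi ij yj.
Qed.

Lemma bsize_shift x : btop x = false -> (0 < bsize x)%N ->
  (bsize x < bsize (bshift x))%N.
Proof.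
move=> xt x0; have [i xi ei] := bsize_witness x0.
have ik : (i.+1 < k.+1)%N.
  rewrite ltnS ltn_neqAle -ltnS ltn_ord andbT; apply/eqP => e.
  by move: xt; rewrite /btop (_ : ord_max = i) ?xi //; apply: val_inj.
rewrite -ei -[i.+1]/(nat_of_ord (Ordinal ik)); apply: bsize_gt; rewrite ffunE /=.
by rewrite (_ : inord i = i) ?xi //; apply: val_inj; rewrite /= inordK.
Qed.

Definition bchar (R : realType) x y : R := \prod_i (-1) ^+ (x i && y i).

Lemma bcharC (R : realType) x y : bchar R x y = bchar R y x.
Proof. by apply: eq_bigr => i _; rewrite andbC. Qed.

Lemma bcharD (R : realType) x y z : bchar R (bxor x y) z = bchar R x z * bchar R y z.
Proof.
rewrite /bchar -big_split; apply: eq_bigr => i _ /=.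
by rewrite ffunE andb_addl signr_addb.
Qed.

Lemma bcharDr (R : realType) x y z : bchar R x (bxor y z) = bchar R x y * bchar R x z.
Proof. by rewrite bcharC bcharD ![bchar R _ x]bcharC. Qed.

Lemma bchar_sq (R : realType) x y : bchar R x y ^+ 2 = 1.
Proof.
rewrite /bchar -prodrXl big1 // => i _.
exact: sqrr_sign.
Qed.

Lemma bchar0 (R : realType) y : bchar R bzero y = 1.
Proof. by rewrite /bchar big1 // => i _; rewrite ffunE. Qed.

Lemma bchar_sum (R : realType) x : x != bzero -> \sum_y bchar R x y = 0.
Proof.
move=> x0; have [i xi] : exists i, x i.
  apply/existsP; apply: contraNT x0; rewrite negb_exists => /forallP h.
  by apply/eqP/ffunP => i; rewrite ffunE; exact/negbTE/h.
pose d : bits := [ffun j => j == i].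
have dinj : injective (bxor^~ d) by move=> a b /(congr1 (bxor^~ d)); rewrite !bxorK.
have xd : bchar R x d = -1.
  rewrite /bchar (bigD1 i) //= big1 ?mulr1 ?ffunE ?eqxx ?xi //.
  by move=> j /negbTE ji; rewrite ffunE ji andbF.
have : \sum_y bchar R x y = - \sum_y bchar R x y.
  rewrite {1}(reindex_inj dinj) -sumrN; apply: eq_bigr => y _.
  by rewrite bcharDr xd mulrN1.
by move/eqP; rewrite -addr_eq0 -mulr2n mulrn_eq0 => /eqP.
Qed.

End Bits.

(** * Shears, signs and the Fourier transform of the plane *)

Section Kernels.
Context (R : realType) (k : nat).

Definition plane : Type := (bits k * bits k)%type.
HB.instance Definition _ := Finite.on plane.
Implicit Types g h : plane.

Definition pxor g h : plane := (bxor g.1 h.1, bxor g.2 h.2).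
Definition pzero : plane := (bzero k, bzero k).
(** In characteristic two the shears are involutions, so their permutation matrices are real
    symmetries. The transposed shear [shear1'] is not one of the generators; conjugation of [shear1]
    by the Fourier transform provides it. *)
Definition shear1 g : plane := (g.1, bxor g.2 g.1).
Definition shear_t g : plane := (g.1, bxor g.2 (bshift g.1)).
Definition shear1' g : plane := (bxor g.1 g.2, g.2).

Lemma pxorK g h : pxor (pxor g h) h = g.
Proof. by case: g h => [a b] [c d]; rewrite /pxor /= !bxorK. Qed.

Lemma pxorxx g : pxor g g = pzero.
Proof. by rewrite /pxor !bxorxx. Qed.

Lemma pxor_eq0 g h : pxor g h = pzero -> g = h.
Proof.
move=> e; rewrite -[g](pxorK _ h) e /pxor /pzero /=.
by rewrite ![bxor (bzero k) _]bxorC !bxor0; case: h e.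
Qed.

Lemma shear1K : involutive shear1.
Proof. by case=> a b; rewrite /shear1 /= bxorK. Qed.

Lemma shear_tK : involutive shear_t.
Proof. by case=> a b; rewrite /shear_t /= bxorK. Qed.

Lemma shear1'K : involutive shear1'.
Proof. by case=> a b; rewrite /shear1' /= bxorK. Qed.

Lemma shear1D g h : pxor (shear1 g) (shear1 h) = shear1 (pxor g h).
Proof. by rewrite /pxor /shear1 /= bxorACA. Qed.

Lemma shear_tD g h : pxor (shear_t g) (shear_t h) = shear_t (pxor g h).
Proof. by rewrite /pxor /shear_t /= bxorACA bshiftD. Qed.

Lemma shear1'D g h : pxor (shear1' g) (shear1' h) = shear1' (pxor g h).
Proof. by rewrite /pxor /shear1' /= bxorACA. Qed.

Definition permk (f : plane -> plane) : rk R plane := fun g h => (g == f h)%:R.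

Lemma permk_mull f X g h : involutive f -> rmul (permk f) X g h = X (f g) h.
Proof.
move=> fK; rewrite /rmul (bigD1 (f g)) //= big1 ?addr0 /permk ?fK ?eqxx ?mul1r //.
move=> l lg; case: eqP => [e|_]; last by rewrite mul0r.
by move: lg; rewrite e fK eqxx.
Qed.

Lemma permk_inv f : involutive f -> rinv (permk f).
Proof.
move=> fK; split; apply: rk_ext => g h.
  by rewrite /rtr /permk -[h == _](inj_eq (inv_inj fK)) fK eq_sym.
by rewrite permk_mull // /permk /r1 (inj_eq (inv_inj fK)).
Qed.

Definition sgnb (b : bool) : R := if b then -1 else 1.

Definition diagk : rk R plane := fun g h => (g == h)%:R * sgnb (btop g.1).

Lemma diagk_mull X g h : rmul diagk X g h = sgnb (btop g.1) * X g h.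
Proof.
rewrite /rmul (bigD1 g) //= big1 ?addr0 /diagk ?eqxx ?mul1r //.
by move=> l /negbTE lg; rewrite eq_sym lg !mul0r.
Qed.

Lemma diagk_inv : rinv diagk.
Proof.
split; apply: rk_ext => g h.
  by rewrite /rtr /diagk eq_sym; case: eqP => [->|]; rewrite ?mul0r.
rewrite diagk_mull /diagk /r1 mulrCA -expr2 /sgnb.
by case: ifP; rewrite ?sqrrN expr1n mulr1.
Qed.

Definition pchar g h : R := bchar R g.1 h.1 * bchar R g.2 h.2.

(* The unitary Fourier transform of the group [plane]: its entries all have the same modulus. *)
Definition fourk : rk R plane := fun g h => Num.sqrt (#|{: plane}|%:R^-1) * pchar g h.

Lemma card_plane_gt0 : 0 < #|{: plane}|%:R :> R.
Proof. by rewrite ltr0n; apply/card_gt0P; exists pzero. Qed.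

Lemma pchar_sum g : \sum_h pchar g h = if g == pzero then #|{: plane}|%:R else 0.
Proof.
have -> : \sum_h pchar g h = (\sum_a bchar R g.1 a) * (\sum_b bchar R g.2 b).
  rewrite big_distrlr /=.
  by rewrite (pair_bigA _ (fun a b => bchar R g.1 a * bchar R g.2 b)).
case: ifP => [/eqP ->|g0].
  have e0 : \sum_a bchar R (bzero k) a = #|{: bits k}|%:R.
    by rewrite -sum1_card natr_sum; apply: eq_bigr => a _; rewrite bchar0.
  by rewrite /= !e0 -natrM card_prod.
case: g g0 => a b /=; rewrite -pair_eqE /= => /negbT; rewrite negb_and => /orP [h|h].
  by rewrite bchar_sum ?mul0r.
by rewrite [X in _ * X]bchar_sum ?mulr0.
Qed.

Lemma fourk_sq g h : fourk g h ^+ 2 = #|{: plane}|%:R^-1.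
Proof.
rewrite exprMn sqr_sqrtr ?invr_ge0 ?(ltW card_plane_gt0) //.
by rewrite /pchar exprMn !bchar_sq !mulr1.
Qed.

Lemma fourk_inv : rinv fourk.
Proof.
split; apply: rk_ext => g h.
  by rewrite /rtr /fourk /pchar bcharC [bchar R h.2 _]bcharC.
have -> : rmul fourk fourk g h = #|{: plane}|%:R^-1 * \sum_l pchar (pxor g h) l.
  rewrite /rmul mulr_sumr; apply: eq_bigr => l _.
  rewrite /fourk mulrACA -expr2 sqr_sqrtr ?invr_ge0 ?(ltW card_plane_gt0) //.
  by rewrite /pchar [bchar R l.1 _]bcharC [bchar R l.2 _]bcharC mulrACA !bcharD.
rewrite pchar_sum /r1; case: eqP => [/pxor_eq0 ->|ne].
  by rewrite eqxx mulVf // gt_eqF // card_plane_gt0.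
case: eqP => [e|_]; last by rewrite mulr0.
by case: ne; rewrite e pxorxx.
Qed.

Lemma permk_mulr f X g h : rmul X (permk f) g h = X g (f h).
Proof.
rewrite /rmul (bigD1 (f h)) //= big1 ?addr0 /permk ?eqxx ?mulr1 //.
by move=> l /negbTE ->; rewrite mulr0.
Qed.

(** For the pairing [pchar] the two shears are adjoint to each other: moving [shear1] in one
    argument is moving [shear1'] in the other. *)
Lemma fourk_shear : rmul (rmul fourk (permk shear1)) fourk = permk shear1'.
Proof.
have e : rmul fourk (permk shear1) = rmul (permk shear1') fourk.
  apply: rk_ext => g h; rewrite permk_mulr permk_mull; last exact: shear1'K.
  rewrite /fourk; congr (_ * _); rewrite /pchar /shear1 /shear1' /=.
  by rewrite bcharDr bcharD; ring.
by rewrite e -rmulA fourk_inv.2 rmul1r.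
Qed.

End Kernels.

Lemma sum_pair (V : nmodType) (I J : finType) (F : I * J -> V) :
  \sum_p F p = \sum_i \sum_j F (i, j).
Proof. by rewrite pair_bigA; apply: eq_bigr => -[]. Qed.

(** * Ping-pong: no normalised traceless matrix almost commutes with all generators *)

Section PingPong.
Context (R : realType) (k : nat).
Notation plane := (plane k).
Notation T := ('I_3 * plane)%type.
Context (X : rk R T) (eta : R).
Hypotheses (X1 : rN X = 1) (X0 : rtrace X = 0) (heta : eta <= 1000^-1).

Let lift1 (r : rk R plane) : rk R T := tk (@r1 R 'I_3) r.

Hypotheses (h_shear1 : rN (rcomm (lift1 (@permk R k (@shear1 k))) X) <= eta)
  (h_shear_t : rN (rcomm (lift1 (@permk R k (@shear_t k))) X) <= eta)
  (h_diag : rN (rcomm (lift1 (@diagk R k)) X) <= eta)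
  (h_four : rN (rcomm (lift1 (@fourk R k)) X) <= eta)
  (h_eu : forall a b : 'I_3, rN (rcomm (tk (eu R a b) (@r1 R plane)) X) <= eta).

Lemma eta_ge0 : 0 <= eta.
Proof. exact: le_trans (rN_ge0 _) h_four. Qed.

(** A finitely additive measure on the differences of the two indices of an entry, of total mass one
    because [rN X = 1]. It plays the part of an almost invariant mean, and the aim is to concentrate
    it at zero. *)
Definition mass (S : plane -> bool) : R :=
  \sum_i \sum_j (S (pxor i.2 j.2))%:R * X i j ^+ 2.

Lemma mass_le (S S' : plane -> bool) : (forall a, S a -> S' a) -> mass S <= mass S'.
Proof.
move=> h; apply: ler_sum => i _; apply: ler_sum => j _; rewrite ler_wpM2r ?sqr_ge0 //.
by rewrite ler_nat; case e: (S _) => //; rewrite h.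
Qed.

Lemma massU (S S' : plane -> bool) :
  (forall a, S a -> S' a -> False) -> mass (fun a => S a || S' a) = mass S + mass S'.
Proof.
move=> h; rewrite -big_split; apply: eq_bigr => i _; rewrite -big_split.
apply: eq_bigr => j _ /=; rewrite -mulrDl -natrD; congr (_%:R * _).
by case e: (S _) => //=; case e': (S' _) => //; case: (h _ e e').
Qed.

Lemma lift1_inv r : rinv r -> rinv (lift1 r).
Proof.
move=> [sr ir]; split; rewrite /lift1 /rsa ?tk_tr ?sr ?(@rproj1 R 'I_3).1 //.
by rewrite tkM ir rmul1l tk1.
Qed.

Lemma lift1_mull r (Y : rk R T) i j :
  rmul (lift1 r) Y i j = \sum_h r i.2 h * Y (i.1, h) j.
Proof.
rewrite /rmul [LHS]sum_pair (bigD1 i.1) //= [X in _ + X]big1 ?addr0.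
  by apply: eq_bigr => h _; rewrite /lift1 /tk /r1 eqxx mul1r.
move=> c /negbTE ci; rewrite big1 // => h _.
by rewrite /lift1 /tk /r1 eq_sym ci !mul0r.
Qed.

Lemma lift1_mulr r (Y : rk R T) i j :
  rmul Y (lift1 r) i j = \sum_h Y i (j.1, h) * r h j.2.
Proof.
rewrite /rmul [LHS]sum_pair (bigD1 j.1) //= [X in _ + X]big1 ?addr0.
  by apply: eq_bigr => h _; rewrite /lift1 /tk /r1 eqxx mul1r.
move=> c /negbTE ci; rewrite big1 // => h _.
by rewrite /lift1 /tk /r1 ci mul0r mulr0.
Qed.

Lemma lift1_permk_mull f (Y : rk R T) i j : involutive f ->
  rmul (lift1 (@permk R k f)) Y i j = Y (i.1, f i.2) j.
Proof.
move=> fK; rewrite lift1_mull.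
exact: (@permk_mull R k f (fun g _ => Y (i.1, g) j) i.2 j.2 fK).
Qed.

Lemma lift1_permk_mulr f (Y : rk R T) i j :
  rmul Y (lift1 (@permk R k f)) i j = Y i (j.1, f j.2).
Proof. by rewrite lift1_mulr; exact: (@permk_mulr R k f (fun _ h => Y i (j.1, h)) i.2 j.2). Qed.

(** Conjugating [X] by the permutation matrix moves each difference by the additive map [f]. The two
    masses then differ by at most the sum of [|X^2 - Y^2|] over the entries, which Cauchy-Schwarz
    bounds by [rN (X - Y) * rN (X + Y) <= 2 c]. *)
Lemma mass_perm f (S : plane -> bool) c : involutive f ->
  (forall g h, pxor (f g) (f h) = f (pxor g h)) ->
  rN (rcomm (lift1 (@permk R k f)) X) <= c ->
  mass (fun a => S (f a)) <= mass S + 2 * c.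
Proof.
move=> fK fD hc; pose P := lift1 (@permk R k f); pose Y := rmul (rmul P X) P.
have hP : rinv P by apply: lift1_inv; exact: permk_inv.
have YE i j : Y i j = X (i.1, f i.2) (j.1, f j.2).
  by rewrite /Y lift1_permk_mulr lift1_permk_mull.
have NY : rN Y = 1 by rewrite rinv_Nr // rinv_N.
have YX : rN (X - Y) <= c by rewrite -rNN opprB rinv_comm.
pose F (i : T) : T := (i.1, f i.2).
have FK : involutive F by case=> a g; rewrite /F /= fK.
have -> : mass S = \sum_i \sum_j (S (f (pxor i.2 j.2)))%:R * Y i j ^+ 2.
  rewrite /mass (reindex_inj (inv_inj FK)); apply: eq_bigr => i _.
  rewrite (reindex_inj (inv_inj FK)); apply: eq_bigr => j _.
  by rewrite YE /F /= fD.
rewrite -lerBlDl /mass -sumrB.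
apply: (@le_trans _ _ (\sum_i \sum_j `|(X - Y) i j| * `|(X + Y) i j|)).
  apply: ler_sum => i _; rewrite -sumrB; apply: ler_sum => j _.
  rewrite -mulrBr subr_sqr -normrM.
  case: (S _); first by rewrite mul1r ler_norm.
  by rewrite mul0r.
rewrite pair_bigA /= (le_trans (ler_norm _)) //.
apply: le_trans (l2_dot (fun p : T * T => `|(X - Y) p.1 p.2|)
  (fun p => `|(X + Y) p.1 p.2|)) _.
have absN (Z : rk R T) : l2 (fun p : T * T => `|Z p.1 p.2|) = rN Z.
  by rewrite /rN /l2; congr Num.sqrt; apply: eq_bigr => p _; rewrite real_normK ?num_real.
rewrite !absN mulrC; apply: ler_pM; rewrite ?rN_ge0 //.
by rewrite (le_trans (rND _ _)) // X1 NY; lra.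
Qed.

(* Ping-pong on the differences [a = g - h] of the indices of an entry, compared by the degrees
   of their two coordinates: the shears move mass between these three regions, and the sign
   character of the top coefficient controls the overflow of the shift. *)
Let below (a : plane) := (bsize a.1 < bsize a.2)%N.
Let above (a : plane) := (bsize a.2 < bsize a.1)%N.
Let level (a : plane) := (bsize a.1 == bsize a.2) && (0 < bsize a.1)%N.
Let toppled (a : plane) := btop a.1.

(** The commutator with a diagonal sign matrix doubles, up to sign, the entries between indices of
    opposite sign and kills the others. These are the entries whose difference has its top
    coefficient set. *)
Lemma mass_top : mass toppled <= eta.
Proof.
have e0 := eta_ge0.
have h : 4 * mass toppled = rN (rcomm (lift1 (@diagk R k)) X) ^+ 2.
  have dl (Y : rk R T) i j : rmul (lift1 (@diagk R k)) Y i j = sgnb R (btop i.2.1) * Y i j.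
    case: i => a g; rewrite lift1_mull.
    exact: (@diagk_mull R k (fun g' _ => Y (a, g') j) g j.2).
  have dr i j : rmul X (lift1 (@diagk R k)) i j = sgnb R (btop j.2.1) * X i j.
    have := dl (rtr X) j i; rewrite -[rmul _ _]rtrK rtrM rtrK.
    by have [-> _] := lift1_inv (@diagk_inv R k).
  rewrite rN_sq /rdot /mass mulr_sumr; apply: eq_bigr => i _.
  rewrite mulr_sumr; apply: eq_bigr => j _.
  rewrite /rcomm rkD rkN dl dr -mulrBl -expr2 exprMn mulrA; congr (_ * _).
  rewrite /toppled /pxor /btop /bxor /= ffunE /sgnb.
  by case: (i.2.1 _); case: (j.2.1 _) => /=; ring.
have : rN (rcomm (lift1 (@diagk R k)) X) ^+ 2 <= eta ^+ 2.
  by rewrite ler_pXn2r ?nnegrE ?rN_ge0.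
rewrite -h; have : eta ^+ 2 <= eta * 1000^-1 by rewrite expr2 ler_wpM2l.
move: (mass _) => m; lra.
Qed.

(** Write [b], [a], [l] for the masses of [below], [above], [level]. The shears give
    [b <= l + 6 eta], [l <= a + 2 eta] and [a + l <= b + 3 eta]. Hence [a <= 9 eta], [l <= 11 eta],
    [b <= 17 eta], and the total is [37 eta]. *)
Lemma offdiag_mass : mass (fun a => a != pzero k) <= 37 * eta.
Proof.
have e0 := eta_ge0.
have h1' : rN (rcomm (lift1 (@permk R k (@shear1' k))) X) <= 3 * eta.
  have kf : rcontr (lift1 (@fourk R k)) by apply/rinv_contr/lift1_inv/fourk_inv.
  have ks : rcontr (lift1 (@permk R k (@shear1 k))).
    by apply/rinv_contr/lift1_inv/permk_inv; exact: shear1K.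
  have -> : lift1 (@permk R k (@shear1' k)) =
      rmul (rmul (lift1 (@fourk R k)) (lift1 (@permk R k (@shear1 k)))) (lift1 (@fourk R k)).
    by rewrite /lift1 !tkM !rmul1l fourk_shear.
  have -> : 3 * eta = eta + eta + eta by ring.
  apply: le_trans (rN_commM _ (rcontrM kf ks) kf) (lerD _ h_four).
  exact: le_trans (rN_commM _ kf ks) (lerD h_four h_shear1).
have below_level : mass below <= mass level + 6 * eta.
  apply: le_trans (mass_le _) (le_trans (mass_perm level _ _ h1') _).
  - move=> [x y]; rewrite /below /level /shear1' /= => xy.
    by rewrite bxorC bsizeD_lt // eqxx /=; exact: leq_ltn_trans xy.
  - exact: shear1'K.
  - exact: shear1'D.
  - by lra.
have level_above : mass level <= mass above + 2 * eta.
  apply: le_trans (mass_le _) (mass_perm above (@shear1K k) (@shear1D k) h_shear1).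
  move=> [x y]; rewrite /above /level /shear1 /= => /andP [/eqP e x0].
  by rewrite bxorC; apply: bsizeD_eq.
have above_level : mass above <= mass level + 2 * eta.
  apply: le_trans (mass_le _) (mass_perm level (@shear1K k) (@shear1D k) h_shear1).
  move=> [x y]; rewrite /above /level /shear1 /= => yx.
  by rewrite bxorC bsizeD_lt // eqxx /=; exact: leq_ltn_trans yx.
(* The shift raises the degree unless it loses the top coefficient; differences with that
   coefficient set are put aside and paid for by [mass toppled]. *)
have to_below : mass above + mass level <= mass below + 2 * eta + mass toppled.
  rewrite -massU; last first.
    by move=> a; rewrite /above /level => h /andP [/eqP e _]; move: h; rewrite e ltnn.
  apply: (@le_trans _ _ (mass (fun a => (((above a || level a) && ~~ toppled a) || toppled a)))).
    by apply: mass_le => a; case: (toppled a); rewrite ?orbT // andbT orbF.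
  rewrite massU; last by move=> a /andP [_ /negP].
  rewrite lerD2r.
  apply: le_trans (mass_le _) (mass_perm below (@shear_tK k) (@shear_tD k) h_shear_t).
  move=> [x y]; rewrite /above /level /toppled /below /shear_t /= => /andP [h /negbTE xt].
  have x0 : (0 < bsize x)%N.
    by move: h => /orP [|/andP [] //]; exact: leq_ltn_trans.
  have yx : (bsize y <= bsize x)%N by move: h => /orP [/ltnW //|/andP [/eqP -> _]].
  have sx := bsize_shift xt x0.
  by rewrite bxorC bsizeD_lt ?sx // (leq_ltn_trans yx).
have top := mass_top.
have tot : mass (fun a => a != pzero k) <= mass below + mass above + mass level.
  rewrite -!massU.
  - apply: mass_le => -[x y] ne; rewrite /below /above /level /=.
    case: ltngtP => //= xy; rewrite lt0n; apply: contraNneq ne => x0.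
    by rewrite (bsize0 x0) (bsize0 (etrans (esym xy) x0)).
  - move=> a; rewrite /below /above /level => /orP [] h /andP [/eqP e _].
      by move: h; rewrite e ltnn.
    by move: h; rewrite e ltnn.
  - by move=> a; rewrite /below /above => h1 h2; have := ltn_trans h1 h2; rewrite ltnn.
move: tot top to_below above_level level_above below_level.
move: (mass below) (mass above) (mass level) (mass toppled) (mass _) => b a l t m.
lra.
Qed.

Let n : R := #|{: plane}|%:R.

Let diagX : rk R T := fun i j => (i.2 == j.2)%:R * X i j.
(** The 3 x 3 partial trace of [X] over the plane. *)
Let blocktr (a b : 'I_3) : R := \sum_g X (a, g) (b, g).

Lemma blocktrE a b : blocktr a b = rtrace (rmul X (tk (eu R b a) (@r1 R plane))).
Proof.
rewrite /rtrace /rmul /blocktr.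
rewrite [RHS]sum_pair (bigD1 a) //= [X in _ = _ + X]big1 ?addr0.
  apply: eq_bigr => g _; rewrite (bigD1 (b, g)) //= big1 ?addr0.
    by rewrite /tk /eu /r1 /= !eqxx !mulr1.
  move=> [c h]; rewrite -pair_eqE negb_and /= => hc; rewrite /tk /eu /r1 /=.
  by move: hc => /orP [] /negbTE ->; rewrite ?mul0r ?mulr0 ?mulr0.
move=> c /negbTE ca; rewrite big1 // => g _; rewrite big1 // => l _.
by rewrite /tk /eu /= ca andbF mul0r mulr0.
Qed.

Lemma rN_eu (a b : 'I_3) : rN (tk (eu R a b) (@r1 R plane)) = Num.sqrt n.
Proof.
rewrite /rN /l2; congr Num.sqrt.
transitivity (rtrace (rmul (tk (eu R a b) (@r1 R plane)) (tk (eu R b a) (@r1 R plane)))).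
  rewrite rtraceE tk_tr eu_tr (@rproj1 R plane).1 /rdot pair_bigA /=.
  by apply: eq_bigr => p _; rewrite expr2.
rewrite tkM euMe rmul1l /rtrace.
rewrite sum_pair (bigD1 a) //= [X in _ + X]big1 ?addr0.
  rewrite /n -sum1_card natr_sum; apply: eq_bigr => g _.
  by rewrite /tk /eu /r1 /= !eqxx mul1r.
by move=> c /negbTE ca; rewrite big1 // => g _; rewrite /tk /eu /= ca mul0r.
Qed.

(** The partial trace almost commutes with the 3 x 3 matrix units, so it is almost scalar; the
    scalar is the mean of its diagonal, which vanishes as [X] is traceless. The factor [Num.sqrt n]
    is the norm of a matrix unit tensored with the identity. *)
Lemma blocktr_le a b : `|blocktr a b| <= eta * Num.sqrt n.
Proof.
have hk c : `|blocktr a b - (a == b)%:R * blocktr c c| <= eta * Num.sqrt n.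
  pose E (x y : 'I_3) := tk (eu R x y) (@r1 R plane).
  have -> : blocktr a b - (a == b)%:R * blocktr c c = rdot (- rcomm (E b c) X) (rtr (E c a)).
    have EM x y u v : rmul (E x y) (E u v) = (y == u)%:R *: E x v.
      by rewrite tkM euM rmul1l tkZl.
    rewrite -rtraceE opprB rmulDl rtraceD rmulNl rtraceN; congr (_ - _).
      by rewrite blocktrE -(rmulA X (E b c)) EM eqxx scale1r.
    by rewrite blocktrE -(rmulA (E b c) X) [in RHS]rtrace_mulC -(rmulA X (E c a)) EM rmulZr rtraceZ.
  rewrite (le_trans (rdot_le _ _)) // rNN rN_tr rN_eu ler_wpM2r ?sqrtr_ge0 //.
  exact: h_eu.
have tr0 : \sum_c blocktr c c = 0.
  by apply: etrans X0; rewrite /rtrace [RHS]sum_pair.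
have : `|\sum_(c : 'I_3) (blocktr a b - (a == b)%:R * blocktr c c)| <= 3 * (eta * Num.sqrt n).
  rewrite (le_trans (ler_norm_sum _ _ _)) //.
  apply: (@le_trans _ _ (\sum_(c : 'I_3) eta * Num.sqrt n)).
    by apply: ler_sum => c _; exact: hk.
  by rewrite sumr_const card_ord -[leLHS]mulr_natl.
rewrite sumrB -mulr_sumr tr0 mulr0 subr0 sumr_const card_ord -[_ *+ 3]mulr_natl normrM.
by rewrite ger0_norm // ler_pM2l.
Qed.

(** Let [F] be the Fourier transform, so [1 = <X, X>] is close to [<X, F X F>]. Split [X] into the
    part with equal plane indices and the rest. The rest has norm at most [1/5], since
    [37/1000 < 1/25], and enters two terms; the remaining term is at most [9 eta^2] by [blocktr_le].
    Together they cannot reach [1 - eta]. *)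
Lemma no_almost_commutant : False.
Proof.
have e0 := eta_ge0; have n0 : 0 < n by exact: card_plane_gt0.
pose F := lift1 (@fourk R k); have hF : rinv F by apply/lift1_inv/fourk_inv.
pose cj (Y : rk R T) := rmul (rmul F Y) F.
have NcjX : rN (cj X - X) <= eta by rewrite rinv_comm.
pose offX := X - diagX.
have Noff : rN offX ^+ 2 <= 37 * eta.
  apply: le_trans offdiag_mass; rewrite rN_sq /rdot /mass le_eqVlt; apply/orP; left.
  apply/eqP/eq_bigr => i _; apply: eq_bigr => j _; rewrite /offX /diagX !rkE.
  have -> : (pxor i.2 j.2 != pzero k) = (i.2 != j.2).
    by congr negb; apply/eqP/eqP => [/pxor_eq0|->] //; rewrite pxorxx.
  by case: eqP => _ /=; rewrite ?mul1r ?mul0r ?subrr ?subr0 ?mulr0 // -expr2.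
have Noff' : rN offX <= 5^-1.
  rewrite -(ler_pXn2r (n := 2)) ?nnegrE ?rN_ge0 ?invr_ge0 //.
  by rewrite (le_trans Noff) //; move: heta; lra.
have Ndiag : rN diagX <= 1.
  apply: le_trans (_ : rN diagX <= rN X) (_ : rN X <= 1); last by rewrite X1.
  rewrite -(ler_pXn2r (n := 2)) ?nnegrE ?rN_ge0 // !rN_sq.
  apply: ler_sum => i _; apply: ler_sum => j _; rewrite /diagX -!expr2.
  by case: eqP => _ /=; rewrite ?mul1r // mul0r expr0n sqr_ge0.
have cjN Y : rN (cj Y) = rN Y by rewrite /cj rinv_Nr // rinv_N.
have cjE : cj X = cj diagX + cj offX.
  by rewrite /cj -rmulDl -rmulDr /offX addrC subrK.
have diag_le : rdot diagX (cj diagX) <= 1000^-1.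
  (* All entries of the Fourier matrix have square [1/n], so conjugation replaces each diagonal
     entry of a block by the mean of that diagonal: only the partial trace survives. *)
  have -> : rdot diagX (cj diagX) = n^-1 * \sum_a \sum_b blocktr a b ^+ 2.
    have cjdE i j : cj diagX i j =
        \sum_h fourk R i.2 h * X (i.1, h) (j.1, h) * fourk R h j.2.
      rewrite /cj lift1_mulr; apply: eq_bigr => h _.
      rewrite lift1_mull (bigD1 h) //= big1 ?addr0 /diagX ?eqxx ?mul1r //.
      by move=> l /negbTE /= ->; rewrite mul0r mulr0.
    rewrite /rdot mulr_sumr sum_pair; apply: eq_bigr => a _ /=.
    rewrite mulr_sumr -[RHS]/(\sum_b _).
    under eq_bigr do rewrite sum_pair.
    rewrite exchange_big; apply: eq_bigr => b _ /=.
    rewrite expr2 {1}/blocktr mulrCA mulr_suml; apply: eq_bigr => g _ /=.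
    rewrite (bigD1 g) //= [X in _ + X]big1 ?addr0.
      rewrite /diagX eqxx mul1r; congr (_ * _).
      rewrite cjdE /blocktr mulr_sumr; apply: eq_bigr => h _ /=.
      have := congr1 (fun Y : rk R plane => Y h g) (@fourk_inv R k).1.
      by rewrite /rtr => <-; rewrite mulrAC -expr2 fourk_sq.
    by move=> h /negbTE hg; rewrite /diagX /= eq_sym hg !mul0r.
  have b2 a b : blocktr a b ^+ 2 <= eta ^+ 2 * n.
    rewrite -[X in _ * X](sqr_sqrtr (ltW n0)) -exprMn -real_normK ?num_real //.
    by rewrite ler_pXn2r ?nnegrE ?mulr_ge0 ?sqrtr_ge0 ?normr_ge0 // blocktr_le.
  have : \sum_a \sum_b blocktr a b ^+ 2 <= 9 * (eta ^+ 2 * n).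
    apply: le_trans (ler_sum _ (fun a _ => ler_sum _ (fun b _ => b2 a b))) _.
    by rewrite !sumr_const !card_ord -mulrnA -[leLHS]mulr_natl.
  move=> h; rewrite mulrC ler_pdivrMr // (le_trans h) // mulrA ler_wpM2r ?(ltW n0) //.
  have : eta ^+ 2 <= 1000^-1 * 1000^-1 by rewrite expr2 ler_pM.
  lra.
have h1 : 1 = rdot X X by rewrite -rN_sq X1 expr1n.
have h2 : `|rdot X (cj X - X)| <= eta.
  by rewrite (le_trans (rdot_le _ _)) // X1 mul1r.
have h3 : `|rdot X (cj offX)| <= 5^-1.
  by rewrite (le_trans (rdot_le _ _)) // X1 mul1r cjN.
have h4 : `|rdot offX (cj diagX)| <= 5^-1.
  rewrite (le_trans (rdot_le _ _)) // cjN -[leRHS]mulr1.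
  by rewrite ler_pM ?rN_ge0.
have h5 : rdot X (cj X) = rdot X (cj offX) + rdot offX (cj diagX) + rdot diagX (cj diagX).
  rewrite cjE rdotDr addrC -addrA; congr (_ + _).
  by rewrite -rdotDl /offX subrK.
move: h2 h3 h4; rewrite !ler_norml rdotBr -h1 => /andP [h2 _] /andP [_ h3] /andP [_ h4].
move: h2 h3 h4 h5 diag_le heta.
move: (rdot _ _) (rdot _ _) (rdot _ _) (rdot _ _) => a b c d.
lra.
Qed.

End PingPong.

(** * Spectral gap and sums over words *)

Section Expander.
Context (R : realType) (T W : finType) (S : W -> rk R T) (w0 : W) (del : R).
Hypotheses (hS : forall w, rinv (S w)) (S0 : S w0 = @r1 R T).
Hypotheses (del0 : 0 <= del) (del1 : del <= 1).
Hypothesis gap : forall X, rtrace X = 0 ->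
  exists2 w, w != w0 & del * rN X <= rN (rcomm (S w) X).
Implicit Types X Y : rk R T.

Let d : R := #|W|%:R.
Let mu : R := d - del ^+ 2 / 4.

Definition Phi X : rk R T := \sum_w rmul (rmul (S w) X) (S w).

Lemma PhiD X Y : Phi (X + Y) = Phi X + Phi Y.
Proof.
by rewrite /Phi -big_split; apply: eq_bigr => w _; rewrite rmulDr rmulDl.
Qed.

Lemma PhiZ c X : Phi (c *: X) = c *: Phi X.
Proof. by rewrite /Phi scaler_sumr; apply: eq_bigr => w _; rewrite rmulZr rmulZl. Qed.

Lemma Phi1 : Phi (@r1 R T) = d *: @r1 R T.
Proof.
rewrite /Phi (eq_bigr (fun _ => @r1 R T)) => [|w _]; last by rewrite rmul1r (hS w).2.
by rewrite sumr_const scaler_nat.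
Qed.

Lemma rtrace_Phi X : rtrace (Phi X) = d * rtrace X.
Proof.
have -> : rtrace (Phi X) = \sum_w rtrace (rmul (rmul (S w) X) (S w)).
  rewrite /Phi; elim: (index_enum W) => [|w r ih].
    by rewrite !big_nil /rtrace big1.
  by rewrite !big_cons rtraceD ih.
rewrite (eq_bigr (fun _ => rtrace X)) => [|w _].
  by rewrite sumr_const mulr_natl.
by rewrite rtrace_mulC rmulA (hS w).2 rmul1l.
Qed.

Lemma rN_conj w X : rN (rmul (rmul (S w) X) (S w)) = rN X.
Proof. by rewrite rinv_Nr // rinv_N. Qed.

(* Parallelogram identity: a large commutator makes [X + S X S] short. *)
Lemma rN_Phi X : rtrace X = 0 -> rN (Phi X) <= mu * rN X.
Proof.
move=> /gap [w ww0 hw].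
have e0 := rN_ge0 X.
pose Y := rmul (rmul (S w) X) (S w).
(* Origin of [del^2 / 4]: the parallelogram identity gives at most [4 - del^2] for the square, and
   [(2 - del^2 / 4)^2] exceeds this by [del^4 / 16]. *)
have hY : rN (X + Y) <= (2 - del ^+ 2 / 4) * rN X.
  have d2 : del ^+ 2 <= 1 by rewrite expr_le1.
  have c0 : 0 <= 2 - del ^+ 2 / 4 by lra.
  rewrite -(ler_pXn2r (n := 2)) ?nnegrE ?mulr_ge0 ?rN_ge0 //.
  have par : rN (X + Y) ^+ 2 = 4 * rN X ^+ 2 - rN (Y - X) ^+ 2.
    have := congr1 (fun x => x ^+ 2) (rN_conj w X); rewrite -/Y => eY.
    move: eY; rewrite !rN_sq !(rdotDl, rdotDr, rdotNl, rdotNr) => eY.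
    by rewrite (rdotC Y X) eY; ring.
  have : (del * rN X) ^+ 2 <= rN (Y - X) ^+ 2.
    by rewrite rinv_comm // ler_pXn2r ?nnegrE ?mulr_ge0 ?rN_ge0.
  rewrite par !exprMn => h.
  have : 0 <= (del ^+ 2) ^+ 2 * rN X ^+ 2 by rewrite mulr_ge0 ?sqr_ge0.
  have -> : (2 - del ^+ 2 / 4) ^+ 2 * rN X ^+ 2 =
     4 * rN X ^+ 2 - del ^+ 2 * rN X ^+ 2 + 16^-1 * ((del ^+ 2) ^+ 2 * rN X ^+ 2).
    by field.
  by move: h; lra.
have card : d = 2 + \sum_(v | (v != w0) && (v != w)) (1 : R).
  rewrite /d -sum1_card natr_sum (bigD1 w0) //= (bigD1 w) //=; ring.
(* The identity letter contributes [X] itself, to be paired with the letter of the gap; the triangle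
   inequality is enough for all other letters. *)
rewrite /Phi (bigD1 w0) //= (bigD1 w) //= S0 rmul1l rmul1r addrA.
rewrite (le_trans (rND _ _)) //.
have -> : mu * rN X = (2 - del ^+ 2 / 4) * rN X +
    \sum_(v | (v != w0) && (v != w)) rN X.
  have -> : \sum_(v | (v != w0) && (v != w)) rN X =
      (\sum_(v | (v != w0) && (v != w)) 1) * rN X.
    by rewrite mulr_suml; apply: eq_bigr => v _; rewrite mul1r.
  by rewrite /mu card; ring.
apply: lerD hY _; rewrite -big_filter -[leRHS]big_filter.
elim: [seq _ <- _ | _] => [|v r ih]; first by rewrite !big_nil rN0.
by rewrite !big_cons (le_trans (rND _ _)) // rN_conj lerD2l.
Qed.

Fixpoint words m : seq (seq W) :=
  if m is m'.+1 then [seq w :: J | w <- enum W, J <- words m'] else [:: [::]].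

Lemma size_words m : (size (words m))%:R = d ^+ m :> R.
Proof.
elim: m => //= m ih; rewrite size_allpairs natrM ih exprS -cardE.
by [].
Qed.

Definition rword (J : seq W) : rk R T := foldr (fun w Y => rmul (S w) Y) (@r1 R T) J.

Lemma sum_rword m X :
  \sum_(J <- words m) rmul (rmul (rword J) X) (rtr (rword J)) = iter m Phi X.
Proof.
elim: m => [|m ih]; first by rewrite big_seq1 /= rmul1l (@rproj1 R T).1 rmul1r.
rewrite /= big_allpairs_dep /= /Phi -big_enum; apply: eq_bigr => w _.
rewrite -ih rmul_sumr rmul_suml; apply: eq_bigr => J _ /=.
by rewrite rtrM (hS w).1 !rmulA.
Qed.

Lemma rN_iter_Phi m X : rtrace X = 0 -> rN (iter m Phi X) <= mu ^+ m * rN X.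
Proof.
move=> X0; have mu0 : 0 <= mu.
  have := max_card (pred1 w0); rewrite card1 -(ler_nat R) -/d => d1.
  have d2 : del ^+ 2 <= 1 by rewrite expr_le1.
  by rewrite /mu; lra.
have : rtrace (iter m Phi X) = 0 /\ rN (iter m Phi X) <= mu ^+ m * rN X; last by case.
elim: m => [|m [ih0 ih]]; first by rewrite expr0 mul1r.
split; first by rewrite /= rtrace_Phi ih0 mulr0.
by rewrite (le_trans (rN_Phi ih0)) // exprS -mulrA ler_wpM2l.
Qed.

(** The square of [<S_J e, g>] is the inner product of [S_J E S_J^T] with [G], for the rank-one
    matrices [E = e e^T] and [G = g g^T]; summing over words gives [<Phi^m E, G>]. The traceless
    part of [E] contracts at rate [mu], and the scalar part [|e|^2 / N] grows at rate [d], which is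
    the second term. *)
Lemma rword_bound m (e g : T -> R) : (0 < #|T|)%N ->
  \sum_(J <- words m) (\sum_i \sum_j g i * rword J i j * e j) ^+ 2 <=
  (mu ^+ m + d ^+ m / #|T|%:R) * (l2 e ^+ 2 * l2 g ^+ 2).
Proof.
move=> T0; have N0 : 0 < #|T|%:R :> R by rewrite ltr0n.
pose E : rk R T := fun i j => e i * e j; pose G : rk R T := fun i j => g i * g j.
have trE (f : T -> R) : rtrace (fun i j => f i * f j : R^o) = l2 f ^+ 2.
  by rewrite l2_sq.
have NE (f : T -> R) : rN (fun i j => f i * f j : R^o) = l2 f ^+ 2.
  apply/eqP; rewrite -(eqrXn2 (n := 2)) ?rN_ge0 ?sqr_ge0 //; apply/eqP.
  rewrite rN_sq l2_sq expr2 mulr_suml; apply: eq_bigr => i _.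
  by rewrite mulr_sumr; apply: eq_bigr => j _; ring.
have -> : \sum_(J <- words m) (\sum_i \sum_j g i * rword J i j * e j) ^+ 2 =
    rdot (iter m Phi E) G.
  rewrite -sum_rword; elim: (words m) => [|J r ih].
    by rewrite !big_nil /rdot big1 // => i _; rewrite big1 // => j _; rewrite rkE mul0r.
  rewrite !big_cons rdotDl ih; congr (_ + _).
  pose h i := \sum_j rword J i j * e j.
  have -> : \sum_i \sum_j g i * rword J i j * e j = \sum_i g i * h i.
    by apply: eq_bigr => i _; rewrite mulr_sumr; apply: eq_bigr => j _; rewrite mulrA.
  rewrite expr2 mulr_suml; apply: eq_bigr => i _; rewrite mulr_sumr.
  apply: eq_bigr => j _.
  have -> : rmul (rmul (rword J) E) (rtr (rword J)) i j = h i * h j.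
    rewrite /rmul /h mulr_sumr; apply: eq_bigr => l _.
    by rewrite /rtr !mulr_suml; apply: eq_bigr => l' _; rewrite /E; ring.
  by rewrite /G; ring.
pose c := l2 e ^+ 2 / #|T|%:R; pose E0 := E - c *: @r1 R T.
have tr0 : rtrace E0 = 0.
  by rewrite /E0 rtraceD rtraceN rtraceZ rtrace1 trE /c divfK ?subrr ?gt_eqF.
have NE0 : rN E0 <= l2 e ^+ 2.
  rewrite -NE -(ler_pXn2r (n := 2)) ?nnegrE ?rN_ge0 // !rN_sq /E0.
  have r11 : rdot (@r1 R T) (@r1 R T) = #|T|%:R.
    by rewrite -rtrace1 -[X in rdot _ X](@rproj1 R T).1 -rtraceE rmul1l.
  have Er1 : rdot E (@r1 R T) = l2 e ^+ 2.
    by rewrite -trE -[X in rdot _ X](@rproj1 R T).1 -rtraceE rmul1r.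
  rewrite !(rdotDl, rdotDr, rdotNl, rdotNr, rdotZl, rdotZr) (rdotC (@r1 R T) E) r11 Er1.
  have -> : c * #|T|%:R = l2 e ^+ 2 by rewrite /c divfK ?gt_eqF.
  have : 0 <= c * l2 e ^+ 2 by rewrite /c mulrC mulrA mulr_ge0 ?sqr_ge0 ?invr_ge0 ?ltW.
  by move: (c * _) (rdot _ _) => a b; lra.
have iterE : iter m Phi E = iter m Phi E0 + (c * d ^+ m) *: @r1 R T.
  elim: m => [|m ih]; first by rewrite expr0 mulr1 /E0 subrK.
  by rewrite /= ih PhiD PhiZ Phi1 scalerA exprSr mulrA.
rewrite iterE rdotDl mulrDl; apply: lerD.
  rewrite (le_trans (ler_norm _)) // (le_trans (rdot_le _ _)) // NE mulrA.
  rewrite ler_wpM2r ?sqr_ge0 // (le_trans (rN_iter_Phi m tr0)) // ler_wpM2l //.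
  rewrite exprn_ge0 //.
  have := max_card (pred1 w0); rewrite card1 -(ler_nat R) -/d => d1.
  have d2 : del ^+ 2 <= 1 by rewrite expr_le1.
  by rewrite /mu; lra.
rewrite rdotZl.
have -> : rdot (@r1 R T) G = l2 g ^+ 2.
  by rewrite rdotC -trE -[X in rdot _ X](@rproj1 R T).1 -rtraceE rmul1r.
by rewrite /c le_eqVlt; apply/orP; left; apply/eqP; ring.
Qed.

End Expander.

(* In the trace of [Q = Q (sum Q_j) Q] the terms [tr (Q Q_j Q)] are squared norms. *)
Lemma rproj_sum_orth (R : realType) (T J : finType) (Q : J -> rk R T) :
  (forall i, rproj (Q i)) -> \sum_i Q i = @r1 R T ->
  forall i j, i != j -> rmul (Q i) (Q j) = 0.
Proof.
move=> hQ Q1 i j ij.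
have : rtrace (rmul (rmul (Q j) (\sum_l Q l)) (Q j)) = rtrace (Q j).
  by rewrite Q1 rmul1r (hQ j).2.
have -> : rtrace (rmul (rmul (Q j) (\sum_l Q l)) (Q j)) =
    \sum_l rN (rmul (Q l) (Q j)) ^+ 2.
  rewrite rmul_sumr rmul_suml; elim: (index_enum J) => [|l r ih].
    by rewrite !big_nil /rtrace big1.
  rewrite !big_cons rtraceD ih; congr (_ + _).
  rewrite rN_sq rdot_mull (hQ l).1 rmulA (hQ l).2 rdotC -{1}(hQ j).1 -rtraceE.
  by rewrite [in RHS]rtrace_mulC rmulA.
rewrite (bigD1 j) //= (hQ j).2 rN_sq -{2}(hQ j).1 -rtraceE (hQ j).2.
move=> /eqP; rewrite -[X in _ == X]addr0 (inj_eq (addrI _)).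
rewrite psumr_eq0 => [|l _]; last exact: sqr_ge0.
move=> /allP /(_ i (mem_index_enum _)); rewrite ij /= sqrf_eq0 => /eqP h.
by apply: rk_ext => a b; exact: (l2_eq0 h (a, b)).
Qed.

(** * The magic unitary and its spectral gap *)

Section MagicKernel.
Context (R : realType) (k : nat).

Definition site : finType := ('I_3 * plane k)%type.

Definition shears (c : 'I_3) : rk R (plane k) :=
  if c == 0 then permk R (@shear1 k) else
  if c == 1 then permk R (@shear_t k) else @diagk R k.

Lemma shears_inv c : rinv (shears c).
Proof.
rewrite /shears; case: eqP => _; first by apply: permk_inv; exact: shear1K.
case: eqP => _; first by apply: permk_inv; exact: shear_tK.
exact: diagk_inv.
Qed.

Let P : rk R site := pp (@fourk R k).
Let one : rk R site := @r1 R site.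

(* Block diagonal: a 2 x 2 block built from the projection [P], the 3 x 3 block [ub], and the
   identity. *)
Definition umat (i j : nat) : rk R site :=
  if (i < 2)%N && (j < 2)%N then (if i == j then P else one - P)
  else if (1 < i < 5)%N && (1 < j < 5)%N then ub shears (inord (i - 2)) (inord (j - 2))
  else (i == j)%:R *: one.

Let P_proj : rproj P. Proof. exact: pp_proj (@fourk_inv R k). Qed.

Let Pc_proj : rproj (one - P).
Proof.
split; last by rewrite rmulDl rmulNl !rmulDr !rmulNr !rmul1l rmul1r P_proj.2 subrr subr0.
rewrite /rsa -[LHS]/(rtr one - rtr P) P_proj.1.
by rewrite [rtr one](@rproj1 R site).1.
Qed.

Lemma umat_proj i j : rproj (umat i j).
Proof.
rewrite /umat; case: ifP => _; first by case: ifP.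
case: ifP => _; first exact: (ub_proj shears_inv).
case: eqP => _; rewrite ?scale1r ?scale0r; first exact: rproj1.
by split; rewrite ?rmul0l //; apply: rk_ext.
Qed.

Let sum_ord3 (F : 'I_3 -> rk R site) :
  \sum_c F c = F (inord 0) + (F (inord 1) + F (inord 2)).
Proof.
rewrite !big_ord_recl big_ord0 addr0; congr (F _ + (F _ + F _));
  by apply: val_inj; rewrite /= inordK.
Qed.

Let tail_sum n (F : nat -> rk R site) i : (4 < i < n.+4.+1)%N ->
  (forall j, (4 < j)%N -> F j = (i == j)%:R *: one) ->
  \sum_(5 <= j < n.+4.+1) F j = one.
Proof.
move=> hi hF; rewrite (bigD1_seq i) ?iota_uniq ?mem_index_iota //=.
rewrite hF ?eqxx ?scale1r; last by case/andP: hi.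
rewrite big_seq_cond big1 ?addr0 // => j /andP [].
by rewrite mem_index_iota => /andP [j4 _] ji; rewrite hF // eq_sym (negbTE ji) scale0r.
Qed.

Let head_sum (F : nat -> rk R site) n :
  \sum_(j < n.+4.+1) F j =
  F 0%N + (F 1%N + (F 2 + (F 3 + F 4))) + \sum_(5 <= j < n.+4.+1) F j.
Proof.
rewrite -(big_mkord xpredT) (@big_cat_nat _ _ _ 5) //=; congr (_ + _).
by rewrite big_mkord !big_ord_recl big_ord0 addr0.
Qed.

Lemma umat_row n i : (i < n.+4.+1)%N -> \sum_(j < n.+4.+1) umat i j = one.
Proof.
move=> hi; rewrite (head_sum (umat i)).
have [i5|i5] := leqP 5 i.
  rewrite (@tail_sum n _ i) ?i5 // => [|j j4].
    by move: i i5 hi => [|[|[|[|[|i]]]]] //= _ _; rewrite /umat /= !scale0r !add0r.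
  by move: i i5 hi => [|[|[|[|[|i]]]]] //= _ _; rewrite /umat /=.
rewrite [X in _ + X]big_nat_cond big1 ?addr0; last first.
  move=> j /andP [/andP [j5 _] _].
  have nj : (1 < j < 5)%N = false by rewrite [(j < 5)%N]ltnNge j5 andbF.
  have nj2 : (j < 2)%N = false by rewrite ltnNge (leq_trans _ j5).
  rewrite /umat nj nj2 !andbF (_ : (i == j) = false) ?scale0r //.
  by apply: contraTF i5 => /eqP ->; rewrite -leqNgt.
move: i i5 hi => [|[|[|[|[|i]]]]] // _ _; rewrite /umat /= ?scale0r ?add0r ?addr0.
- by rewrite addrC subrK.
- by rewrite subrK.
all: by rewrite -sum_ord3 ub_row.
Qed.

Lemma umat_col n j : (j < n.+4.+1)%N -> \sum_(i < n.+4.+1) umat i j = one.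
Proof.
move=> hj; rewrite (head_sum (umat^~ j)).
have [j5|j5] := leqP 5 j.
  rewrite (@tail_sum n _ j) ?j5 // => [|i i4].
    by move: j j5 hj => [|[|[|[|[|j]]]]] //= _ _; rewrite /umat /= !scale0r !add0r.
  by move: j j5 hj => [|[|[|[|[|j]]]]] //= _ _; rewrite /umat /= !andbF [i == _]eq_sym.
rewrite [X in _ + X]big_nat_cond big1 ?addr0; last first.
  move=> i /andP [/andP [i5 _] _].
  have ni : (1 < i < 5)%N = false by rewrite [(i < 5)%N]ltnNge i5 andbF.
  have ni2 : (i < 2)%N = false by rewrite ltnNge (leq_trans _ i5).
  rewrite /umat ni ni2 /= (_ : (i == j) = false) ?scale0r //.
  by apply: contraTF j5 => /eqP <-; rewrite -leqNgt.
move: j j5 hj => [|[|[|[|[|j]]]]] // _ _; rewrite /umat /= ?scale0r ?add0r ?addr0.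
- by rewrite addrC subrK.
- by rewrite subrK.
all: by rewrite -(sum_ord3 (fun c => ub shears c _)) ub_col.
Qed.

(** The 5 x 5 corner already does it. If all its entries almost commuted with [X], then after
    normalising [X] the amplification would cost a factor 200 and leave the bound [1/1000] that
    [no_almost_commutant] refutes. *)
Lemma umat_gap n (X : rk R site) : rtrace X = 0 ->
  exists i j : 'I_n.+4.+1, (200 * 1000)^-1 * rN X <= rN (rcomm (umat i j) X).
Proof.
move=> X0; have [e|ne] := eqVneq (rN X) 0.
  by exists ord0, ord0; rewrite e mulr0 rN_ge0.
have NX : 0 < rN X by rewrite lt0r ne rN_ge0.
apply: contrapT => /forallNP h.
have {}h i j : (i < 5)%N -> (j < 5)%N -> rN (rcomm (umat i j) X) <= (200 * 1000)^-1 * rN X.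
  move=> i5 j5; have lt5 a : (a < 5)%N -> (a < n.+4.+1)%N by move/leq_trans; apply.
  have /forallNP /(_ (Ordinal (lt5 _ j5))) /= := h (Ordinal (lt5 _ i5)).
  by move=> /negP; rewrite -ltNge => /ltW.
pose Y := (rN X)^-1 *: X.
have {}h i j : (i < 5)%N -> (j < 5)%N -> rN (rcomm (umat i j) Y) <= (200 * 1000)^-1.
  move=> i5 j5; have -> : rcomm (umat i j) Y = (rN X)^-1 *: rcomm (umat i j) X.
    by rewrite /rcomm rmulZr rmulZl -scalerBr.
  by rewrite rNZ ger0_norm ?invr_ge0 ?rN_ge0 // mulrC ler_pdivrMr // h.
have hp : rN (rcomm P Y) <= (200 * 1000)^-1 by exact: (h 0%N 0%N).
have hu i l : rN (rcomm (ub shears i l) Y) <= (200 * 1000)^-1.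
  have lt5 (a : 'I_3) : (1 < a + 2 < 5)%N by case: a => -[|[|[|a]]].
  have /andP [_ i5] := lt5 i; have /andP [_ l5] := lt5 l.
  have := h _ _ i5 l5; rewrite /umat (lt5 i) (lt5 l) !addnK !inord_val.
  by rewrite [(i + 2 < 2)%N]ltnNge leq_addl.
have c : 200 * (200 * 1000)^-1 <= 1000^-1 :> R by rewrite invfM mulrA divff ?mul1r.
have hf := @fourk_inv R k.
apply: (@no_almost_commutant R k Y 1000^-1).
- by rewrite rNZ ger0_norm ?invr_ge0 ?rN_ge0 // mulVf.
- by rewrite rtraceZ X0 mulr0.
- by [].
- exact: le_trans (amplify_r shears_inv hf hp hu 0) c.
- exact: le_trans (amplify_r shears_inv hf hp hu 1) c.
- exact: le_trans (amplify_r shears_inv hf hp hu (1 + 1)) c.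
- exact: le_trans (amplify_f hf hp hu) c.
- by move=> a b; exact: le_trans (amplify_eu hf hp hu a b) c.
Qed.

End MagicKernel.

(* A log-convex sequence grows at least as fast as its first step. *)
Lemma logconvex_growth (R : realType) (b : nat -> R) (C q : R) :
  (forall m, 0 <= b m) -> (forall m, b m.+1 ^+ 2 <= b m * b m.+2) -> 0 < q ->
  (forall m, b m.+1 <= C * q ^+ m) -> b 1%N <= q * b 0%N.
Proof.
move=> b0 bc q0 bq; rewrite leNgt; apply/negP => h.
have b1 : 0 < b 1%N by apply: le_lt_trans h; rewrite mulr_ge0 // ltW.
have b00 : 0 < b 0%N.
  rewrite lt0r b0 andbT; apply/eqP => e; have := bc 0%N.
  by rewrite e mul0r leNgt exprn_gt0.
pose r := b 1%N / b 0%N; have qr : q < r by rewrite /r ltr_pdivlMr.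
have grow m : 0 < b m.+1 /\ r * b m <= b m.+1.
  elim: m => [|m [ih0 ih]]; first by rewrite /r divfK ?gt_eqF.
  have bm : 0 < b m.
    rewrite lt0r b0 andbT; apply/eqP => e; have := bc m.
    by rewrite e mul0r leNgt exprn_gt0.
  have h1 : r * b m.+1 <= b m.+2.
    rewrite -(ler_pM2l bm) (le_trans _ (bc m)) // expr2 mulrCA mulrA.
    by rewrite ler_pM2r.
  by split=> //; apply: lt_le_trans h1; rewrite mulr_gt0 // (lt_trans q0).
have r0 : 0 < r by exact: lt_trans qr.
have pw m : b 1%N * r ^+ m <= b m.+1.
  elim: m => [|m ih]; first by rewrite expr0 mulr1.
  by rewrite exprS mulrCA (le_trans _ (grow m.+1).2) // ler_pM2l.
pose e := r / q - 1; have e0 : 0 < e by rewrite subr_gt0 ltr_pdivlMr ?mul1r.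
(* Were the first step faster than [q], the ratio [r / q > 1] would have bounded powers; Bernoulli's
   inequality makes them grow at least linearly. *)
have bern m : 1 + m%:R * e <= (r / q) ^+ m.
  have -> : r / q = 1 + e by rewrite /e addrC subrK.
  elim: m => [|m ih]; first by rewrite mul0r addr0 expr0.
  have e1 : 0 <= 1 + e by rewrite addr_ge0 ?ler01 // ltW.
  rewrite exprS; apply: le_trans (ler_wpM2l e1 ih).
  have : 0 <= m%:R * (e * e) by rewrite !mulr_ge0 ?ler0n ?(ltW e0).
  by rewrite -natr1; move: m%:R => x; nra.
have bnd m : 1 + m%:R * e <= C / b 1%N.
  apply: le_trans (bern m) _; rewrite exprMn exprVn ler_pdivlMr // mulrAC.
  by rewrite ler_pdivrMr ?exprn_gt0 // mulrC (le_trans (pw m)).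
have := bnd (Num.truncn `|C / b 1%N / e|).+1.
have := truncnS_gt `|C / b 1%N / e|.
move: (_.+1%:R) => x hx; apply/negP; rewrite -ltNge.
have : `|C / b 1%N / e| * e < x * e by rewrite ltr_pM2r.
have : C / b 1%N <= `|C / b 1%N / e| * e.
  by rewrite -{2}[e]gtr0_norm // -normrM divfK ?gt_eqF // ler_norm.
by move: (C / _) (x * e) (_ * e) => u v w; lra.
Qed.

(** * Words in sequences of real matrices *)

Section RealSequences.
Context (R : realType) (T : nat -> finType).
Implicit Types (X Y : forall k, rk R (T k)).

Definition kreal X : kvec R T := fun q => (X (tag q) (tagged q).1 (tagged q).2)%:C.

Lemma kreal_ext X Y : (forall k, X k = Y k) -> kreal X = kreal Y.
Proof. by move=> h; apply: kvec_ext => k i j; rewrite /ent /kreal /= h. Qed.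

Lemma kreal_mul X Y : kmul (kreal X) (kreal Y) = kreal (fun k => rmul (X k) (Y k)).
Proof.
apply: kvec_ext => k i j; rewrite ent_mul /ent /kreal /= rmorph_sum.
by apply: eq_bigr => l _; rewrite rmorphM.
Qed.

Lemma kreal_adj X : kadj (kreal X) = kreal (fun k => rtr (X k)).
Proof. by apply: kvec_ext => k i j; rewrite ent_adj /ent /kreal conjR. Qed.

Lemma kreal1 : kreal (fun k => @r1 R (T k)) = @kone R T.
Proof. by apply: kvec_ext => k i j; rewrite /ent /kreal /kone /r1 /=; case: eqP. Qed.

Lemma kreal0 : kreal (fun k => 0) = 0.
Proof. by apply: kvec_ext => k i j. Qed.

Lemma krealP (c : R) X Y :
  c%:C *: kreal X + kreal Y = kreal (fun k => c *: X k + Y k).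
Proof. by apply: kvec_ext => k i j; rewrite entP /ent /kreal !rkE rmorphD rmorphM. Qed.

Lemma kreal_inv_bd X : (forall k, rinv (X k)) -> bbd (kreal X) 1.
Proof.
move=> hX k; apply: kbd_star => //; rewrite expr1n.
have -> : kmul (kadj (kreal X)) (kreal X) = @kone R T; last exact: kbd1.
rewrite kreal_adj kreal_mul -kreal1; apply: kreal_ext => l.
by rewrite (hX l).1 (hX l).2.
Qed.

End RealSequences.

Section WordBound.
Context (R : realType) (T : nat -> finType) (W : finType).
Context (S : forall k, W -> rk R (T k)) (w0 : W) (del : R).
Hypotheses (hS : forall k w, rinv (@S k w)) (S0 : forall k, @S k w0 = @r1 R (T k)).
Hypotheses (del0 : 0 < del) (del1 : del <= 1).
Hypothesis gap : forall k X, rtrace X = 0 ->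
  exists2 w, w != w0 & del * rN X <= rN (rcomm (@S k w) X).
Hypothesis T_large : forall N, exists K, forall k, (K <= k)%N -> (N <= #|T k|)%N.

Let d : R := #|W|%:R.
Let mu : R := d - del ^+ 2 / 4.

Definition letter w : kvec R T := kreal (fun k => @S k w).
Definition kword (J : seq W) : kvec R T := foldr (fun w x => kmul (letter w) x) (@kone R T) J.

Lemma kwordE J : kword J = kreal (fun k => rword (@S k) J).
Proof.
elim: J => [|w J ih]; first by rewrite /= kreal1.
by rewrite /= ih kreal_mul.
Qed.

Lemma letter_bd w : bbd (letter w) 1.
Proof. exact: kreal_inv_bd. Qed.

Lemma card_letters : 1 <= d.
Proof. by have := max_card (pred1 w0); rewrite card1 -(ler_nat R). Qed.

Lemma mu_gt0 : 0 < mu.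
Proof.
have d2 : del ^+ 2 <= 1 by rewrite expr_le1 // ltW.
by have := card_letters; rewrite /mu; lra.
Qed.

Definition bform k (Y : rk R (T k)) (u v : T k -> R) : R := \sum_i \sum_j u i * Y i j * v j.
Definition re_part k (xi : ell2 R (T k)) : T k -> R := fun i => complex.Re (xi i).
Definition im_part k (xi : ell2 R (T k)) : T k -> R := fun i => complex.Im (xi i).

(** The gap is known for real matrices while the Hilbert spaces are complex. The form is expanded
    into real and imaginary parts of both vectors, and the cross terms are absorbed by
    [(x + y)^2 <= 2 (x^2 + y^2)]. *)
Lemma real_form_sq k (Y : rk R (T k)) (xi zeta : ell2 R (T k)) :
  cnorm (\sum_i (\sum_j (Y i j)%:C * xi j) * Num.conj (zeta i)) ^+ 2 <=
  2 * (bform Y (re_part zeta) (re_part xi) ^+ 2 + bform Y (im_part zeta) (im_part xi) ^+ 2 +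
       bform Y (re_part zeta) (im_part xi) ^+ 2 + bform Y (im_part zeta) (re_part xi) ^+ 2).
Proof.
set e := re_part xi; set e' := im_part xi; set g := re_part zeta; set g' := im_part zeta.
have -> : \sum_i (\sum_j (Y i j)%:C * xi j) * Num.conj (zeta i) =
    (bform Y g e + bform Y g' e') +i* (bform Y g e' - bform Y g' e).
  rewrite /bform -sumrN -!big_split /=.
  have sumC (I : Type) (r : seq I) (F G : I -> R) :
      (\sum_(i <- r) F i) +i* (\sum_(i <- r) G i) = \sum_(i <- r) (F i +i* G i).
    elim: r => [|i r ih]; first by rewrite !big_nil.
    by rewrite !big_cons -ih.
  rewrite sumC; apply: eq_bigr => i _; rewrite -sumrN -!big_split sumC mulr_suml.
  apply: eq_bigr => j _; rewrite conjcE /e /e' /g /g' /re_part /im_part.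
  case: (xi j) => x y; case: (zeta i) => z w.
  by apply/eqP; rewrite eq_complex /=; apply/andP; split; apply/eqP; ring.
rewrite cnorm_sq /=.
move: (bform Y g e) (bform Y g' e') (bform Y g e') (bform Y g' e) => x y z w.
have := sqr_ge0 (x - y); have := sqr_ge0 (z + w); nra.
Qed.

Lemma nm_re_im k (xi : ell2 R (T k)) : nm xi ^+ 2 = l2 (re_part xi) ^+ 2 + l2 (im_part xi) ^+ 2.
Proof.
rewrite nm_ell2 !l2_sq -big_split; apply: eq_bigr => i _ /=.
exact: cnorm_sq.
Qed.

Lemma word_form_bound m k (xi zeta : ell2 R (T k)) : (0 < #|T k|)%N ->
  \sum_(J <- words W m) cnorm (hdot (kact (kword J) xi) zeta) ^+ 2 <=
  2 * ((mu ^+ m + d ^+ m / #|T k|%:R) * (nm xi ^+ 2 * nm zeta ^+ 2)).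
Proof.
move=> T0.
have bd e g := @rword_bound R (T k) W (@S k) w0 del (@hS k) (@S0 k) (ltW del0) del1
  (@gap k) m e g T0.
have h : \sum_(J <- words W m) cnorm (hdot (kact (kword J) xi) zeta) ^+ 2 <=
    \sum_(J <- words W m) 2 * (bform (rword (@S k) J) (re_part zeta) (re_part xi) ^+ 2 +
       bform (rword (@S k) J) (im_part zeta) (im_part xi) ^+ 2 +
       bform (rword (@S k) J) (re_part zeta) (im_part xi) ^+ 2 +
       bform (rword (@S k) J) (im_part zeta) (re_part xi) ^+ 2).
  apply: ler_sum => J _; rewrite hdot_ell2 kwordE; exact: real_form_sq.
apply: le_trans h _; rewrite -mulr_sumr ler_pM2l // !big_split /=.
rewrite !nm_re_im; rewrite -/d -/mu in bd.
have b1 := bd (re_part xi) (re_part zeta); have b2 := bd (im_part xi) (im_part zeta).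
have b3 := bd (im_part xi) (re_part zeta); have b4 := bd (re_part xi) (im_part zeta).
apply: le_trans (lerD (lerD (lerD b1 b2) b3) b4) _.
by rewrite le_eqVlt; apply/orP; left; apply/eqP; ring.
Qed.

Lemma sum_sq_le (I : Type) (r : seq I) (F : I -> R) :
  (\sum_(i <- r) F i) ^+ 2 <= (size r)%:R * \sum_(i <- r) F i ^+ 2.
Proof.
rewrite !(big_tnth _ _ r).
have := l2_dot (fun _ => 1) (fun i : 'I_(size r) => F (tnth (in_tuple r) i)).
rewrite -(ler_pXn2r (n := 2)) ?nnegrE ?normr_ge0 ?mulr_ge0 ?l2_ge0 //.
rewrite exprMn !l2_sq real_normK ?num_real //.
under eq_bigr do rewrite mul1r; under [\sum_(i < _) 1 ^+ 2]eq_bigr do rewrite expr1n.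
by rewrite sumr_const card_ord.
Qed.

(** The geometric mean of [d] and [mu]: Cauchy-Schwarz over [d^m] words meets a sum of squares of
    order [mu^m]. *)
Definition growth : R := Num.sqrt (d * mu).

Lemma growth_gt0 : 0 < growth.
Proof. by rewrite sqrtr_gt0 mulr_gt0 ?mu_gt0 // (lt_le_trans _ card_letters). Qed.

Lemma growth_lt : growth < d.
Proof.
have d1 := card_letters; have d0 : 0 < d by exact: lt_le_trans d1.
rewrite -(ltr_pXn2r (n := 2)) ?nnegrE ?(ltW growth_gt0) ?(ltW d0) //.
rewrite sqr_sqrtr ?mulr_ge0 ?(ltW mu_gt0) ?(ltW d0) // expr2 ltr_pM2l //.
by rewrite /mu ltrBlDr ltrDl divr_gt0 ?exprn_gt0.
Qed.

Lemma kword_sum_bd m (gam : seq W -> R[i]) c : 0 <= c -> (forall J, cnorm (gam J) <= c) ->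
  qbd (\sum_(J <- words W m) gam J *: kword J) (2 * c * growth ^+ m).
Proof.
move=> c0 hg; have mum : 0 < mu ^+ m by rewrite exprn_gt0 // mu_gt0.
have d0 : 0 <= d by exact: le_trans card_letters.
(* Beyond [K] the contribution [d^m / N] of the scalar matrices is at most [mu^m]. The threshold
   depends on [m], so the bound is one of the quotient algebra only. *)
have [K hK] := T_large (Num.truncn (d ^+ m / mu ^+ m)).+1.
exists K => k /hK Nk; split=> [|xi]; first by rewrite !mulr_ge0 ?exprn_ge0 // ltW ?growth_gt0.
have T0 : (0 < #|T k|)%N by exact: leq_trans Nk.
have small : d ^+ m / #|T k|%:R <= mu ^+ m.
  rewrite ler_pdivrMr ?ltr0n // mulrC -ler_pdivrMr //.
  apply: ltW; apply: lt_le_trans (truncnS_gt _) _.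
  by rewrite ler_nat.
apply: nm_le_hdot => [|zeta].
  by rewrite !mulr_ge0 ?exprn_ge0 ?nm_ge0 // ltW ?growth_gt0.
have -> : hdot (kact (\sum_(J <- words W m) gam J *: kword J) xi) zeta =
    \sum_(J <- words W m) gam J * hdot (kact (kword J) xi) zeta.
  elim: (words W m) => [|J r ih]; first by rewrite !big_nil kact0 hdot0l.
  by rewrite !big_cons kactD hdotDl ih kactZ hdotZl.
rewrite (le_trans (cnorm_sum _ _)) //.
apply: (@le_trans _ _ (c * \sum_(J <- words W m) cnorm (hdot (kact (kword J) xi) zeta))).
  rewrite mulr_sumr; apply: ler_sum => J _; rewrite cnormM.
  by rewrite ler_wpM2r ?cnorm_ge0.
rewrite -!mulrA mulrCA ler_wpM2l //.
have l0 : 0 <= \sum_(J <- words W m) cnorm (hdot (kact (kword J) xi) zeta).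
  by apply: sumr_ge0 => J _; exact: cnorm_ge0.
have r0 : 0 <= 2 * (growth ^+ m * (nm xi * nm zeta)).
  by rewrite !mulr_ge0 ?exprn_ge0 ?nm_ge0 // ltW ?growth_gt0.
rewrite -(ler_pXn2r (n := 2)) ?nnegrE //.
apply: le_trans (sum_sq_le _ _) _; rewrite size_words -/d.
(* The sum of squares is now at most [4 mu^m] times the squared norms; the root of 4 is the factor 2
   of the statement. *)
apply: (@le_trans _ _ (d ^+ m * (2 * ((mu ^+ m + mu ^+ m) * (nm xi ^+ 2 * nm zeta ^+ 2))))).
  rewrite ler_wpM2l ?exprn_ge0 // (le_trans (word_form_bound m xi zeta T0)) //.
  rewrite ler_pM2l //; apply: ler_wpM2r; first by rewrite mulr_ge0 ?sqr_ge0.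
  exact: lerD.
have gE : (growth ^+ m) ^+ 2 = d ^+ m * mu ^+ m.
  by rewrite -exprM mulnC exprM sqr_sqrtr ?exprMn // mulr_ge0 ?(ltW mu_gt0).
rewrite 3!exprMn gE.
by rewrite le_eqVlt; apply/orP; left; apply/eqP; ring.
Qed.

End WordBound.

(** * Norm of the average in the quotient *)

Section MomentBound.
Context (R : realType) (T : nat -> finType) (W : finType) (x : W -> kvec R T) (g : R).

Let xword (J : seq W) : kvec R T := foldr (fun w y => kmul (x w) y) (@kone R T) J.

Hypotheses (x1 : forall w, bbd (x w) 1) (xsa : forall w, kadj (x w) = x w) (g0 : 0 < g).
Hypothesis word_sum_bd : forall m (gam : seq W -> R[i]) c, 0 <= c ->
  (forall J, cnorm (gam J) <= c) ->
  qbd (\sum_(J <- words W m) gam J *: xword J) (2 * c * g ^+ m).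

Context (Q A : cstarType R) (qpi : kvec R T -> Q) (a : W -> A).
Hypothesis mq : cq_model (P := qpre R T) qpi.
Hypotheses (asa : forall w, adj (a w) = a w)
  (ac : forall (K : hilbertType R) (sigma : A -> K -> K), is_rep sigma ->
    forall w eta, nm (sigma (a w) eta) <= nm eta).

Let s : seq (Q * A) := [seq (qpi (x w), a w) | w <- enum W].

Let Sx w : bS (x w). Proof. by exists 1; exact: x1. Qed.

Let xword_S J : bS (xword J).
Proof.
elim: J => [|w J ih]; first exact: b_one_S.
exact: bSM.
Qed.

Let qpi0 : qpi 0 = 0.
Proof. by have := model_sub mq (bS0 R T) (bS0 R T); rewrite !subrr. Qed.

Let s_sa : sadj s = s.
Proof.
rewrite /sadj /s -map_comp; apply: eq_map => w /=.
by rewrite asa -(model_adj mq (Sx w)) [padj _]xsa.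
Qed.

Context (H K L : hilbertType R) (t : H -> K -> L) (pi : Q -> H -> H) (sigma : A -> K -> K).
Hypotheses (ht : is_hilbert_tensor t) (hpi : is_rep pi) (hs : is_rep sigma).
Implicit Types v : seq (H * K).

Let step w (p : H * K) : H * K := (pi (qpi (x w)) p.1, sigma (a w) p.2).
Let F := fev pi sigma s.

Let iter_fev m v (V : nmodType) (f : H * K -> V) :
  \sum_(p <- iter m F v) f p = \sum_(p <- v) \sum_(J <- words W m) f (foldr step p J).
Proof.
elim: m f => [|m ih] f; first by apply: eq_bigr => p _; rewrite big_seq1.
rewrite /= /F /fev big_allpairs_dep /s big_map /=.
under eq_bigr => w _ do rewrite (ih (fun p => f (step w p))).
rewrite exchange_big; apply: eq_bigr => p _ /=.
by rewrite big_allpairs_dep.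
Qed.

Let step1 J (p : H * K) : pi (qpi (@kone R T)) p.1 = p.1 ->
  (foldr step p J).1 = pi (qpi (xword J)) p.1.
Proof.
move=> hp; elim: J => [|w J ih] //=.
rewrite ih -(repM hpi); congr (pi _ _).
by rewrite -(model_mul mq (Sx w) (xword_S J)).
Qed.

Let step2 J (p : H * K) : nm (foldr step p J).2 <= nm p.2.
Proof. by elim: J => [|w J ih] //=; exact: le_trans (ac hs _ _) ih. Qed.

(** The inner products of the second legs are read as bounded coefficients [gam J]. The sum of
    products then becomes one coefficient of a single element of [Q], whose norm [word_sum_bd]
    controls; nothing about the elements of [A] matters except that they act as contractions. *)
Let pair_bound m (p p' : H * K) : pi (qpi (@kone R T)) p.1 = p.1 ->
  cnorm (\sum_(J <- words W m)
    hdot (foldr step p J).1 p'.1 * hdot (foldr step p J).2 p'.2) <=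
  2 * (nm p.2 * nm p'.2) * (nm p.1 * nm p'.1) * g ^+ m.
Proof.
move=> hp; pose gam J := hdot (foldr step p J).2 p'.2.
have hgam J : cnorm (gam J) <= nm p.2 * nm p'.2.
  by rewrite (le_trans (hdot_le _ _)) // ler_wpM2r ?nm_ge0.
have c0 : 0 <= nm p.2 * nm p'.2 by rewrite mulr_ge0 ?nm_ge0.
have bd := word_sum_bd m c0 hgam.
have -> : \sum_(J <- words W m) hdot (foldr step p J).1 p'.1 * hdot (foldr step p J).2 p'.2 =
    hdot (pi (qpi (\sum_(J <- words W m) gam J *: xword J)) p.1) p'.1.
  have : bS (\sum_(J <- words W m) gam J *: xword J) /\
    \sum_(J <- words W m) hdot (foldr step p J).1 p'.1 * hdot (foldr step p J).2 p'.2 =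
    hdot (pi (qpi (\sum_(J <- words W m) gam J *: xword J)) p.1) p'.1; last by case.
  elim: (words W m) => [|J r [ih1 ih2]].
    by rewrite !big_nil qpi0 (rep0 hpi) hdot0l; split=> //; exact: bS0.
  rewrite !big_cons; split; first exact: bSP.
  rewrite (model_lin mq _ (xword_S J) ih1) (repP hpi) hdotDl hdotZl -ih2 step1 //.
  by rewrite mulrC.
have Sb : bS (\sum_(J <- words W m) gam J *: xword J) by exact: qbd_bS bd.
rewrite (le_trans (hdot_le _ _)) //.
apply: (@le_trans _ _ (2 * (nm p.2 * nm p'.2) * g ^+ m * nm p.1 * nm p'.1)); last first.
  by rewrite le_eqVlt; apply/orP; left; apply/eqP; ring.
rewrite ler_wpM2r ?nm_ge0 // (le_trans (rep_contract hpi _ _)) // ler_wpM2r ?nm_ge0 //.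
exact: (model_le mq Sb bd).
Qed.

(* Applying [F] once puts all first legs in the range of the projection [pi 1]. *)
Let growth_bound v v' : exists C, forall m,
  cnorm (hdot (tval t (iter m F (F v))) (tval t v')) <= C * g ^+ m.
Proof.
exists (\sum_(w <- enum W) \sum_(p <- v) \sum_(p' <- v')
  2 * (nm (step w p).2 * nm p'.2) * (nm (step w p).1 * nm p'.1)) => m.
rewrite (hdot_tval ht).
rewrite (@iter_fev m (F v) _ (fun p => \sum_(p' <- v') hdot p.1 p'.1 * hdot p.2 p'.2)).
rewrite {1}/F /fev big_allpairs_dep /s big_map /= mulr_suml.
rewrite (le_trans (cnorm_sum _ _)) //; apply: ler_sum => w _; rewrite mulr_suml.
rewrite (le_trans (cnorm_sum _ _)) //; apply: ler_sum => p _; rewrite mulr_suml exchange_big /=.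
rewrite (le_trans (cnorm_sum _ _)) //; apply: ler_sum => p' _.
apply: (pair_bound m (p := step w p)).
rewrite /= -(repM hpi) -(model_mul mq (b_one_S R T) (Sx w)).
by rewrite [pmul _ _]kmul1x.
Qed.

Let F_sym v v' : hdot (tval t (F v)) (tval t v') = hdot (tval t v) (tval t (F v')).
Proof. by rewrite /F (hdot_fev ht hpi hs) s_sa. Qed.

Let iter_sym m v v' :
  hdot (tval t (iter m F v)) (tval t v') = hdot (tval t v) (tval t (iter m F v')).
Proof. by elim: m v' => //= m ih v'; rewrite F_sym ih -iterSr. Qed.

(** As [F] is symmetric, the squared norms of [F^m v] are log-convex, and the one for [F^(m+1) v] is
    the inner product of [F^(2m) F v] with [F v], at most [C g^(2m)]. The constant [C] depends on
    the list [v] and may be huge, but log-convexity removes it. *)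
Lemma moment_bound v : nm (tval t (F v)) <= g * nm (tval t v).
Proof.
pose b m := nm (tval t (iter m F v)) ^+ 2.
have [C hC] := growth_bound v (F v).
have nmh u : nm (tval t u) ^+ 2 = cnorm (hdot (tval t u) (tval t u)).
  by rewrite hdot_nm cnormR ger0_norm ?sqr_ge0.
rewrite -(ler_pXn2r (n := 2)) ?nnegrE ?mulr_ge0 ?nm_ge0 ?(ltW g0) // exprMn.
apply: (@logconvex_growth R b C (g ^+ 2)) => [m|m||m].
- exact: sqr_ge0.
- rewrite {1}/b nmh /= F_sym /b -exprMn.
  by rewrite ler_pXn2r ?nnegrE ?cnorm_ge0 ?mulr_ge0 ?nm_ge0 // hdot_le.
- exact: exprn_gt0.
- rewrite /b nmh !iterSr iter_sym hdotC cnormJ -iterD -exprM mul2n -addnn; exact: hC.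
Qed.

End MomentBound.

Section TensorNorm.
Context (R : realType) (B A TB : cstarType R) (tens : B -> A -> TB).
Hypothesis ht : is_min_tensor tens.
Implicit Types s : seq (B * A).

Definition sval s : TB := \sum_(q <- s) tens q.1 q.2.

Lemma tensMin c b b' a : tens (c *: b + b') a = c *: tens b a + tens b' a.
Proof. by case: ht => -[h _] _ _ _ _; exact: h. Qed.

Lemma sval_cat s s' : sval (s ++ s') = sval s + sval s'.
Proof. by rewrite /sval big_cat. Qed.

Lemma sval_scale c s : sval (sscale c s) = c *: sval s.
Proof.
have t0 a : tens 0 a = 0.
  by have := tensMin 1 0 0 a; rewrite !scale1r addr0 => /eqP;
    rewrite -subr_eq subrr eq_sym => /eqP.
rewrite /sval /sscale big_map scaler_sumr; apply: eq_bigr => q _ /=.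
by rewrite -[c *: q.1]addr0 tensMin t0 addr0.
Qed.

Lemma sval_smul s s' : sval (smul s s') = sval s ** sval s'.
Proof.
have [_ tM _ _ _] := ht.
rewrite /sval /smul big_allpairs_dep amul_suml; apply: eq_bigr => q _.
by rewrite amul_sumr; apply: eq_bigr => q' _; rewrite tM.
Qed.

Lemma sval_norm s (M : R) : 0 <= M -> nm (sval s) <= M <->
  forall (H K L : hilbertType R) (t : H -> K -> L) pi sigma,
    is_hilbert_tensor t -> is_rep pi -> is_rep sigma -> forall v,
    nm (tval t (fev pi sigma s v)) <= M * nm (tval t v).
Proof.
move=> M0; have [_ _ _ _ tn] := ht.
have := tn (size s) (fun i => (tnth (in_tuple s) i).1) (fun i => (tnth (in_tuple s) i).2) M%:C.
rewrite ler0c => /(_ M0) {tn}.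
rewrite -(big_tnth _ _ s xpredT (fun q => tens q.1 q.2)) -/(sval s) nmE lecR => -> {M0}.
have E (H K L : hilbertType R) (t : H -> K -> L) pi sigma v :
    tval t (fev pi sigma s v) = \sum_(p <- v) \sum_(i < size s)
      t (pi (tnth (in_tuple s) i).1 p.1) (sigma (tnth (in_tuple s) i).2 p.2).
  rewrite tval_fev exchange_big; apply: eq_bigr => p _ /=.
  by rewrite (big_tnth _ _ s).
split=> h H K L t pi sigma hl hpi hs.
  move=> v; have := h H K L t pi sigma hl hpi hs (size v)
    (fun k => (tnth (in_tuple v) k).1) (fun k => (tnth (in_tuple v) k).2).
  by rewrite !nmE -rmorphM lecR E /tval !(big_tnth _ _ v).
move=> p x y; have := h H K L t pi sigma hl hpi hs [seq (x k, y k) | k <- enum 'I_p].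
by rewrite E /tval !big_map !nmE -rmorphM lecR.
Qed.

Lemma sval_approx z (e : R) : 0 < e -> exists s, nm (z - sval s) <= e.
Proof.
move=> e0; have [_ _ _ td _] := ht.
have e0' : 0 < e%:C by rewrite ltcR.
have [|w [/interior_subset h [m [b [a eba]]]]] := td (ball z e%:C)^° _ (open_interior _).
  by exists z; exact: nbhsx_ballx.
exists [seq (b i, a i) | i <- enum 'I_m].
rewrite /sval big_map big_enum /=.
by move: h; rewrite eba -ball_normE /= nmE ltcR => /ltW.
Qed.

End TensorNorm.

Lemma tensor_models (R : realType) (J B Q A : cstarType R) (f : J -> B) (g : B -> Q) :
  star_hom f -> star_hom g ->
  exists (TJ TB TQ : cstarType R) (tJ : J -> A -> TJ) (tB : B -> A -> TB) (tQ : Q -> A -> TQ)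
    (F : TJ -> TB) (G : TB -> TQ),
  [/\ is_min_tensor tJ, is_min_tensor tB & is_min_tensor tQ] /\
  [/\ star_hom F, star_hom G, forall j a, F (tJ j a) = tB (f j) a,
    forall b a, G (tB b a) = tQ (g b) a & forall z, nm (F z) <= nm z].
Proof.
move=> hf hg; exists (mtens J A), (mtens B A), (mtens Q A).
exists (@etens R J A), (@etens R B A), (@etens R Q A).
exists (@tmap R J B A f), (@tmap R B Q A g).
split; first by split; exact: etens_min.
split; [exact: tmap_hom | exact: tmap_hom | exact: tmap_etens hf | exact: tmap_etens hg |].
exact: tmap_le.
Qed.

(** * Contractivity of [1 - 2 u_ij^2] from orthogonality *)

Section OrthogonalContraction.
Context (R : realType) (n : nat) (A : unitalCstarType R) (u : 'I_n -> 'I_n -> A).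
Hypothesis hu : orthogonal_system u.

Lemma adj_aone : adj (aone : A) = aone.
Proof. by rewrite -[LHS]amul1x -{1}[aone]adjK -adjM amul1x adjK. Qed.

Definition refl i j : A := aone - 2%:R%:C *: (u i j ** u i j).

Lemma adj_refl i j : adj (refl i j) = refl i j.
Proof.
have [ua _ _] := hu.
by rewrite /refl adjB adj_aone adjZ conjR adjM !ua.
Qed.

(* [1 - a^2 = 4 h (1 - h)] for [h = u_ij^2] and [a = 1 - 2 h], and [h (1 - h)] is
   the sum of the squares [(u_il u_ij)^* (u_il u_ij)], [l != j]. *)
Lemma refl_contract i j (H : hilbertType R) (pi : A -> H -> H) (x : H) :
  is_rep pi -> nm (pi (refl i j) x) <= nm x.
Proof.
move=> hpi; have [ua urow _] := hu.
pose h := u i j ** u i j.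
have hsum : \sum_(l | l != j) adj (u i l ** u i j) ** (u i l ** u i j) = h - h ** h.
  have e : \sum_l (u i l ** u i l) = aone by rewrite urow eqxx.
  have e2 : u i j ** (\sum_(l | l != j) u i l ** u i l) ** u i j = h - h ** h.
    apply/eqP; rewrite eq_sym subr_eq addrC; apply/eqP.
    transitivity (u i j ** (\sum_l u i l ** u i l) ** u i j); first by rewrite e amulx1.
    by rewrite (bigD1 j) //= amulDr amulDl /h !amulA.
  rewrite -e2 -[LHS]big_filter -[X in _ ** X ** _]big_filter amul_sumr amul_suml.
  apply: eq_bigr => l _.
  by rewrite adjM !ua !amulA.
have dotJ a b : hdot (pi a x) (pi b x) = hdot x (pi (adj a ** b) x).
  by rewrite (repJ hpi) -(repM hpi).
(* A representation may be degenerate, so [pi aone] need not be the identity. *)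
have one_le : nm (pi aone x) <= nm x.
  rewrite (le_trans (rep_contract hpi _ _)) // -[leRHS]mul1r ler_wpM2r ?nm_ge0 //.
  have : nm (aone : A) ^+ 2 = nm (aone : A) by rewrite -nm_star adj_aone amul1x.
  have := nm_ge0 (aone : A); rewrite expr2; move: (nm _) => c; nra.
apply: le_trans one_le.
rewrite -(ler_pXn2r (n := 2)) ?nnegrE ?nm_ge0 // -subr_ge0.
have -> : nm (pi aone x) ^+ 2 - nm (pi (refl i j) x) ^+ 2 =
    4 * \sum_(l | l != j) nm (pi (u i l ** u i j) x) ^+ 2.
  apply: complexI; rewrite rmorphB [in RHS]rmorphM rmorph_sum /= -!hdot_nm.
  under eq_bigr => l _ do rewrite -hdot_nm dotJ.
  rewrite -big_filter -hdot_sumr -(rep_sum hpi) big_filter hsum !dotJ -hdotBr -(repB hpi).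
  rewrite adj_refl adj_aone amul1x.
  have -> : aone - refl i j ** refl i j = 4%:R%:C *: (h - h ** h).
    have two : 2%:R%:C *: h = h + h by rewrite rmorph_nat scaler_nat mulr2n.
    rewrite /refl -/h two amulBl !amulBr !amul1x amulx1 amulDl !amulDr.
    rewrite opprB opprB addrCA [aone + _]addrC subrK rmorph_nat scaler_nat mulrnBl addrAC.
    by congr (_ - _); rewrite !mulrS mulr0n addr0 !addrA.
  by rewrite (repZ hpi) hdotZr conjR rmorph_nat.
by rewrite mulr_ge0 // sumr_ge0 // => l _; exact: sqr_ge0.
Qed.

End OrthogonalContraction.

(** * Failure of exactness *)

Section MagicSequences.
Context (R : realType) (m : nat).
Let n := m.+4.+1.

(** [None] stands for the identity. It is the summand [1 (x) 1] of the average, and in the gap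
    estimate the unchanged [X] with which a displaced copy is compared. *)
Definition letters : finType := option ('I_n * 'I_n).

Definition sgen (k : nat) (w : letters) : rk R (site k) :=
  if w is Some (i, j) then @r1 R (site k) - 2 *: @umat R k i j else @r1 R (site k).

Lemma rproj_rinv (T : finType) (P : rk R T) : rproj P -> rinv (@r1 R T - 2 *: P).
Proof.
move=> [Ps Pp]; split.
  rewrite /rsa -[LHS]/(rtr (@r1 R T) - 2 *: rtr P) Ps.
  by rewrite (@rproj1 R T).1.
rewrite rmulDl rmulNl !rmulDr !rmulNr rmul1l !rmul1r rmul1l rmulZl rmulZr Pp.
by apply: rk_ext => i j; rewrite !rkE; ring.
Qed.

Lemma sgen_inv k w : rinv (@sgen k w).
Proof.
case: w => [[i j]|] /=; last exact: rinv1.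
exact/rproj_rinv/umat_proj.
Qed.

(* The amplification loses a factor 200, and [no_almost_commutant] starts at 1 / 1000. *)
Definition gap_const : R := 2 * (200 * 1000)^-1.

Lemma gap_const_gt0 : 0 < gap_const.
Proof. rewrite /gap_const; lra. Qed.

Lemma gap_const_le1 : gap_const <= 1.
Proof. rewrite /gap_const; lra. Qed.

Lemma sgen_gap k (X : rk R (site k)) : rtrace X = 0 ->
  exists2 w, w != None & gap_const * rN X <= rN (rcomm (@sgen k w) X).
Proof.
move=> X0; have [i [j h]] := umat_gap m X0.
exists (Some (i, j)) => //.
have -> : rcomm (@sgen k (Some (i, j))) X = (-2) *: rcomm (@umat R k i j) X.
  by rewrite /sgen -scaleNr rcommD rcomm1 add0r rcommZ.
by rewrite rNZ normrN ger0_norm // /gap_const -mulrA ler_pM2l.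
Qed.

Lemma site_large N : exists K, forall k, (K <= k)%N -> (N <= #|site k|)%N.
Proof.
exists N => k Nk; apply: leq_trans Nk _.
rewrite card_prod card_ord card_prod.
have b : (k <= #|{: bits k}|)%N.
  rewrite card_ffun card_bool card_ord expnS; apply: leq_trans (leq_pmull _ _) => //.
  exact/ltnW/ltn_expl.
have b0 : (0 < #|{: bits k}|)%N by apply/card_gt0P; exists (bzero k).
apply: leq_trans b _; rewrite mulnA; apply: leq_pmull.
by rewrite muln_gt0 b0.
Qed.

Definition ku (i j : nat) : kvec R site := kreal (fun k => @umat R k i j).

Lemma letterE i j : letter sgen (Some (i, j)) = @kone R site - 2%:R%:C *: ku i j.
Proof.
rewrite -kreal1 addrC -scaleNr -rmorphN krealP; apply: kreal_ext => k.
by rewrite /sgen scaleNr addrC.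
Qed.

Lemma ku_S i j : bS (ku i j).
Proof.
(* A projection is half the difference of the identity and its symmetry, and symmetries are bounded
   by one. *)
have -> : ku i j = (2^-1)%:C *: (@kone R site) +
    (- 2^-1)%:C *: kreal (fun k => @r1 R (site k) - 2 *: @umat R k i j).
  rewrite addrC -kreal1 -[X in _ + X]addr0 -kreal0 !krealP; apply: kreal_ext => k.
  by apply: rk_ext => a b; rewrite !rkE; field.
have S1 : bS (kreal (fun k => @r1 R (site k) - 2 *: @umat R k i j)).
  by exists 1; apply: kreal_inv_bd => k; exact/rproj_rinv/umat_proj.
apply: bSP; first exact: b_one_S.
by rewrite -[_ *: _]addr0; apply: bSP S1 (bS0 _ _).
Qed.

Context (B : unitalCstarType R) (bpi : kvec R site -> B).
Hypotheses (mb : cq_model (P := bpre R site) bpi) (b1 : bpi (@kone R site) = aone).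

Let bpi0 : bpi 0 = 0.
Proof. by have := model_sub mb (bS0 R site) (bS0 R site); rewrite !subrr. Qed.

Let bpi_sum (X : 'I_n -> forall k, rk R (site k)) : (forall l, bS (kreal (X l))) ->
  (forall k, \sum_l X l k = @r1 R (site k)) -> \sum_l bpi (kreal (X l)) = aone.
Proof.
move=> SX X1; rewrite -b1 -kreal1.
have h (r : seq 'I_n) : bS (kreal (fun k => \sum_(l <- r) X l k)) /\
    \sum_(l <- r) bpi (kreal (X l)) = bpi (kreal (fun k => \sum_(l <- r) X l k)).
  elim: r => [|l r [ih1 ih2]].
    have -> : kreal (fun k => \sum_(l <- [::]) X l k) = 0.
      by rewrite -kreal0; apply: kreal_ext => k; rewrite big_nil.
    by rewrite big_nil bpi0; split=> //; exact: bS0.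
  have -> : kreal (fun k => \sum_(l <- l :: r) X l k) =
      1 *: kreal (X l) + kreal (fun k => \sum_(l <- r) X l k).
    rewrite -[1]/(1%:C) krealP; apply: kreal_ext => k.
    by rewrite big_cons scale1r.
  rewrite big_cons ih2; split; first exact: bSP.
  by rewrite (model_lin mb 1 (SX l) ih1) scale1r.
rewrite (h _).2; congr bpi; apply: kreal_ext => k; exact: X1.
Qed.

Let v (i j : 'I_n) : B := bpi (ku i j).

Let v_mul (i j i' j' : 'I_n) :
  v i j ** v i' j' = bpi (kreal (fun k => rmul (@umat R k i j) (@umat R k i' j'))).
Proof. by rewrite -(model_mul mb (ku_S i j) (ku_S i' j')) -kreal_mul. Qed.

Lemma v_idem i j : v i j ** v i j = v i j.
Proof.
rewrite v_mul; congr bpi; apply: kreal_ext => k.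
by case: (@umat_proj R k i j).
Qed.

Let v_row i : \sum_j v i j = aone.
Proof.
by apply: (bpi_sum (X := fun j k => @umat R k i j)) => [l|k]; [exact: ku_S | exact: umat_row].
Qed.

Let v_col j : \sum_i v i j = aone.
Proof.
by apply: (bpi_sum (X := fun i k => @umat R k i j)) => [l|k]; [exact: ku_S | exact: umat_col].
Qed.

Let v_orth i j k : i != j -> v i k ** v j k = 0 /\ v k i ** v k j = 0.
Proof.
move=> ij; rewrite !v_mul -bpi0 -kreal0; split; congr bpi; apply: kreal_ext => l.
  apply: (rproj_sum_orth (Q := fun i : 'I_n => @umat R l i k)) ij => [i'|]; first exact: umat_proj.
  exact: umat_col.
apply: (rproj_sum_orth (Q := fun i : 'I_n => @umat R l k i)) ij => [i'|]; first exact: umat_proj.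
exact: umat_row.
Qed.

Lemma v_magic : magic_system v.
Proof.
split=> //; split; last by move=> i j; rewrite v_row v_col.
split; last exact: v_orth.
split=> [i j|i j|i j].
- rewrite -(model_adj mb (ku_S i j)) [padj _]kreal_adj; congr bpi.
  by apply: kreal_ext => k; case: (@umat_proj R k i j).
- case: eqP => [<-|/eqP ij].
    by rewrite -(v_row i); apply: eq_bigr => l _; exact: v_idem.
  by apply: big1 => l _; case: (v_orth l ij).
- case: eqP => [<-|/eqP ij].
    by rewrite -(v_col i); apply: eq_bigr => l _; exact: v_idem.
  by apply: big1 => l _; case: (v_orth l ij).
Qed.

Lemma bpi_letter i j : bpi (letter sgen (Some (i, j))) = aone - 2%:R%:C *: (v i j ** v i j).
Proof.
rewrite v_idem letterE addrC -scaleNr (model_lin mb _ (ku_S i j) (b_one_S R site)) b1.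
by rewrite scaleNr addrC.
Qed.

End MagicSequences.

Section TensorValues.
Context (R : realType) (B A : cstarType R) (H K L : hilbertType R) (t : H -> K -> L).
Context (pi : B -> H -> H) (sigma : A -> K -> K).
Hypotheses (ht : is_hilbert_tensor t) (hpi : is_rep pi) (hs : is_rep sigma).

(** The action on lists respects equality of values because it is bounded: the list for the
    difference has value zero, and [fev_contract] sends it to value zero. *)
Lemma fev_linear (s : seq (B * A)) (c : R[i]) v v' : tval t v = c *: tval t v' ->
  tval t (fev pi sigma s v) = c *: tval t (fev pi sigma s v').
Proof.
move=> e; pose w := v ++ [seq ((- c) *: p.1, p.2) | p <- v'].
have w0 : tval t w = 0.
  rewrite /w tval_cat e {2}/tval big_map.
  under eq_bigr => p _ do rewrite (tensZl ht).
  by rewrite -scaler_sumr scaleNr subrr.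
have piZ b x : pi b ((- c) *: x) = (- c) *: pi b x.
  have pi0 : pi b 0 = 0.
    by have := repVP hpi b 1 0 0; rewrite !scale1r addr0 => /eqP;
      rewrite -subr_eq subrr eq_sym => /eqP.
  by rewrite -[_ *: x]addr0 (repVP hpi) pi0 addr0.
have fw : tval t (fev pi sigma s w) =
    tval t (fev pi sigma s v) - c *: tval t (fev pi sigma s v').
  rewrite !tval_fev scaler_sumr -sumrN -big_split; apply: eq_bigr => q _ /=.
  rewrite /w big_cat big_map /= -scaleNr scaler_sumr; congr (_ + _).
  by apply: eq_bigr => p _; rewrite piZ (tensZl ht).
have := fev_contract ht hpi hs s w; rewrite w0 nm0 mulr0 fw => h.
by apply/subr0_eq/nm_eq0/eqP; rewrite eq_le h nm_ge0.
Qed.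

End TensorValues.

Section Cut.
Context (R : realType) (T : nat -> finType) (k : nat).

Definition cut (x : kvec R T) : kvec R T := fun q => if tag q == k then x q else 0.

Lemma kact_cut x (xi : ell2 R (T k)) : kact (cut x) xi = kact x xi.
Proof. by apply/funext => i; rewrite /kact /ent /cut /= eqxx. Qed.

Lemma cut_bd x M : kbd k x M -> bbd (cut x) M.
Proof.
move=> hx l; have M0 : 0 <= M by case: hx.
have [e|ne] := eqVneq l k.
  by case: _ / (esym e) in hx *; split=> // xi; rewrite kact_cut; case: hx => _; exact.
split=> // xi; have -> : kact (cut x) xi = 0.
  by apply/funext => i; rewrite /kact big1 // => j _; rewrite /ent /cut /= (negbTE ne) mul0r.
by rewrite nm0 mulr_ge0 ?nm_ge0.
Qed.

End Cut.

Lemma hom_sum (R : realType) (A B : cstarType R) (f : A -> B) (I : Type) (r : seq I)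
    (F : I -> A) : star_hom f -> f (\sum_(i <- r) F i) = \sum_(i <- r) f (F i).
Proof.
move=> [fl _ _]; have f0 : f 0 = 0.
  by have := fl 1 0 0; rewrite !scale1r addr0 => /eqP;
    rewrite -subr_eq subrr eq_sym => /eqP.
elim: r => [|i r ih]; first by rewrite !big_nil f0.
by rewrite !big_cons -ih -[F i]scale1r fl !scale1r.
Qed.

Lemma homB (R : realType) (A B : cstarType R) (f : A -> B) (a b : A) :
  star_hom f -> f (a - b) = f a - f b.
Proof.
by move=> [fl _ _]; rewrite addrC -scaleN1r fl scaleN1r addrC.
Qed.

Lemma homZ (R : realType) (A B : cstarType R) (f : A -> B) (c : R[i]) (b : A) :
  star_hom f -> f (c *: b) = c *: f b.
Proof.
move=> hf; have [fl _ _] := hf.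
by have := fl c b 0; rewrite addr0 (_ : f 0 = 0) ?addr0 // -(subrr 0) homB // subrr.
Qed.

Section NotExact.
Context (R : realType) (m : nat).
Let n := m.+4.+1.
Context (A : unitalCstarType R) (u : 'I_n -> 'I_n -> A).
Hypothesis hu : orthogonal_system u.
Hypothesis hlift : forall (B : unitalCstarType R) (v : 'I_n -> 'I_n -> B), magic_system v ->
  exists f : A -> B, unital_star_hom f /\ forall i j, f (u i j) = v i j.

Let W := letters m.
Let x (w : W) : kvec R site := letter (@sgen R m) w.
Let a (w : W) : A := if w is Some (i, j) then refl u i j else aone.
Let g : R := growth W (gap_const R).
Let d : R := #|W|%:R.

Let d_gt0 : 0 < d. Proof. by rewrite ltr0n; apply/card_gt0P; exists None. Qed.

Let x1 w : bbd (x w) 1.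
Proof. by apply: letter_bd => k w'; exact: sgen_inv. Qed.

Let Sx w : bS (x w). Proof. by exists 1; exact: x1. Qed.

Let xsa w : kadj (x w) = x w.
Proof. by rewrite kreal_adj; apply: kreal_ext => k; case: (@sgen_inv R m k w). Qed.

Let xNone : x None = @kone R site. Proof. by rewrite -kreal1. Qed.

Let asa w : adj (a w) = a w.
Proof. by case: w => [[i j]|] /=; [exact: adj_refl | exact: adj_aone]. Qed.

Let ac (K : hilbertType R) (sigma : A -> K -> K) : is_rep sigma ->
  forall w eta, nm (sigma (a w) eta) <= nm eta.
Proof.
move=> hs [[i j]|] eta /=; first exact: refl_contract.
rewrite (le_trans (rep_contract hs _ _)) // -[leRHS]mul1r ler_wpM2r ?nm_ge0 //.
have : nm (aone : A) ^+ 2 = nm (aone : A) by rewrite -nm_star adj_aone amul1x.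
have := nm_ge0 (aone : A); rewrite expr2; move: (nm _) => c; nra.
Qed.

Let g_gt0 : 0 < g.
Proof. exact: (growth_gt0 None (gap_const_gt0 R) (gap_const_le1 R)). Qed.

Let g_lt : g < d.
Proof. exact: (growth_lt None (gap_const_gt0 R) (gap_const_le1 R)). Qed.

Let quotient_bound (Q : cstarType R) (qpi : kvec R site -> Q) (TQ : cstarType R)
    (tQ : Q -> A -> TQ) : cq_model (P := qpre R site) qpi -> is_min_tensor tQ ->
  nm (sval tQ [seq (qpi (x w), a w) | w <- enum W]) <= g.
Proof.
move=> mq hQ; apply/(sval_norm hQ); first exact: ltW.
move=> H K L t pi sigma ht hpi hs v.
apply: (moment_bound x1 xsa g_gt0 _ mq asa ac ht hpi hs) => l gam c c0 hg.
by apply: (kword_sum_bd (w0 := None) (@sgen_inv R m) _ (gap_const_gt0 R) (gap_const_le1 R)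
  (@sgen_gap R m) site_large).
Qed.

Let diag_tensor k : seq (ell2 R (site k) * ell2 R (site k)) :=
  [seq (delta R e, delta R e) | e <- enum (site k)].
Let Om k : ell2 R (site k * site k)%type := tval (@ell2tens R (site k) (site k)) (diag_tensor k).

Let OmE k p : @Om k p = (p.1 == p.2)%:R.
Proof.
rewrite /Om /tval big_map big_enum /=.
have sumE (r : seq (site k)) :
    (\sum_(e <- r) ell2tens (delta R e) (delta R e) : ell2 R (site k * site k)%type) p =
    \sum_(e <- r) delta R e p.1 * delta R e p.2.
  by elim: r => [|e r ih]; rewrite ?big_nil // !big_cons -ih.
rewrite sumE (bigD1 p.1) //= big1 ?addr0 /delta ?eqxx ?mul1r 1?eq_sym //.
by move=> e /negbTE ep; rewrite eq_sym ep mul0r.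
Qed.

Let Om_gt0 k : 0 < nm (@Om k).
Proof.
pose e : site k := (0, pzero k).
have : cnorm (@Om k (e, e)) <= nm (@Om k) by exact: ell2_coord.
by rewrite OmE eqxx cnorm1; exact: lt_le_trans.
Qed.

Let Om_inv k w : tval (@ell2tens R (site k) (site k))
    [seq (kact (x w) p.1, kact (x w) p.2) | p <- diag_tensor k] = @Om k.
Proof.
apply/funext => p; rewrite OmE /tval 2!big_map big_enum /=.
have sumE (r : seq (site k)) :
    (\sum_(e <- r) ell2tens (kact (x w) (delta R e)) (kact (x w) (delta R e)) :
      ell2 R (site k * site k)%type) p =
    \sum_(e <- r) (@sgen R m k w p.1 e * @sgen R m k w e p.2)%:C.
  elim: r => [|e r ih]; first by rewrite !big_nil.
  rewrite !big_cons -ih; congr (_ + _).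
  rewrite /ell2tens !kact_delta rmorphM; congr (_ * _).
  by have := congr1 (fun Y : rk R (site k) => Y p.2 e) (@sgen_inv R m k w).1; rewrite /rtr => ->.
rewrite sumE -rmorph_sum.
have := congr1 (fun Y : rk R (site k) => Y p.1 p.2) (@sgen_inv R m k w).2.
by rewrite /rmul /r1 => ->; case: eqP.
Qed.

Section AtLevel.
Context (B J : cstarType R) (bpi : kvec R site -> B) (jpi : kvec R site -> J) (fJ : J -> B)
  (f : A -> B).
Hypotheses (mb : cq_model (P := bpre R site) bpi) (mj : cq_model (P := jpre R site) jpi).
Hypotheses (fJE : forall y, jS y -> fJ (jpi y) = bpi y) (fhom : star_hom f).
Hypothesis fa : forall w, f (a w) = bpi (x w).
Context (rho : forall k, B -> ell2 R (site k) -> ell2 R (site k)).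
Hypotheses (hrho : forall k, is_rep (@rho k))
  (rhoE : forall k y xi, bS y -> @rho k (bpi y) xi = kact y xi).

Let st : seq (B * A) := [seq (bpi (x w), a w) | w <- enum W].
(** [A] acts on block [k] through [f], so that both legs of [st] become the same real symmetry, as
    the invariance of [Om] requires. *)
Let theta k (b : A) := @rho k (f b).
Let ev k (s : seq (B * A)) : ell2 R (site k * site k)%type :=
  tval (@ell2tens R (site k) (site k)) (fev (@rho k) (@theta k) s (diag_tensor k)).

Let htheta k : is_rep (@theta k).
Proof. exact: is_rep_comp fhom (@hrho k). Qed.

Let hell k := @ell2_hilbert_tensor R (site k) (site k).

Let ev_st k : tval (@ell2tens R (site k) (site k))
  (fev (@rho k) (@theta k) st (diag_tensor k)) = d%:C *: @Om k.
Proof.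
rewrite tval_fev /st big_map big_enum /=.
rewrite (eq_bigr (fun _ => @Om k)) => [|w _].
  by rewrite sumr_const /d rmorph_nat scaler_nat.
rewrite -[RHS](@Om_inv k w) /tval [RHS]big_map; apply: eq_bigr => p _ /=.
by rewrite /theta fa !rhoE.
Qed.

(** In the product [st] acts first, and [Om] is an eigenvector of it with eigenvalue [d]. For this
    reason the equation to be solved has its unknown to the left of the average. *)
Let ev_smul k s : @ev k (smul s st) = d%:C *: @ev k s.
Proof.
rewrite /ev (fev_smul _ (@hrho k) (@htheta k)).
exact: (fev_linear (@hell k) (@hrho k) (@htheta k) s (@ev_st k)).
Qed.

Let ev_small (sz : seq (J * A)) e : 0 < e ->
  exists K, forall k, (K <= k)%N -> nm (@ev k [seq (fJ q.1, q.2) | q <- sz]) <= e * nm (@Om k).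
Proof.
elim: sz e => [|[j b] sz ih] e e0.
  by exists 0%N => k _; rewrite /ev /tval /fev big_nil nm0 mulr_ge0 ?nm_ge0 ?ltW.
have e2 := divr_gt0 e0 (ltr0n R 2); have [K hK] := ih _ e2.
have nb : 0 < nm b + 1 by rewrite ltr_wpDl ?nm_ge0.
have [y [By hy] ->] := model_surj mj j.
have [K' hK'] := hy _ (divr_gt0 e2 nb).
exists (maxn K K') => k; rewrite geq_max => /andP [k1 k2].
rewrite /= /ev -cat1s fev_cat (le_trans (nmD _ _)) // [e]splitr mulrDl.
apply: lerD; last exact: hK.
(* At level [k] only the block [k] acts. So [y], whose norm in [B] need not be small, may be
   replaced by that block alone, whose norm is small. *)
have bc := cut_bd (hK' k k2); have Sc : bS (cut k y) by exists (e / 2 / (nm b + 1)).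
have -> : fev (@rho k) (@theta k) [:: (fJ (jpi y), b)] (diag_tensor k) =
    fev (@rho k) (@theta k) [:: (bpi (cut k y), b)] (diag_tensor k).
  rewrite /fev /= !cats0; apply: eq_map => p /=.
  by rewrite fJE // !rhoE // kact_cut.
apply: le_trans (fev1_contract (@hell k) (@hrho k) (@htheta k) _ _ _) _.
rewrite ler_wpM2r ?nm_ge0 //.
apply: le_trans (_ : e / 2 / (nm b + 1) * nm b <= _).
  by rewrite ler_wpM2r ?nm_ge0 // (model_le mb Sc bc).
by rewrite mulrAC ler_pdivrMr // ler_wpM2l ?(ltW e2) // lerDl.
Qed.

(* [sval st / d] fixes [Om k], so at [Om k] the first three terms add up to [- Om k], and the
   last one is small for large [k]. *)
Lemma no_approximate_inverse (TB : cstarType R) (tB : B -> A -> TB) (sv : seq (B * A))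
    (sz : seq (J * A)) (one : B) : is_min_tensor tB -> bpi (@kone R site) = one ->
  f aone = one ->
  nm (sval tB sv - tB one aone - sval tB sv ** ((d^-1)%:C *: sval tB st) -
    sval tB [seq (fJ q.1, q.2) | q <- sz]) <= 4^-1 -> False.
Proof.
move=> hB b1 f1.
set sj := [seq _ | _ <- _]; pose D := sv ++ sscale (- 1) [:: (one, aone : A)] ++
  sscale (- (d^-1)%:C) (smul sv st) ++ sscale (- 1) sj.
have -> : sval tB sv - tB one aone - sval tB sv ** ((d^-1)%:C *: sval tB st) - sval tB sj =
    sval tB D.
  rewrite /D !sval_cat !(sval_scale hB) (sval_smul hB) !scaleN1r scaleNr -amulZr.
  have -> : sval tB [:: (one, aone : A)] = tB one aone by rewrite /sval big_seq1.
  by rewrite !addrA.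
have q0 : 0 <= 4^-1 :> R by rewrite invr_ge0.
move=> /(sval_norm hB D q0) hD.
have q1 : 0 < 4^-1 :> R by rewrite invr_gt0.
have [K hK] := ev_small sz q1.
have := hD _ _ _ _ _ _ (@hell K) (@hrho K) (@htheta K) (diag_tensor K).
rewrite -/(@ev K D).
have -> : @ev K D = - (@Om K + @ev K sj).
  rewrite /ev /D !fev_cat !(fev_scale _ (@hell K) (@hrho K)) -!/(@ev K _) ev_smul.
  rewrite scalerA mulNr -rmorphM mulVf ?gt_eqF // scaleNr !scaleN1r scale1r.
  have -> : @ev K [:: (one, aone : A)] = @Om K.
    rewrite /ev /Om tval_fev big_seq1 /tval; apply: eq_bigr => p _ /=.
    by rewrite /theta f1 -b1 !(rhoE _ (b_one_S R site)) !kact1.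
  by rewrite addrCA addNKr opprD.
(* Both [Om + ev] and [ev] have at most a quarter of the norm of [Om], so [Om] would have at most
   half of its own norm. *)
rewrite nmN => h1; have h2 := hK K (leqnn _).
have h3 : nm (@Om K) <= nm (@Om K + @ev K sj) + nm (@ev K sj).
  by rewrite -{1}[@Om K](addrK (@ev K sj)) (le_trans (nmD _ _)) // nmN.
have := Om_gt0 K; move: h1 h2 h3; rewrite -/(@Om K).
move: (nm (@Om K)) (nm (@ev K sj)) (nm _) => p q r; lra.
Qed.

End AtLevel.

Lemma not_exact : ~ exact_cstar A.
Proof.
move=> exA.
have [B [bpi [mb b1]]] := @unital_model R site.
have [J [jpi mj]] : exists (J : cstarType R) (jpi : kvec R site -> J),
    cq_model (P := jpre R site) jpi by eexists; eexists; exact: cq_modelP.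
have [Q [qpi mq]] : exists (Q : cstarType R) (qpi : kvec R site -> Q),
    cq_model (P := qpre R site) qpi by eexists; eexists; exact: cq_modelP.
have [fJ [gQ [ex fJE gQE]]] := models_exact mb mj mq.
have [f [[fhom f1] fu]] := hlift (v_magic m mb b1).
have fa w : f (a w) = bpi (x w).
  case: w => [[i j]|]; last by rewrite /= f1 xNone b1.
  rewrite /x (bpi_letter mb b1) /a /refl homB // homZ // f1.
  by have [_ fM _] := fhom; rewrite fM fu.
pose rho k := projT1 (cid (matrix_rep mb k)).
have hrho k : is_rep (rho k) /\ forall y xi, bS y -> rho k (bpi y) xi = kact y xi.
  exact: (projT2 (cid (matrix_rep mb k))).
have [fJhom gQhom _ _ _] := ex.
have [TJ [TB [TQ [tJ [tB [tQ [F [G [[hJ hB hQ] [Fh Gh FE GE Fle]]]]]]]]]] :=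
  tensor_models A fJhom gQhom.
have [_ _ _ Gsurj Gker] := exA J B Q fJ gQ ex TJ TB TQ tJ tB tQ hJ hB hQ F G Fh Gh FE GE.
pose st := [seq (bpi (x w), a w) | w <- enum W].
pose ti : TB := (d^-1)%:C *: sval tB st.
have ny : nm (G ti) < 1.
  rewrite /ti (homZ _ _ Gh) nmZ cnormR ger0_norm ?invr_ge0 ?(ltW d_gt0) //.
  rewrite mulrC ltr_pdivrMr // mul1r; apply: le_lt_trans g_lt.
  have -> : G (sval tB st) = sval tQ [seq (qpi (x w), a w) | w <- enum W].
    rewrite /sval (hom_sum _ _ Gh) /st !big_map; apply: eq_bigr => w _ /=.
    by rewrite GE gQE.
  exact: quotient_bound mq hQ.
pose e := tB aone aone.
(* The sum of the geometric series [e + e y + e y^2 + ...] for [y = G ti], obtained as a fixed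
   point; its radius is the sum of the norms. This form needs no unit in [TQ]. *)
have [v _ vE] : exists2 v, nm v <= nm (G e) / (1 - nm (G ti)) & G e + v ** G ti = v.
  have r1 : 0 < 1 - nm (G ti) by rewrite subr_gt0.
  apply: (ball_fixed_point (f := fun v => G e + v ** G ti) (q := nm (G ti))) => //.
  - by rewrite divr_ge0 ?nm_ge0 ?(ltW r1).
  - exact: nm_ge0.
  - move=> v hv; rewrite (le_trans (nmD _ _)) //.
    apply: (@le_trans _ _ (nm (G e) + nm (G e) / (1 - nm (G ti)) * nm (G ti))).
      by rewrite lerD2l (le_trans (nmM _ _)) // ler_wpM2r ?nm_ge0.
    rewrite le_eqVlt; apply/orP; left; apply/eqP; field.
    by rewrite gt_eqF.
  - move=> v w _ _; rewrite opprD addrACA subrr add0r -amulBl mulrC.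
    exact: nmM.
have [vt vtE] := Gsurj v.
(* Exactness in the middle is used here: the defect of the lifted equation vanishes in [TQ], hence
   comes from [TJ]. *)
have [z zE] : exists z, F z = vt - e - vt ** ti.
  apply/Gker; rewrite !homB //; have [_ GM _] := Gh; rewrite GM vtE -{1}vE.
  by rewrite addrAC addrK subrr.
(* Replacing [vt] and [z] by finite sums of tensors costs [eps + eps + eps * nm ti], which this
   choice makes equal to [1/4]. *)
pose eps := (4 * (2 + nm ti))^-1.
have eps0 : 0 < eps by rewrite invr_gt0 mulr_gt0 // ltr_pwDl ?nm_ge0.
have [sv hsv] := sval_approx hB vt eps0.
have [sz hsz] := sval_approx hJ z eps0.
apply: (@no_approximate_inverse B J bpi jpi fJ f mb mj fJE fhom fa rho
  (fun k => (hrho k).1) (fun k => (hrho k).2) TB tB sv sz aone hB b1 f1).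
have -> : sval tB [seq (fJ q.1, q.2) | q <- sz] = F (sval tJ sz).
  by rewrite /sval (hom_sum _ _ Fh) big_map; apply: eq_bigr => q _; rewrite FE.
rewrite -/st -/ti -/e.
have -> : sval tB sv - e - sval tB sv ** ti - F (sval tJ sz) =
    F (z - sval tJ sz) - (vt - sval tB sv) + (vt - sval tB sv) ** ti.
  rewrite homB // zE amulBl; move: (vt ** ti) (sval tB sv ** ti) (F _) => p q r.
  rewrite opprB !addrA [RHS](ACl (((1 * 6) * (3 * 7)) * (5 * 2 * 8 * 4))%AC) /=.
  by rewrite subrr addNr !add0r.
apply: (@le_trans _ _ (eps + eps + eps * nm ti)).
  rewrite (le_trans (nmD _ _)) // lerD //.
    by rewrite (le_trans (nmD _ _)) // nmN lerD // (le_trans (Fle _)).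
  by rewrite (le_trans (nmM _ _)) // ler_wpM2r ?nm_ge0.
rewrite /eps le_eqVlt; apply/orP; left; apply/eqP; field.
by rewrite gt_eqF // ltr_pwDl ?nm_ge0.
Qed.

End NotExact.

Theorem corollary5p9 (R : realType) (n : nat) (hn : (5 <= n)%N) :
  (forall (A : unitalCstarType R) (u : 'I_n -> 'I_n -> A),
     is_A_On u -> ~ exact_cstar A) /\
  (forall (A : unitalCstarType R) (u : 'I_n -> 'I_n -> A),
     is_A_Bn_sharp u -> ~ exact_cstar A) /\
  (forall (A : unitalCstarType R) (u : 'I_n -> 'I_n -> A),
     is_A_Bn' u -> ~ exact_cstar A) /\
  (forall (A : unitalCstarType R) (u : 'I_n -> 'I_n -> A),
     is_A_Bn u -> ~ exact_cstar A) /\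
  (forall (A : unitalCstarType R) (u : 'I_n -> 'I_n -> A),
     is_A_Hn u -> ~ exact_cstar A) /\
  (forall (A : unitalCstarType R) (u : 'I_n -> 'I_n -> A),
     is_A_Sn' u -> ~ exact_cstar A) /\
  (forall (A : unitalCstarType R) (u : 'I_n -> 'I_n -> A),
     is_A_Sn u -> ~ exact_cstar A).
Proof.
(* Each of the seven sets of relations lies between the orthogonal and the magic ones. The first
   gives the contractions in [A], the second the homomorphism from [A] to matrix sequences. *)
have key (P : forall A : unitalCstarType R, ('I_n -> 'I_n -> A) -> Prop) :
    (forall (A : unitalCstarType R) (u : 'I_n -> 'I_n -> A), P A u -> orthogonal_system u) ->
    (forall (A : unitalCstarType R) (u : 'I_n -> 'I_n -> A), magic_system u -> P A u) ->
    forall (A : unitalCstarType R) (u : 'I_n -> 'I_n -> A), is_universal P u -> ~ exact_cstar A.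
  case: n hn P => [|[|[|[|[|m]]]]] // _ P Po mP A u [Pu _ lift].
  by apply: (@not_exact R m A u (Po _ _ Pu)) => B v /mP; exact: lift.
have row_comm (A : unitalCstarType R) (u : 'I_n -> 'I_n -> A) :
    (forall i, row_sum u i = aone) ->
    forall i j l, u i j ** row_sum u l = row_sum u l ** u i j.
  by move=> r1 i j l; rewrite r1 amul1x amulx1.
split; first by apply: key => [A u|A u [[[h _] _] _]].
split; first by apply: key => [A u [h _]|A u [[[h _] e] _]].
split.
  apply: key => [A u [[h _] _]|A u [[[h _] e] r]] //.
  by split=> //; exact: row_comm.
split.
  apply: key => [A u [[[h _] _] _]|A u [[[h _] e] r]] //.
  by split=> //; split=> //; exact: row_comm.
split; first by apply: key => [A u [h _]|A u [[c _] _]].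
split; first by apply: key => [A u [[h _] _]|A u [c _]].
by apply: key => [A u [[[h _] _] _]|A u].
Qed.
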